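(* Let $N\ge1$ be an integer and $2_*:=2+\frac4{N+1}$. For every compact metric graph $\mathcal G$, the limit $$K^\infty_{\mathbb R^N\times\mathcal G,2_*}:=\lim_{B\to+\infty}K_{\mathbb R^N\times\mathcal G,2_*,B}$$ exists. Moreover, $K_{\mathbb R^{N+1},2_*}\le K^\infty_{\mathbb R^N\times\mathcal G,2_*}\le K_{\mathbb R^{N+1}_+,2_*}$, and $$K^\infty_{\mathbb R^N\times\mathcal G,2_*}=K_{\mathbb R^{N+1},2_*}\quad\text{if }\mathcal G\text{ can be covered by cycles},$$ $$K^\infty_{\mathbb R^N\times\mathcal G,2_*}=K_{\mathbb R^{N+1}_+,2_*}=2^{\frac2{N+1}}K_{\mathbb R^{N+1},2_*}\quad\text{if }\mathcal G\text{ contains a terminal edge}.$$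
   Context: A compact metric graph $\mathcal G$ is a connected graph with finitely many edges (edge set $\mathfrak E$) and vertices, each edge $e$ being identified with an interval $[0,\ell_e]$, $0<\ell_e<\infty$, whose endpoints are glued at vertices (self-loops and multiple edges allowed); $l(\mathcal G)=\sum_e\ell_e$. A terminal edge is an edge having an endpoint at a vertex of degree one. $\mathcal G$ can be covered by cycles if every edge belongs to a cycle, i.e. to a closed path with no self-intersections except possibly at finitely many points. All functions are real-valued. $H^1(\mathbb R^N\times\mathcal G)$ is the set of $u=\{u_e\}_{e\in\mathfrak E}$ with $u_e\in H^1(\mathbb R^N\times e)$ for every $e$, and equal traces (in $L^2(\mathbb R^N)$) on $\mathbb R^N\times\{v\}$ from any two edges meeting at the vertex $v$; $L^p$ norms are the sums over edges of those on $\mathbb R^N\times e\subset\mathbb R^{N+1}$, and $\|\nabla_{x,y}u\|_2^2=\|\nabla_xu\|_2^2+\|\partial_yu\|_2^2$. For $B>0$, $$K_{\mathbb R^N\times\mathcal G,2_*,B}=\sup_{u\in H^1(\mathbb R^N\times\mathcal G)\setminus\{0\}}\frac{\|u\|_{2_*}^{2_*}}{\big(\|\nabla_{x,y}u\|_2^2+\frac{B}{l(\mathcal G)^2}\|u\|_2^2\big)\|u\|_2^{2_*-2}}.$$ For $\Omega=\mathbb R^{N+1}$ or $\Omega=\mathbb R^{N+1}_+=\mathbb R^N\times[0,+\infty)$, $$K_{\Omega,2_*}=\sup_{u\in H^1(\Omega)\setminus\{0\}}\frac{\|u\|_{L^{2_*}(\Omega)}^{2_*}}{\|\nabla u\|_{L^2(\Omega)}^{2}\|u\|_{L^2(\Omega)}^{2_*-2}}.$$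 *)

(* Defs.v *)
From HB Require Import structures.
From mathcomp Require Import all_boot all_order all_algebra.
From mathcomp Require Import all_classical all_reals all_analysis.
Set Implicit Arguments.
Unset Strict Implicit.
Unset Printing Implicit Defensive.
Import Order.TTheory GRing.Theory Num.Theory.
Import numFieldNormedType.Exports.
Local Open Scope classical_set_scope.
Local Open Scope ring_scope.

Section measurable_rV.
Context {d} {T : measurableType d}.
Variable n : nat.

Let coors : 'I_n -> 'rV[T]_n -> T := fun i x => x ord0 i.

Let rV_set0 : g_sigma_preimage coors set0.
Proof. exact: sigma_algebra0. Qed.

Let rV_setC A : g_sigma_preimage coors A -> g_sigma_preimage coors (~` A).
Proof. exact: sigma_algebraC. Qed.

Let rV_bigcup (F : _^nat) : (forall i, g_sigma_preimage coors (F i)) ->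
  g_sigma_preimage coors (\bigcup_i (F i)).
Proof. exact: sigma_algebra_bigcup. Qed.

(* for T := R, the Borel sets of R^n *)
HB.instance Definition _ := @isMeasurable.Build (measure_tuple_display d)
  'rV[T]_n (g_sigma_preimage coors) rV_set0 rV_setC rV_bigcup.

Lemma measurable_coor (i : 'I_n) :
  measurable_fun [set: 'rV[T]_n] (fun x : 'rV[T]_n => x ord0 i).
Proof.
move=> _ Y mY; rewrite setTI; apply: sub_sigma_algebra => /=.
rewrite -bigcup_seq/=; exists i => /=; first by rewrite mem_index_enum.
by exists Y => //; rewrite setTI.
Qed.

End measurable_rV.

Lemma measurable_fun_rV d1 d2 (T1 : measurableType d1) (T2 : measurableType d2)
    n (f : T1 -> 'rV[T2]_n) :
  (forall i, measurable_fun [set: T1] (fun t => f t ord0 i)) ->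
  measurable_fun [set: T1] f.
Proof.
move=> mf.
have prefS : g_sigma_preimage (fun i => (fun x : 'rV[T2]_n => x ord0 i) \o f)
    `<=` measurable.
  apply: smallest_sub; first exact: sigma_algebra_measurable.
  case: n => [|n] in f mf *; first by rewrite big_ord0.
  rewrite -bigcup_mkord_ord; apply: bigcup_sub => i Ii.
  by move=> A [B mB <-]; exact: mf.
rewrite g_sigma_preimage_comp in prefS.
by move=> _ A mA; apply: prefS; exists A.
Qed.

(* the point (x, y) of R^n x R = R^(n+1) : y is the last coordinate *)
Definition rV_rcons (T : Type) n (p : 'rV[T]_n * T) : 'rV[T]_n.+1 :=
  \row_(i < n.+1) oapp (p.1 ord0) p.2 (unlift ord_max i).

Definition rV_unrcons (T : Type) n (z : 'rV[T]_n.+1) : 'rV[T]_n * T :=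
  (\row_(i < n) z ord0 (lift ord_max i), z ord0 ord_max).

Lemma rV_rconsK T n : cancel (@rV_rcons T n) (@rV_unrcons T n).
Proof.
move=> [x y]; congr (_, _); last by rewrite mxE unlift_none.
by apply/rowP => i; rewrite !mxE liftK.
Qed.

Section leb_step.
Context {R : realType}.
Variables (n : nat) (m : {sigma_finite_measure set 'rV[R]_n -> \bar R}).

Let rcons_fun : 'rV[R]_n * measurableTypeR R -> 'rV[R]_n.+1 := @rV_rcons R n.
Let unrcons_fun : 'rV[R]_n.+1 -> 'rV[R]_n * measurableTypeR R :=
  @rV_unrcons R n.

Lemma measurable_rV_rcons : measurable_fun setT rcons_fun.
Proof.
apply: measurable_fun_rV => i; rewrite /rcons_fun /rV_rcons.
under eq_fun do rewrite mxE.
case: unliftP => [j _|_] /=; last exact: measurable_snd.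
apply: (@measurableT_comp _ _ _ _ _ _ (fun x : 'rV[R]_n => x ord0 j)).
  exact: measurable_coor.
exact: measurable_fst.
Qed.

Lemma measurable_rV_unrcons : measurable_fun setT unrcons_fun.
Proof.
apply/measurable_fun_pairP; split; last exact: measurable_coor.
apply: measurable_fun_rV => i; rewrite /unrcons_fun /=.
under eq_fun do rewrite mxE.
exact: measurable_coor.
Qed.

Definition leb_step : set 'rV[R]_n.+1 -> \bar R :=
  pushforward (m \x lebesgue_measure)%E rcons_fun.

Let leb_step0 : leb_step set0 = 0%E.
Proof. by rewrite /leb_step /pushforward preimage_set0 measure0. Qed.

Let measurable_preimage_rcons A :
  measurable A -> measurable (rcons_fun @^-1` A).
Proof. by rewrite -[X in _ -> measurable X]setTI; exact: measurable_rV_rcons. Qed.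

Let leb_step_ge0 A : (0 <= leb_step A)%E.
Proof. by rewrite /leb_step /pushforward; exact: measure_ge0. Qed.

Let leb_step_sigma_additive : semi_sigma_additive leb_step.
Proof.
move=> F mF tF mUF; rewrite /leb_step /pushforward preimage_bigcup.
apply: measure_semi_sigma_additive.
- by move=> k; exact: measurable_preimage_rcons.
- apply/trivIsetP => /= i j _ _ ij; rewrite -preimage_setI.
  by move/trivIsetP : tF => /(_ _ _ _ _ ij) ->//; rewrite preimage_set0.
- by rewrite -preimage_bigcup; exact: measurable_preimage_rcons.
Qed.

HB.instance Definition _ := isMeasure.Build _ _ _ leb_step
  leb_step0 leb_step_ge0 leb_step_sigma_additive.

Let leb_step_sigma_finite : sigma_finite setT leb_step.
Proof.
have /sigma_finiteP[F [TF ndF Foo]] := sigma_finiteT m.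
have /sigma_finiteP[H [TH ndH Hoo]] := sigma_finiteT (@lebesgue_measure R).
exists (fun k => unrcons_fun @^-1` (F k `*` H k)).
  rewrite -preimage_bigcup (_ : \bigcup_k _ = setT) ?preimage_setT//.
  rewrite predeqE => -[x y]; split => // _.
  have [k _ Fkx] : (\bigcup_k F k) x by rewrite -TF.
  have [l _ Hly] : (\bigcup_k H k) y by rewrite -TH.
  exists (maxn k l) => //; split => /=.
  - by move: x Fkx; exact/subsetPset/ndF/leq_maxl.
  - by move: y Hly; exact/subsetPset/ndH/leq_maxr.
move=> k; have [mF Fk] := Foo k; have [mH Hk] := Hoo k; split.
  rewrite -[X in measurable X]setTI.
  by apply: measurable_rV_unrcons => //; exact: measurableX.
rewrite /leb_step /pushforward -comp_preimage.
rewrite (_ : unrcons_fun \o rcons_fun = id); last exact/funext/rV_rconsK.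
by rewrite product_measure1E// lte_mul_pinfty// ge0_fin_numE.
Qed.

HB.instance Definition _ := Measure_isSigmaFinite.Build _ _ _ leb_step
  leb_step_sigma_finite.

End leb_step.

Fixpoint leb (R : realType) (n : nat) :
    {sigma_finite_measure set 'rV[R]_n -> \bar R} :=
  match n with
  | 0%N => dirac (0 : 'rV[R]_0)
  | n'.+1 => leb_step (leb R n')
  end.

Section sobolev.
Context {R : realType}.

Section Lp.
Variable n : nat.
Implicit Types (D : set 'rV[R]_n) (f : 'rV[R]_n -> R) (p : R).

(* ||f||_p^p on D *)
Definition Lpow D p f : \bar R := \int[leb R n]_(z in D) (`|f z| `^ p)%:E.

Definition L2 D f : Prop := measurable_fun D f /\ (Lpow D 2 f < +oo)%E.

End Lp.

Section weak_derivatives.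
Variable n : nat.
Implicit Types (D : set 'rV[R]_n) (u f : 'rV[R]_n -> R).
Implicit Types (g : 'I_n -> 'rV[R]_n -> R).

Definition partial (i : 'I_n) f : 'rV[R]_n -> R :=
  fun z => 'D_(delta_mx ord0 i) f z.

(* C^oo : all iterated partial derivatives exist and are continuous *)
Definition smooth f : Prop := forall s : seq 'I_n,
  let h := foldr partial f s in
  continuous h /\ forall i z, derivable h z (delta_mx ord0 i).

Definition fsupport f : set 'rV[R]_n := closure [set z | f z != 0].

Definition Cc f : Prop := smooth f /\ compact (fsupport f).

Definition is_weak_partial D (i : 'I_n) u f : Prop :=
  forall phi, Cc phi -> fsupport phi `<=` D ->
    (\int[leb R n]_(z in D) (u z * partial i phi z) =
     - \int[leb R n]_(z in D) (f z * phi z))%R.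

(* u belongs to H^1(D), D open, and g is its weak gradient; g is determined
   by u up to a negligible set *)
Definition H1 D u g : Prop :=
  L2 D u /\ forall i, L2 D (g i) /\ is_weak_partial D i u (g i).

(* ||g||_2^2 on D, to be used with the weak gradient g *)
Definition dirichlet D g : \bar R := (\sum_(i < n) Lpow D 2 (g i))%E.

Definition H1dist2 D u g f : \bar R :=
  (Lpow D 2 (f \- u)%R + dirichlet D (fun i => (partial i f \- g i)%R))%E.

End weak_derivatives.

(* h is the trace on R^N x {y} of u in H^1(D), D in R^N x R = R^(N+1): the
   trace is the continuous extension to H^1(D) of the restriction to
   R^N x {y} of functions of class C_c^oo(R^(N+1)) *)
Definition is_trace (N : nat) (D : set 'rV[R]_N.+1) (u : 'rV[R]_N.+1 -> R)
    (g : 'I_N.+1 -> 'rV[R]_N.+1 -> R) (y : R) (h : 'rV[R]_N -> R) : Prop :=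
  L2 setT h /\
  exists phi : nat -> 'rV[R]_N.+1 -> R,
    [/\ forall k, Cc (phi k),
        H1dist2 D u g (phi k) @[k --> \oo] --> 0%E &
        Lpow setT 2 (fun x => phi k (rV_rcons (x, y)) - h x)%R
          @[k --> \oo] --> 0%E].

End sobolev.

(* The edge e is the interval [0, len e]; its end y = 0 is glued at the vertex
   gend e false, its end y = len e at the vertex gend e true. The field
   gedge_gt0 excludes the graph reduced to a point, which has length 0. *)
Record metric_graph (R : realType) := MetricGraph {
  gvertex : finType;
  gedge : finType;
  gend : gedge -> bool -> gvertex;
  len : gedge -> R;
  len_gt0 : forall e, 0 < len e;
  gedge_gt0 : (0 < #|gedge|)%N;
  gconnected : forall v w : gvertex,
    connect [rel a b | [exists e, exists t,
      (gend e t == a) && (gend e (~~ t) == b)]] v w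
}.

Section graph.
Context {R : realType}.
Variable G : metric_graph R.
Local Notation E := (gedge G).

Definition total_length : R := \sum_(e : E) len e.

Definition degree (v : gvertex G) : nat :=
  #|[set d : E * bool | gend d.1 d.2 == v]%SET|.

Definition terminal_edge (e : E) : Prop := exists t, degree (gend e t) = 1%N.

Definition has_terminal_edge : Prop := exists e, terminal_edge e.

(* The pair d = (e, t) is the edge e run through from the end t to the end
   ~~ t. Self-intersections at finitely many points are repetitions of
   vertices, so that a cycle is a closed path which repeats no edge. *)
Definition is_cycle (c : seq (E * bool)) : Prop :=
  cycle [rel d d' | gend d.1 (~~ d.2) == gend d'.1 d'.2] c /\
  uniq [seq d.1 | d <- c].

Definition covered_by_cycles : Prop :=
  forall e : E, exists2 c, is_cycle c & e \in [seq d.1 | d <- c].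

End graph.

Definition two_star (R : realType) (N : nat) : R := 2 + 4 / N.+1%:R.

Section constants.
Context {R : realType}.
Variable N : nat.
Local Notation X := 'rV[R]_N.+1.
Local Notation q := (two_star R N).

(* R^N x ]0, l[ *)
Definition strip (l : R) : set X := [set z | 0 < z ord0 ord_max < l].

Definition half_space : set X := [set z | 0 < z ord0 ord_max].

(* D is the interior of Omega. The quotient does not depend on the choice of
   the weak gradient g of u, and Lpow D 2 u != 0 says that u is not the zero
   class; its denominator is then positive and finite. *)
Definition K_domain (D : set X) : \bar R := ereal_sup
  [set r | exists u g, [/\ H1 D u g, Lpow D 2 u != 0%E &
    r = (Lpow D q u /
         (dirichlet D g * (Lpow D 2 u `^ 2^-1) `^ (q - 2)))%E]].

Variable G : metric_graph R.
Implicit Types (u : gedge G -> X -> R) (g : gedge G -> 'I_N.+1 -> X -> R).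

Definition Lpow_graph (p : R) u : \bar R :=
  (\sum_(e : gedge G) Lpow (strip (len e)) p (u e))%E.

Definition dirichlet_graph g : \bar R :=
  (\sum_(e : gedge G) dirichlet (strip (len e)) (g e))%E.

(* u belongs to H^1(R^N x G) and g is its weak gradient; h v is the common
   trace on R^N x {v} *)
Definition H1_graph u g : Prop :=
  (forall e, H1 (strip (len e)) (u e) (g e)) /\
  exists h : gvertex G -> 'rV[R]_N -> R, forall (e : gedge G) (t : bool),
    is_trace (strip (len e)) (u e) (g e) (if t then len e else 0)
      (h (gend e t)).

Definition K_graph (B : R) : \bar R := ereal_sup
  [set r | exists u g, [/\ H1_graph u g, Lpow_graph 2 u != 0%E &
    r = (Lpow_graph q u /
         ((dirichlet_graph g
             + (B / total_length G ^+ 2)%:E * Lpow_graph 2 u)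
          * (Lpow_graph 2 u `^ 2^-1) `^ (q - 2)))%E]].

End constants.

(* Main.v *)
(* Write s = 2 / (N + 1), so that 2_* = 2 + 2 s.

   Finiteness of the constant of R^(N+1) is a Gagliardo-Nirenberg inequality
   for test functions, proved by induction on the dimension: the inequality in
   dimension n is interpolated with L^2 and applied to the slices of a function
   of n + 1 variables, whose masses are at most 2 ||f||_2 ||grad f||_2. Density
   of test functions in H^1 then transfers inequalities to the whole of H^1.

   K_half = 2^s K: the even reflection of u in H^1(R^(N+1)_+) doubles all the
   integrals, which gives <=; a test function translated so that y = 0 bisects
   its mass splits into two functions on half-spaces, which gives >=.

   Lower bounds: a test function is concentrated by scaling inside an edge, or
   at the end of a terminal edge, where the term in B / l^2 disappears in the
   limit.

   Upper bounds: each edge is cut into two half-edges by smooth cutoffs with n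
   disjoint transition zones. Averaging over the zones loses a fraction O(1/n)
   of the L^{2_*} mass, and the gradients of the cutoffs cost a multiple of
   ||u||_2^2, absorbed by B. A half-edge is a function on the half-space, hence
   the bound K_half. If G is covered by cycles, every vertex has at least two
   half-edges; a cyclic permutation of them pairs each half-edge with the next
   one at the same vertex, and since their traces agree the two glue across
   y = 0 into a function of H^1(R^(N+1)), hence the bound K. *)
From HB Require Import structures.
Require Import Defs.
From mathcomp Require Import all_boot all_order all_algebra.
From mathcomp Require Import all_classical all_reals all_analysis.
From mathcomp Require Import measurable_realfun ring lra.
Set Implicit Arguments.
Unset Strict Implicit.
Unset Printing Implicit Defensive.
Import Order.TTheory GRing.Theory Num.Theory.
Import numFieldNormedType.Exports.
Local Open Scope classical_set_scope.
Local Open Scope ring_scope.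

(** * Lebesgue measure on R^n *)

(** Since [(N + 1) s = 2], a dilation of ratio [lam] multiplies the L^{2_*} term and the product of
    the Dirichlet integral with the power s of the mass by the same factor [lam^-(N+1)].
    Concentration is therefore free, and the term in B gains a factor [lam^-2].

    In the upper bound the Dirichlet integrals of the pieces add up while the power s bears on the
    total mass, so inequalities for pieces can be summed with one constant. This needs cutoffs with
    [eta^2 + (1 - eta)^2 <= 1]. A single cut might fall where u concentrates, hence the average over
    disjoint zones.

    No trace theorem is proved. Equality of traces at a vertex enters only through Green's formula,
    as equality of two linear functionals on test functions, and this is exactly what gluing across
    [y = 0] requires.

    A perfect matching of the half-edges does not exist at a vertex of odd degree. With a
    permutation without fixed points, each half-edge is counted twice on both sides of the summed
    inequality. *)

Section affine1D.
Context {R : realType}.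
Variables (c a : R) (c0 : c != 0).

Definition aff1 : measurableTypeR R -> measurableTypeR R := fun y : R => c * y + a.

Lemma measurable_aff1 : measurable_fun setT aff1.
Proof. by apply: measurable_funD => //; exact: measurable_funM. Qed.

Let m1 := measure_function_pushforward__canonical__measure_function_Measure
  (lebesgue_measure : {measure set (measurableTypeR R) -> \bar R}) measurable_aff1.

Lemma aff1_preimage (x y : R) : aff1 @^-1` `]x, y]%classic =
  if 0 < c then `](x - a) / c, (y - a) / c]%classic
  else `[(y - a) / c, (x - a) / c[%classic.
Proof.
have [cp|cn|ce] := ltgtP 0 c; last by move: c0; rewrite -ce eqxx.
- apply/seteqP; split => z; rewrite /aff1 /= !in_itv/= => /andP[h1 h2].
    by rewrite ltr_pdivrMr// ler_pdivlMr//; apply/andP; split; lra.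
  by move: h1 h2; rewrite ltr_pdivrMr// ler_pdivlMr// => h1 h2; apply/andP; split; lra.
- apply/seteqP; split => z; rewrite /aff1 /= !in_itv/= => /andP[h1 h2].
    by rewrite ltr_ndivlMr// ler_ndivrMr//; apply/andP; split; lra.
  by move: h1 h2; rewrite ltr_ndivlMr// ler_ndivrMr// => h1 h2; apply/andP; split; lra.
Qed.

(** Both sides are measures, so agreement on the intervals []x, y]] suffices. For [c < 0] the
    preimage is half-open on the other side, which does not change its length. *)
Lemma lebesgue_measure_aff1 (A : set R) : measurable A ->
  lebesgue_measure A = mscale (NngNum (normr_ge0 c)) m1 A.
Proof.
move=> mA.
apply: lebesgue_measure_unique => //= _ [[x y]] _ <-.
rewrite /mscale/= /pushforward aff1_preimage.
have [cp|cn|ce] := ltgtP 0 c; last by move: c0; rewrite -ce eqxx.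
- rewrite !lebesgue_measure_itv/= !lte_fin ltr_pM2r ?invr_gt0// ltrD2r.
  case: ifPn => _; last by rewrite mule0.
  by rewrite -!EFinB -EFinM; congr EFin; rewrite gtr0_norm//; field; lra.
- rewrite !lebesgue_measure_itv/= !lte_fin ltr_nM2r ?invr_lt0// ltrD2r.
  case: ifPn => _; last by rewrite mule0.
  by rewrite -!EFinB -EFinM; congr EFin; rewrite ltr0_norm//; field; lra.
Qed.

Lemma ge0_integral_aff1 (f : R -> \bar R) :
  measurable_fun [set: R] f -> (forall y, (0 <= f y)%E) ->
  (`|c|%:E * \int[lebesgue_measure]_y f (c * y + a)%R = \int[lebesgue_measure]_y f y)%E.
Proof.
move=> mf f0; rewrite [RHS](eq_measure_integral (mscale (NngNum (normr_ge0 c)) m1)); last first.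
  by move=> A mA _; exact: lebesgue_measure_aff1.
rewrite ge0_integral_mscale//=; congr (_ * _)%E.
by rewrite (ge0_integral_pushforward measurable_aff1 lebesgue_measure measurableT mf)//.
Qed.

End affine1D.

(** * Measurability, Fubini and affine changes of variables on row vectors *)

Section rV_measure.
Context {R : realType}.
Local Notation mu n := (leb R n).

(** The measurable sets are generated by the coordinates, not by the open sets, so continuity does
    not give measurability at once. [f] is the pointwise limit of [f \o r k], where [r k] rounds
    each coordinate down to the grid of mesh [1 / (k + 1)]; these functions are constant on
    countably many measurable cells. *)
Lemma continuous_measurable_rV n (f : 'rV[R]_n -> R) :
  continuous f -> measurable_fun setT f.
Proof.
move=> cf.
pose r k (z : 'rV[R]_n) : 'rV[R]_n :=
  \row_i ((Num.floor (z ord0 i * k.+1%:R))%:~R / k.+1%:R).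
apply: (measurable_fun_cvg (h := fun k => f \o r k)).
  move=> k _ Y mY; rewrite setTI.
  pose fl (z : 'rV[R]_n) : 'rV[int]_n :=
    \row_i Num.floor (z ord0 i * k.+1%:R).
  pose up (w : 'rV[int]_n) : 'rV[R]_n := \row_i ((w ord0 i)%:~R / k.+1%:R).
  have rE z : r k z = up (fl z) by apply/rowP => i; rewrite !mxE.
  rewrite (_ : _ @^-1` Y = \bigcup_w if `[< Y (f (up w)) >] then [set z | fl z = w] else set0); last first.
    apply/seteqP; split => z /=; rewrite rE.
      by move=> Yz; exists (fl z) => //; case: asboolP.
    by move=> [w _]; case: asboolP => [Yw /= ->|_ []].
  apply: countable_bigcupT_measurable => [|w]; first exact: countableP.
  case: ifP => // _.
  rewrite (_ : [set z | fl z = w] = \bigcap_(i in [set: 'I_n]) [set z | Num.floor (z ord0 i * k.+1%:R) = w ord0 i]); last first.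
    apply/seteqP; split => [z /= <- i _|z /= h]; first by rewrite mxE.
    by apply/rowP => i; rewrite mxE; exact: h.
  apply: fin_bigcap_measurable => // i _.
  rewrite (_ : (fun a => _) = (fun z : 'rV[R]_n => z ord0 i) @^-1`
    `[((w ord0 i)%:~R / k.+1%:R), ((w ord0 i + 1)%:~R / k.+1%:R)[); last first.
    apply/seteqP; split => z /=; rewrite in_itv/= ler_pdivrMr// ltr_pdivlMr//.
      by move=> <-; exact: floor_itv.
    by move/floor_def.
  rewrite -[X in measurable X]setTI; exact: measurable_coor.
move=> z _.
apply: (@cvg_comp _ _ _ (fun k => r k z) f _ (nbhs z)); last exact: cf.
apply/cvgrPdist_le => e e0; near=> k.
have k0 : 0 < k.+1%:R :> R by [].
rewrite /Num.norm/= mx_normrE; apply: bigmax_le; first exact: ltW.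
move=> [i j] _ /=; rewrite !mxE (ord1 i).
have /andP[h1 h2] := floor_itv (z ord0 j * k.+1%:R).
rewrite ger0_norm; last by rewrite subr_ge0 ler_pdivrMr.
rewrite lerBlDr -lerBlDl ler_pdivlMr// mulrBl.
rewrite intrD in h2.
suff : 1 <= e * k.+1%:R by lra.
rewrite mulrC -ler_pdivrMr//.
near: k; exists (Num.truncn e^-1).+1 => // k /= hk.
have := truncnS_gt e^-1; rewrite mul1r => /ltW /le_trans; apply.
by rewrite ler_nat ltnW.
Unshelve. all: by end_near. Qed.

Let rc n : 'rV[R]_n * measurableTypeR R -> 'rV[R]_n.+1 := @rV_rcons R n.

Lemma measurable_rcons_comp n d (T : measurableType d) (f : 'rV[R]_n.+1 -> T) :
  measurable_fun [set: 'rV[R]_n.+1] f -> measurable_fun setT (f \o @rc n).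
Proof. by move=> mf; apply: measurableT_comp => //; exact: measurable_rV_rcons. Qed.

Lemma leb_pushforward n (f : 'rV[R]_n.+1 -> \bar R) :
  measurable_fun [set: 'rV[R]_n.+1] f -> (forall z, (0 <= f z)%E) ->
  (\int[mu n.+1]_z f z = \int[mu n \x lebesgue_measure]_p f (rc p))%E.
Proof.
move=> mf f0.
have E := ge0_integral_pushforward (@measurable_rV_rcons R n)
  (mu n \x lebesgue_measure)%E measurableT mf (fun z _ => f0 z).
by rewrite preimage_setT in E; exact: E.
Qed.

Lemma integrable_leb_pushforward n (f : 'rV[R]_n.+1 -> \bar R) :
  (mu n.+1).-integrable setT f ->
  (mu n \x lebesgue_measure)%E.-integrable setT (f \o @rc n).
Proof.
move=> /integrableP[mf fi]; apply/integrableP; split.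
  exact: measurable_rcons_comp.
rewrite (leb_pushforward (f := fun z => `|f z|%E)) in fi => //.
exact: measurableT_comp.
Qed.

Lemma ge0_leb_fubini n (f : 'rV[R]_n.+1 -> \bar R) :
  measurable_fun [set: 'rV[R]_n.+1] f -> (forall z, (0 <= f z)%E) ->
  (\int[mu n.+1]_z f z =
   \int[lebesgue_measure]_y \int[mu n]_x f (rV_rcons (x, y)))%E.
Proof.
move=> mf f0; rewrite leb_pushforward// (fubini_tonelli2 (f \o @rc n))//.
- exact: measurable_rcons_comp.
- by move=> p; exact: f0.
Qed.

Lemma ge0_leb_fubini' n (f : 'rV[R]_n.+1 -> \bar R) :
  measurable_fun [set: 'rV[R]_n.+1] f -> (forall z, (0 <= f z)%E) ->
  (\int[mu n.+1]_z f z =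
   \int[mu n]_x \int[lebesgue_measure]_y f (rV_rcons (x, y)))%E.
Proof.
move=> mf f0; rewrite leb_pushforward// (fubini_tonelli1 (f \o @rc n))//.
- exact: measurable_rcons_comp.
- by move=> p; exact: f0.
Qed.

Lemma leb_pushforward_int n (f : 'rV[R]_n.+1 -> \bar R) :
  (mu n.+1).-integrable setT f ->
  (\int[mu n.+1]_z f z = \int[mu n \x lebesgue_measure]_p f (rc p))%E.
Proof.
move=> /integrableP[mf _]; rewrite integralE [RHS]integralE.
congr (_ - _)%E; rewrite leb_pushforward//; last first.
- exact: measurable_funeneg.
- by apply: eq_integral => p _; rewrite ?funenegE ?funeposE.
- exact: measurable_funepos.
- by apply: eq_integral => p _; rewrite ?funenegE ?funeposE.
Qed.

Lemma leb_fubini n (f : 'rV[R]_n.+1 -> \bar R) :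
  (mu n.+1).-integrable setT f ->
  (\int[mu n.+1]_z f z =
   \int[lebesgue_measure]_y \int[mu n]_x f (rV_rcons (x, y)))%E.
Proof.
move=> fi; rewrite leb_pushforward_int//.
have := integral21_prod_meas1 (integrable_leb_pushforward fi).
by move=> <-.
Qed.

Lemma leb_fubini' n (f : 'rV[R]_n.+1 -> \bar R) :
  (mu n.+1).-integrable setT f ->
  (\int[mu n.+1]_z f z =
   \int[mu n]_x \int[lebesgue_measure]_y f (rV_rcons (x, y)))%E.
Proof.
move=> fi; rewrite leb_pushforward_int//.
have := integral12_prod_meas1 (integrable_leb_pushforward fi).
by move=> <-.
Qed.

Lemma measurable_rcons_l n d (T : measurableType d) (f : 'rV[R]_n.+1 -> T) y :
  measurable_fun [set: 'rV[R]_n.+1] f ->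
  measurable_fun [set: 'rV[R]_n] (fun x => f (rV_rcons (x, y))).
Proof. by move=> mf; apply: (measurable_fun_pair1 (f := f \o @rc n)); exact: measurable_rcons_comp. Qed.

Lemma measurable_rcons_r n d (T : measurableType d) (f : 'rV[R]_n.+1 -> T) x :
  measurable_fun [set: 'rV[R]_n.+1] f ->
  measurable_fun [set: R] (fun y => f (rV_rcons (x, y))).
Proof. by move=> mf; apply: (measurable_fun_pair2 (f := f \o @rc n)); exact: measurable_rcons_comp. Qed.

Lemma measurable_int_rcons n (f : 'rV[R]_n.+1 -> \bar R) :
  measurable_fun [set: 'rV[R]_n.+1] f -> (forall z, (0 <= f z)%E) ->
  measurable_fun [set: R] (fun y => \int[mu n]_x f (rV_rcons (x, y)))%E.
Proof.
move=> mf f0; apply: (measurable_fun_fubini_tonelli_G (f \o @rc n)) => //.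
- exact: measurable_rcons_comp.
- by move=> p; exact: f0.
Qed.

Lemma measurable_int_rcons' n (f : 'rV[R]_n.+1 -> \bar R) :
  measurable_fun [set: 'rV[R]_n.+1] f -> (forall z, (0 <= f z)%E) ->
  measurable_fun [set: 'rV[R]_n] (fun x => \int[lebesgue_measure]_y f (rV_rcons (x, y)))%E.
Proof.
move=> mf f0; apply: (measurable_fun_fubini_tonelli_F (f \o @rc n)) => //.
- exact: measurable_rcons_comp.
- by move=> p; exact: f0.
Qed.

(** Diagonal maps cover the translations, dilations and reflections used later, and they are
    compatible with slicing ([affmap_rcons]), which allows induction on the dimension. *)
Definition affmap n (c a : 'I_n -> R) (z : 'rV[R]_n) : 'rV[R]_n :=
  \row_i (c i * z ord0 i + a i).

Lemma measurable_affmap n (c a : 'I_n -> R) : measurable_fun setT (affmap c a).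
Proof.
apply: measurable_fun_rV => i; under eq_fun do rewrite mxE.
apply: measurable_funD => //; apply: measurable_funM => //.
exact: measurable_coor.
Qed.

Lemma affmap_rcons n (c a : 'I_n.+1 -> R) x y : affmap c a (rV_rcons (x, y)) =
  rV_rcons (affmap (c \o lift ord_max) (a \o lift ord_max) x,
            c ord_max * y + a ord_max).
Proof.
apply/rowP => i; rewrite !mxE; case: unliftP => [j ->|->] /=; last by [].
by rewrite mxE.
Qed.

(** By Fubini, the one-variable formula rescales the last coordinate, and the induction hypothesis
    rescales the others on each slice. *)
Lemma ge0_integral_affmap n (c a : 'I_n -> R) (f : 'rV[R]_n -> \bar R) :
  (forall i, c i != 0) ->
  measurable_fun [set: 'rV[R]_n] f -> (forall z, (0 <= f z)%E) ->
  ((\prod_i `|c i|)%:E * \int[mu n]_z f (affmap c a z) = \int[mu n]_z f z)%E.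
Proof.
elim: n c a f => [|n IH] c a f c0 mf f0.
  rewrite big_ord0 mul1e; apply: eq_integral => z _; congr f.
  by apply/rowP => -[].
have mF : measurable_fun [set: 'rV[R]_n.+1] (fun z => f (affmap c a z)).
  by apply: measurableT_comp => //; exact: measurable_affmap.
rewrite !ge0_leb_fubini//.
under eq_integral do (under eq_integral do rewrite affmap_rcons).
rewrite -(ge0_integral_aff1 (a ord_max) (c0 ord_max)); last 2 first.
- exact: measurable_int_rcons.
- by move=> y; exact: integral_ge0.
rewrite big_ord_recr/= mulrC EFinM -muleA; congr (_ * _)%E.
rewrite -ge0_integralZl//; last 3 first.
- have := measurable_int_rcons mF (fun z => f0 _).
  by apply: eq_measurable_fun => y _; apply: eq_integral => x _; rewrite affmap_rcons.
- by move=> y _; exact: integral_ge0.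
- by rewrite lee_fin prodr_ge0.
apply: eq_integral => y _.
rewrite -(IH (c \o lift ord_max) (a \o lift ord_max) (fun x => f (rV_rcons (x, c ord_max * y + a ord_max))))//.
- congr (_%:E * _)%E; apply: eq_bigr => i _ /=; congr (`|c _|).
  by apply: val_inj; rewrite /= /bump leqNgt ltn_ord.
- by move=> i; exact: c0.
- exact: measurable_rcons_l.
Qed.

End rV_measure.

(** * Smooth functions *)

Section C1k.
Context {R : realType}.
Implicit Types (f g : R -> R) (k m : nat).

(** Class C^k with the derivative as a witness, so that stability under sums, products and
    composition is an induction on [k]. *)
Fixpoint C1k k f : Prop := if k is k'.+1 then
  exists2 f' : R -> R, (forall x : R, is_derive x (1 : R) f (f' x)) & C1k k' f'
  else continuous f.

Lemma is_derive1_continuous f f' : (forall x : R, is_derive x (1 : R) f (f' x)) -> continuous f.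
Proof.
move=> df x; apply/differentiable_continuous/derivable1_diffP.
by have [] := df x.
Qed.

Lemma C1k_continuous k f : C1k k f -> continuous f.
Proof. by case: k => // k [f' df _]; exact: is_derive1_continuous df. Qed.

Lemma C1kS k f : C1k k.+1 f -> C1k k f.
Proof.
elim: k f => [|k IH] f; first by move=> [f' df _]; exact: is_derive1_continuous df.
by move=> [f' df cf]; exists f' => //; exact: IH.
Qed.

Lemma C1k_cst k (a : R) : C1k k (fun=> a).
Proof.
elim: k a => [|k IH] a /=; first by move=> x; exact: cvg_cst.
by exists (fun=> 0); [move=> x; exact: is_derive_cst|exact: IH].
Qed.

Lemma C1k_id k : C1k k id.
Proof.
case: k => [|k] /=; first by move=> x; exact: cvg_id.
by exists (fun=> 1); [move=> x; exact: is_derive_id|exact: C1k_cst].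
Qed.

Lemma C1kD k f g : C1k k f -> C1k k g -> C1k k (fun x => f x + g x).
Proof.
elim: k f g => [|k IH] f g /=; first by move=> cf cg x; apply: cvgD; [exact: cf|exact: cg].
move=> [f' df cf] [g' dg cg]; exists (fun x => f' x + g' x); last exact: IH.
by move=> x; exact: is_deriveD.
Qed.

Lemma C1kM k f g : C1k k f -> C1k k g -> C1k k (fun x => f x * g x).
Proof.
elim: k f g => [|k IH] f g; first by move=> /= cf cg x; apply: cvgM; [exact: cf|exact: cg].
move=> /[dup] /C1kS cf [f' df cf'] /[dup] /C1kS cg [g' dg cg'].
exists (fun x => f x * g' x + g x * f' x).
  by move=> x; exact: is_deriveM.
by apply: C1kD; exact: IH.
Qed.

Lemma C1k_comp k f g : C1k k f -> C1k k g -> C1k k (fun x => f (g x)).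
Proof.
elim: k f g => [|k IH] f g.
  by move=> /= cf cg x; apply: (@continuous_comp _ _ _ g f); [exact: cg|exact: cf].
move=> /[dup] /C1kS cf [f' df cf'] /[dup] /C1kS cg [g' dg cg'].
exists (fun x => f' (g x) * g' x); last by apply: C1kM => //; exact: IH.
by move=> x; exact: (@is_derive1_comp _ f g).
Qed.

Lemma C1kV k f : (forall x, f x != 0) -> C1k k f -> C1k k (fun x => (f x)^-1).
Proof.
move=> f0; elim: k => [|k IH].
  by move=> /= cf x; apply: cvgV => //; exact: cf.
move=> /[dup] /C1kS cf [f' df cf'].
exists (fun x => - ((f x)^-1 * (f x)^-1) * f' x).
  move=> x; have -> : - ((f x)^-1 * (f x)^-1) = - (f x) ^- 2 by rewrite -expr2 exprVn.
  exact: is_deriveV.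
apply: C1kM => //.
rewrite (_ : (fun x => _) = (fun x => (-1) * ((f x)^-1 * (f x)^-1))); last first.
  by apply/funext => x; rewrite mulN1r.
by apply: C1kM; [exact: C1k_cst|apply: C1kM; exact: IH].
Qed.

(** The functions [x ^ (-m) exp (-1 / x)] extended by 0. The derivative of each is a combination of
    two others, so smoothness at the origin is settled by one computation valid for all [m]. *)
Definition flat m (x : R) : R := if 0 < x then x^-1 ^+ m * expR (- x^-1) else 0.

Lemma flat_ge0 m x : 0 <= flat m x.
Proof.
rewrite /flat; case: ifPn => // x0.
by rewrite mulr_ge0 ?expR_ge0// exprn_ge0// invr_ge0 ltW.
Qed.

(** The term of order [m + 2] of the exponential series bounds [exp (1 / x)] from below. A quadratic
    bound gives the derivative 0 at the origin for every [m]. *)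
Lemma flat_le m x : flat m x <= (m.+2)`!%:R * x ^+ 2.
Proof.
rewrite /flat; case: ifPn => x0; last by rewrite mulr_ge0// sqr_ge0.
have xi : 0 < x^-1 by rewrite invr_gt0.
have := expR_ge1Dxn m.+1 (ltW xi).
rewrite -[X in 1 + X](mulrC (m.+2)`!%:R^-1) => h.
rewrite expRN ler_pdivrMr ?expR_gt0//.
have F0 : 0 < (m.+2)`!%:R :> R by rewrite ltr0n fact_gt0.
have : (m.+2)`!%:R^-1 * x^-1 ^+ m.+2 <= expR x^-1 by apply: le_trans h; rewrite lerDr.
rewrite mulrC ler_pdivrMr// => {}h.
have -> : x^-1 ^+ m = x ^+ 2 * x^-1 ^+ m.+2.
  by rewrite -[m.+2]addn2 exprD mulrCA -exprMn mulfV ?gt_eqF// expr1n mulr1.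
apply: (le_trans (ler_wpM2l (sqr_ge0 x) h)).
by rewrite le_eqVlt; apply/orP; left; apply/eqP; ring.
Qed.

Lemma is_derive_flat m (x : R) :
  is_derive x (1 : R) (flat m) (flat m.+2 x - m%:R * flat m.+1 x).
Proof.
have [x0|x0|<-] := ltgtP 0 x.
- pose F := fun y : R => y^-1 ^+ m * expR (- y^-1).
  apply: (near_eq_is_derive (f := F)).
    near=> y; rewrite /flat (_ : 0 < y)//.
    by near: y; exact: lt_nbhsr.
  have dV : is_derive x 1 (fun y : R => y^-1) (- x^-2).
    have := @is_deriveV _ id x 1 1 (lt0r_neq0 x0) (is_derive_id _ _).
    by rewrite /GRing.scale/= mulr1.
  have dN : is_derive x 1 (fun y : R => - y^-1) (x^-2).
    by rewrite -[x^-2]opprK; exact: is_deriveN.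
  have dE : is_derive x 1 (fun y : R => expR (- y^-1)) (expR (- x^-1) * x^-2).
    exact: (@is_derive1_comp _ expR (fun y => - y^-1)).
  have dX := is_deriveX m dV.
  have := is_deriveM dX dE.
  rewrite exprfctE mulrfctE -/F => H.
  apply: (@eq_ind _ _ (is_derive x 1 F) H).
  rewrite /flat x0 /GRing.scale/= -exprVn; move: (expR (- x^-1)) => E; move: (x^-1) => t.
  case: m {F dX H} => [|m]; first by rewrite !mul0r mulr0 subr0 addr0 expr0 !mul1r mulrC.
  rewrite !exprS expr0; move: (t ^+ m) => a; ring.
- apply: (near_eq_is_derive (f := fun=> 0)).
    near=> y; rewrite /flat ltNge (_ : y <= 0)//.
    by apply: ltW; near: y; exact: lt_nbhsl.
  by rewrite /flat !ltNge (ltW x0)/= mulr0 subr0; exact: is_derive_cst.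
- have -> : flat m.+2 0 - m%:R * flat m.+1 0 = 0 by rewrite /flat ltxx mulr0 subr0.
  have H : (h^-1 *: ((flat m \o shift 0) (h *: 1) - flat m 0) @[h --> 0^']) --> (0:R).
    apply/cvgrPdist_le => e e0; near=> h.
    rewrite sub0r normrN /= addr0 /GRing.scale/= mulr1 {2}/flat ltxx subr0.
    rewrite normrM (ger0_norm (flat_ge0 _ _)).
    have h0 : h != 0 by near: h; exact: nbhs_dnbhs_neq.
    rewrite normfV mulrC ler_pdivrMr ?normr_gt0//.
    apply: (le_trans (flat_le _ _)); rewrite -real_normK ?num_real// expr2 mulrA ler_wpM2r//.
    have F0 : 0 < (m.+2)`!%:R :> R by rewrite ltr0n fact_gt0.
    rewrite mulrC -ler_pdivlMr//.
    near: h; apply: dnbhs0_le; exact: divr_gt0.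
  apply: DeriveDef; last exact: cvg_lim H.
  by apply/cvg_ex; exists 0.
Unshelve. all: by end_near. Qed.

Lemma C1k_flat k m : C1k k (flat m).
Proof.
elim: k m => [|k IH] m /=; first exact: is_derive1_continuous (is_derive_flat m).
exists (fun x => flat m.+2 x - m%:R * flat m.+1 x); first exact: is_derive_flat.
rewrite (_ : (fun x => _) = (fun x => flat m.+2 x + (- m%:R) * flat m.+1 x)).
  by apply: C1kD => //; apply: C1kM => //; exact: C1k_cst.
by apply/funext => x; rewrite mulNr.
Qed.

(** The classical smooth step, 0 for [x <= 0] and 1 for [x >= 1]. Every cutoff below is built from
    it. *)
Definition sstep (x : R) : R := flat 0 x / (flat 0 x + flat 0 (1 - x)).

Let den_gt0 x : 0 < flat 0 x + flat 0 (1 - x).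
Proof.
have [x0|x0] := ltP 0 x.
  apply: ltr_wpDr; first exact: flat_ge0.
  by rewrite /flat x0 expr0 mul1r expR_gt0.
apply: ltr_wpDl; first exact: flat_ge0.
by rewrite /flat subr_gt0 (le_lt_trans x0)// expr0 mul1r expR_gt0.
Qed.

Lemma C1k_sstep k : C1k k sstep.
Proof.
apply: C1kM; first exact: C1k_flat.
apply: (C1kV (f := fun x => flat 0 x + flat 0 (1 - x))) => [x|].
  by rewrite gt_eqF.
apply: C1kD; first exact: C1k_flat.
apply: (C1k_comp (f := flat 0) (g := fun x => 1 - x)); first exact: C1k_flat.
rewrite (_ : (fun x => 1 - x) = (fun x => 1 + (-1) * x)).
  by apply: C1kD; [exact: C1k_cst|apply: C1kM; [exact: C1k_cst|exact: C1k_id]].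
by apply/funext => x; rewrite mulN1r.
Qed.

Lemma sstep_ge0 x : 0 <= sstep x.
Proof. by rewrite divr_ge0// ?flat_ge0// ltW. Qed.

Lemma sstep_le1 x : sstep x <= 1.
Proof. by rewrite ler_pdivrMr// mul1r lerDl flat_ge0. Qed.

Lemma sstep0 x : x <= 0 -> sstep x = 0.
Proof. by move=> x0; rewrite /sstep /flat ltNge x0 mul0r. Qed.

Lemma sstep1 x : 1 <= x -> sstep x = 1.
Proof.
move=> x1; have := den_gt0 x; rewrite /sstep /flat subr_gt0 !ltNge x1/= addr0.
by move=> h; rewrite divff// gt_eqF// ltNge.
Qed.

End C1k.

(** * Functions of class C^k of several variables *)

Section Ck.
Context {R : realType}.
Variable n : nat.
Local Notation X := 'rV[R]_n.
Implicit Types (f g : X -> R) (k : nat).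
Local Notation dx i := (delta_mx ord0 i : X).

(** Directional derivatives at [z] become derivatives at 0 along a line, where the chain rule of one
    variable applies. *)
Lemma is_derive_line (F : X -> R) (z v : X) (phi : R -> R) (d : R) :
  (forall h : R, F (h *: v + z) = phi h) -> is_derive (0 : R) (1 : R) phi d ->
  is_derive z v F d.
Proof.
move=> Fphi dphi.
have E : (fun h : R => h^-1 *: ((F \o shift z) (h *: v) - F z)) =
         (fun h : R => h^-1 *: ((phi \o shift 0) (h *: 1) - phi 0)).
  apply/funext => h; rewrite /= Fphi addr0 (_ : h *: 1 = h); last exact: mulr1.
  by have := Fphi 0; rewrite scale0r add0r => ->.
apply: DeriveDef; first by rewrite /derivable E; case: dphi.
by rewrite /derive E; exact: (@derive_val _ _ _ _ _ phi).
Qed.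

Lemma line_is_derive (F : X -> R) (z v : X) (d : R) :
  is_derive z v F d -> is_derive (0 : R) (1 : R) (fun h => F (h *: v + z)) d.
Proof.
move=> dF.
have E : (fun h : R => h^-1 *: ((F \o shift z) (h *: v) - F z)) =
         (fun h : R => h^-1 *: (((fun h => F (h *: v + z)) \o shift 0) (h *: 1) - F (0 *: v + z))).
  by apply/funext => h; rewrite /= addr0 (_ : h *: 1 = h) ?scale0r ?add0r//; exact: mulr1.
apply: DeriveDef; first by rewrite /derivable -E; case: dF.
by rewrite /derive -E; exact: (@derive_val _ _ _ _ _ F).
Qed.

(** Continuity is demanded at each level, as in [smooth], because the existence of partial
    derivatives does not imply it. *)
Fixpoint Ck k f : Prop := continuous f /\ if k is k'.+1 then
  exists2 g : 'I_n -> X -> R, (forall i z, is_derive z (dx i) f (g i z)) &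
    forall i, Ck k' (g i) else True.

Lemma CkS k f : Ck k.+1 f -> Ck k f.
Proof.
elim: k f => [|k IH] f; first by move=> [].
by move=> [cf [g dg cg]]; split => //; exists g => // i; exact: IH.
Qed.

Lemma Ck_partial k f i : Ck k.+1 f -> Ck k (partial i f).
Proof.
move=> [cf [g dg cg]]; rewrite (_ : partial i f = g i); first exact: cg.
by apply/funext => z; rewrite /partial; have [_ ->] := dg i z.
Qed.

Lemma smoothP f : smooth f <-> forall k, Ck k f.
Proof.
split => [sf k|cf s].
  suff H : forall s, Ck k (foldr (@partial R n) f s) by exact: (H [::]).
  elim: k => [|k IH] s; have [cs ds] := sf s; split => //.
  exists (fun i => partial i (foldr (@partial R n) f s)); last by move=> i; exact: (IH (i :: s)).
  by move=> i z; apply: DeriveDef.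
have H k : Ck k (foldr (@partial R n) f s).
  by elim: s k => [|i s IH] k //=; exact: Ck_partial (IH k.+1).
have [ch [g dg cg]] := H 1%N.
by split => // i z; case: (dg i z).
Qed.

Lemma smooth_continuous f : smooth f -> continuous f.
Proof. by move=> /(_ [::]) []. Qed.

Lemma smooth_is_derive f i z : smooth f -> is_derive z (dx i) f (partial i f z).
Proof. by move=> /(_ [::]) [_] /(_ i z) h; apply: DeriveDef. Qed.

Lemma smooth_partial f i : smooth f -> smooth (partial i f).
Proof. by move=> /smoothP sf; apply/smoothP => k; exact: Ck_partial. Qed.

Lemma Ck_cst k (a : R) : Ck k (fun=> a).
Proof.
elim: k a => [|k IH] a /=; (split; first by exact: cst_continuous) => //.
by exists (fun _ _ => 0); [move=> i x; exact: is_derive_cst|move=> i; exact: IH].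
Qed.

Lemma CkD k f g : Ck k f -> Ck k g -> Ck k (fun x => f x + g x).
Proof.
elim: k f g => [|k IH] f g.
  by move=> [cf _] [cg _]; split => // x; exact: (cvgD (cf x) (cg x)).
move=> [cf [f' df cf']] [cg [g' dg cg']]; split.
  by move=> x; exact: (cvgD (cf x) (cg x)).
exists (fun i x => f' i x + g' i x); last by move=> i; apply: IH; [exact: cf'|exact: cg'].
by move=> i x; exact: is_deriveD.
Qed.

Lemma CkM k f g : Ck k f -> Ck k g -> Ck k (fun x => f x * g x).
Proof.
elim: k f g => [|k IH] f g.
  by move=> [cf _] [cg _]; split => // x; exact: (cvgM (cf x) (cg x)).
move=> /[dup] /CkS cf0 [cf [f' df cf']] /[dup] /CkS cg0 [cg [g' dg cg']]; split.
  by move=> x; exact: (cvgM (cf x) (cg x)).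
exists (fun i x => f x * g' i x + g x * f' i x).
  by move=> i x; exact: is_deriveM.
by move=> i; apply: CkD; apply: IH => //; [exact: cg'|exact: cf'].
Qed.

Lemma is_derive_coord (g : R -> R) (d : R) i j (z : X) :
  is_derive (z ord0 i) (1 : R) g d ->
  is_derive z (dx j) (fun z : X => g (z ord0 i)) (if i == j then d else 0).
Proof.
move=> dg; have E h : (h *: dx j + z) ord0 i = h * (i == j)%:R + z ord0 i.
  by rewrite !mxE eqxx.
case: eqVneq => [ij|ij].
  apply: (is_derive_line (phi := fun h => g (h + z ord0 i))).
    by move=> h; rewrite E ij eqxx mulr1.
  rewrite -[d]mulr1; apply: (@is_derive1_comp _ g (fun h => h + z ord0 i)).
    by rewrite add0r.
  exact: is_derive_shift.
apply: (is_derive_line (phi := fun=> g (z ord0 i))) => h.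
by rewrite E (negbTE ij) mulr0 add0r.
Qed.

Lemma Ck_coord k (g : R -> R) i : C1k k g -> Ck k (fun z : X => g (z ord0 i)).
Proof.
elim: k g => [|k IH] g.
  move=> cg; split => // z; apply: (@continuous_comp _ _ _ (fun z : X => z ord0 i) g).
    exact: coord_continuous.
  exact: cg.
move=> /[dup] /C1k_continuous cg [g' dg cg']; split.
  move=> z; apply: (@continuous_comp _ _ _ (fun z : X => z ord0 i) g).
    exact: coord_continuous.
  exact: cg.
exists (fun j z => if i == j then g' (z ord0 i) else 0).
  by move=> j z; apply: is_derive_coord.
by move=> j; case: eqVneq => _; [exact: IH|exact: Ck_cst].
Qed.

Lemma smooth_cst (a : R) : smooth (fun _ : X => a).
Proof. by apply/smoothP => k; exact: Ck_cst. Qed.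

Lemma smoothD f g : smooth f -> smooth g -> smooth (fun x => f x + g x).
Proof. by move=> /smoothP sf /smoothP sg; apply/smoothP => k; exact: CkD. Qed.

Lemma smoothM f g : smooth f -> smooth g -> smooth (fun x => f x * g x).
Proof. by move=> /smoothP sf /smoothP sg; apply/smoothP => k; exact: CkM. Qed.

Lemma smooth_coord (g : R -> R) i : (forall k, C1k k g) -> smooth (fun z : X => g (z ord0 i)).
Proof. by move=> cg; apply/smoothP => k; exact: Ck_coord. Qed.

Lemma smooth_prod (g : 'I_n -> X -> R) : (forall i, smooth (g i)) ->
  smooth (fun z => \prod_i g i z).
Proof.
move=> sg; elim: (index_enum _) => [|i s IH].
  by rewrite (_ : (fun z => _) = cst 1); [exact: smooth_cst|apply/funext => z; rewrite big_nil].
have -> : (fun z => \prod_(j <- i :: s) g j z) = (fun z => g i z * \prod_(j <- s) g j z).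
  by apply/funext => z; rewrite big_cons.
exact: (smoothM (sg i) IH).
Qed.

Lemma partialM f g i : smooth f -> smooth g ->
  partial i (fun x => f x * g x) = (fun x => f x * partial i g x + g x * partial i f x).
Proof.
move=> sf sg; apply/funext => z.
exact: (@derive_val _ _ _ _ _ _ _ (is_deriveM (smooth_is_derive i z sf) (smooth_is_derive i z sg))).
Qed.

Lemma partialD f g i : smooth f -> smooth g ->
  partial i (fun x => f x + g x) = (fun x => partial i f x + partial i g x).
Proof.
move=> sf sg; apply/funext => z.
exact: (@derive_val _ _ _ _ _ _ _ (is_deriveD (smooth_is_derive i z sf) (smooth_is_derive i z sg))).
Qed.

Lemma partial_cst (a : R) i : partial i (fun _ : X => a) = (fun=> 0).
Proof. by apply/funext => z; exact: derive_cst. Qed.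

Lemma partial_coord (g g' : R -> R) i j : (forall x : R, is_derive x (1 : R) g (g' x)) ->
  partial j (fun z : X => g (z ord0 i)) = (fun z => if i == j then g' (z ord0 i) else 0).
Proof.
move=> dg; apply/funext => z.
exact: (@derive_val _ _ _ _ _ _ _ (is_derive_coord j (dg (z ord0 i)))).
Qed.

Lemma coord_le_norm (z : X) j : `|z ord0 j| <= `|z|.
Proof.
rewrite [X in _ <= X]/Num.norm/= mx_normrE.
exact: (le_bigmax _ (fun p : 'I_1 * 'I_n => `|z p.1 p.2|) (ord0, j)).
Qed.

Lemma continuous_affmap (c a : 'I_n -> R) : continuous (affmap c a).
Proof.
move=> z; apply/(@cvgrPdist_le _ _ _ (nbhs z)) => e e0.
have c10 : 0 < 1 + \sum_i `|c i| by rewrite ltr_pwDl// sumr_ge0.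
near=> w.
rewrite /Num.norm/= mx_normrE; apply: bigmax_le; first exact: ltW.
move=> [i j] _ /=; rewrite !mxE.
rewrite opprD addrACA subrr addr0 -mulrBr normrM.
have h1 : `|z ord0 j - w ord0 j| <= `|z - w|.
  by have := coord_le_norm (z - w) j; rewrite !mxE.
have h2 : `|c j| <= 1 + \sum_i `|c i|.
  rewrite (bigD1 j)//= addrCA lerDl addr_ge0// sumr_ge0//.
apply: (@le_trans _ _ ((1 + \sum_i `|c i|) * `|z - w|)).
  by apply: ler_pM.
rewrite mulrC -ler_pdivlMr//.
near: w; apply: cvgr_dist_le => //.
exact: divr_gt0.
Unshelve. all: by end_near. Qed.

Lemma is_derive_affmap f (c a : 'I_n -> R) i z d :
  is_derive (affmap c a z) (dx i) f d ->
  is_derive z (dx i) (fun z => f (affmap c a z)) (c i * d).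
Proof.
move=> /line_is_derive dl.
apply: (is_derive_line (phi := fun h => f ((c i * h) *: dx i + affmap c a z))).
  move=> h; congr f; apply/rowP => j; rewrite !mxE eqxx/=.
  by case: eqVneq => [->|_]; rewrite ?mulr1 ?mulr0; ring.
rewrite [_ * d]mulrC; apply: (@is_derive1_comp _ (fun h => f (h *: dx i + affmap c a z)) (fun h => c i * h)).
  by rewrite mulr0.
have := @is_deriveZ _ _ _ id (c i) (0 : R) (1 : R) 1 (is_derive_id _ _).
by rewrite (_ : (c i) *: 1 = c i)//; exact: mulr1.
Qed.

Lemma Ck_affmap k f (c a : 'I_n -> R) : Ck k f -> Ck k (fun z => f (affmap c a z)).
Proof.
elim: k f => [|k IH] f.
  move=> [cf _]; split => // z; apply: (@continuous_comp _ _ _ (affmap c a) f); last exact: cf.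
  exact: continuous_affmap.
move=> [cf [g dg cg]]; split.
  move=> z; apply: (@continuous_comp _ _ _ (affmap c a) f); last exact: cf.
  exact: continuous_affmap.
exists (fun i z => c i * g i (affmap c a z)).
  by move=> i z; exact: is_derive_affmap.
move=> i; apply: CkM; first exact: Ck_cst.
apply: IH; exact: cg.
Qed.

Lemma smooth_affmap f (c a : 'I_n -> R) : smooth f -> smooth (fun z => f (affmap c a z)).
Proof. by move=> /smoothP sf; apply/smoothP => k; exact: Ck_affmap. Qed.

Lemma partial_affmap f (c a : 'I_n -> R) i : smooth f ->
  partial i (fun z => f (affmap c a z)) = (fun z => c i * partial i f (affmap c a z)).
Proof.
move=> sf; apply/funext => z.
exact: (@derive_val _ _ _ _ _ _ _ (is_derive_affmap (smooth_is_derive i (affmap c a z) sf))).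
Qed.

End Ck.

(** * Test functions: supports, slices, integration by parts *)

Section Cc_basics.
Context {R : realType}.
Local Notation mu n := (leb R n).

Definition box n (r : R) : set 'rV[R]_n := [set z | forall i, `|z ord0 i| <= r].

(** Bounded support in quantitative form: it passes to products, slices and derivatives without any
    topology. [CcP] relates it to compact support. *)
Definition bsupp n (r : R) (f : 'rV[R]_n -> R) := forall (z : 'rV[R]_n) i, r < `|z ord0 i| -> f z = 0.

Lemma bsupp_notin n r (f : 'rV[R]_n -> R) z : bsupp r f -> ~ box r z -> f z = 0.
Proof. by move=> bf /existsNP[i /negP]; rewrite -ltNge => /bf. Qed.

Lemma closed_box n r : closed (@box n r).
Proof.
have -> : @box n r = \bigcap_(i in [set: 'I_n]) [set z | `|z ord0 i| <= r].
  by apply/seteqP; split => z /= h i; [move=> _|]; exact: h.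
apply: closed_bigI => i _.
apply: (@closed_comp _ _ (fun z : 'rV[R]_n => `|z ord0 i|) [set x | x <= r]).
  move=> z _; apply: (@continuous_comp _ _ _ (fun z : 'rV[R]_n => z ord0 i) Num.norm).
    exact: coord_continuous.
  exact: norm_continuous.
exact: closed_le.
Qed.

Lemma norm_le_box n r (z : 'rV[R]_n) : 0 <= r -> box r z -> `|z| <= r.
Proof.
move=> r0 bz; rewrite /Num.norm/= mx_normrE; apply: bigmax_le => //.
by move=> [i j] _ /=; rewrite (ord1 i); exact: bz.
Qed.

Lemma compact_box n r : compact (@box n r).
Proof.
apply: bounded_closed_compact; last exact: closed_box.
exists `|r|; split; first exact: num_real.
move=> M rM z bz /=; apply: ltW; apply: le_lt_trans rM; apply: norm_le_box => //.
by move=> i; exact: le_trans (bz i) (ler_norm r).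
Qed.

Lemma measurable_box n r : measurable (@box n r).
Proof.
have -> : @box n r = \bigcap_(i in [set: 'I_n]) ((fun z : 'rV[R]_n => z ord0 i) @^-1` `[-r, r]).
  apply/seteqP; split => z /= h i; first by move=> _ /=; rewrite in_itv/= -ler_norml; exact: h.
  by have := h i I; rewrite /= in_itv/= -ler_norml.
apply: fin_bigcap_measurable => // i _.
rewrite -[X in measurable X]setTI; exact: measurable_coor.
Qed.

Lemma leb_boxE n r : 0 <= r -> (mu n (box r) = ((r *+ 2) ^+ n)%:E)%E.
Proof.
move=> r0; elim: n => [|n IH].
  rewrite /= diracE expr0 mem_set//; by case.
have -> : mu n.+1 (box r) = (mu n \x lebesgue_measure)%E (@box n r `*` `[-r, r]).
  rewrite /= /leb_step /pushforward; congr (_ _).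
  apply/seteqP; split => -[x y] /=.
    move=> h; split => [i|]; first by have := h (lift ord_max i); rewrite mxE liftK.
    by rewrite in_itv/= -ler_norml; have := h ord_max; rewrite mxE unlift_none.
  move=> [h1 h2] i; rewrite mxE; case: unliftP => [j _|_] /=; first exact: h1.
  by move: h2; rewrite in_itv/= -ler_norml.
rewrite product_measure1E//; last exact: measurable_box.
have := lebesgue_measure_itv `[(- r)%R, r] => /= ->; rewrite lte_fin.
rewrite exprSr EFinM; congr (_ * _)%E; first exact: IH.
have [rr|rr] := ltP (- r) r; first by rewrite -EFinB opprK mulr2n.
have -> : r = 0 by apply/eqP; rewrite eq_le r0 andbT; lra.
by rewrite mul0rn.
Qed.

Lemma leb_box n r : 0 <= r -> (mu n (box r) < +oo)%E.
Proof. by move=> r0; rewrite leb_boxE// ltry. Qed.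

Lemma integrable_bsupp n r M (f : 'rV[R]_n -> R) : measurable_fun setT f ->
  bsupp r f -> (forall z, `|f z| <= M) -> (mu n).-integrable setT (EFin \o f).
Proof.
move=> mf bf fM.
have E : EFin \o f = (EFin \o f) \_ (@box n `|r|).
  apply/funext => z; rewrite patchE; case: ifPn => // /negP zb /=.
  rewrite (@bsupp_notin _ `|r| _ z)//.
    by move=> w i h; apply: (bf w i); exact: le_lt_trans (ler_norm r) h.
  by move=> h; apply: zb; rewrite inE.
rewrite E -integrable_mkcond; last exact: measurable_box.
apply: measurable_bounded_integrable.
- exact: measurable_box.
- exact: leb_box.
- exact: measurable_funS mf.
- exists `|M|; split; first exact: num_real.
  by move=> x Mx z _ /=; apply: le_trans (fM z) _; apply: ltW; exact: le_lt_trans (ler_norm M) Mx.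
Qed.

Lemma CcP n (f : 'rV[R]_n -> R) : Cc f <-> smooth f /\ exists2 r, 0 <= r & bsupp r f.
Proof.
split => [[sf cf]|[sf [r r0 bf]]]; split => //.
  have [M [_ HM]] := compact_bounded cf.
  exists (`|M| + 1); first by rewrite addr_ge0.
  move=> z i h; apply: contrapT => /eqP fz.
  have : fsupport f z by apply: subset_closure.
  have : M < `|M| + 1 by rewrite (le_lt_trans (ler_norm M))// ltrDl.
  move=> /HM /[apply] /= hz; have := lt_le_trans h (coord_le_norm z i).
  by rewrite ltNge hz.
have sub : fsupport f `<=` box r.
  rewrite [X in _ `<=` X]((closure_id _).1 (@closed_box n r)).
  by apply: closureS => z /eqP fz i; rewrite leNgt; apply/negP => /bf.
apply: (subclosed_compact _ (@compact_box n r) sub).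
exact: closed_closure.
Qed.

Lemma Cc_smooth n (f : 'rV[R]_n -> R) : Cc f -> smooth f. Proof. by case. Qed.

Lemma Cc_continuous n (f : 'rV[R]_n -> R) : Cc f -> continuous f.
Proof. by move=> /Cc_smooth /smooth_continuous. Qed.

Lemma smooth_measurable n (f : 'rV[R]_n -> R) : smooth f -> measurable_fun setT f.
Proof. by move=> /smooth_continuous /continuous_measurable_rV. Qed.

Lemma Cc_measurable n (f : 'rV[R]_n -> R) : Cc f -> measurable_fun setT f.
Proof. by move=> /Cc_smooth /smooth_measurable. Qed.

(** The strict inequality in [bsupp] is an open condition on [z], so [f] vanishes in a neighbourhood
    of [z] and the radius need not be enlarged. *)
Lemma bsupp_partial n (f : 'rV[R]_n -> R) r i : bsupp r f -> bsupp r (partial i f).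
Proof.
move=> bf z j h; rewrite /partial (@near_eq_derive _ _ _ _ (cst 0)); first exact: derive_cst.
have H : \forall w \near nbhs z, r < `|(w : 'rV[R]_n) ord0 j|.
  by apply: (@cvgr_norm_gt _ _ _ (nbhs z) _ (fun w : 'rV[R]_n => w ord0 j) (z ord0 j)) => //; exact: coord_continuous.
by near=> w; rewrite (bf w j)//; near: w.
Unshelve. all: by end_near. Qed.

Lemma Cc_partial n (f : 'rV[R]_n -> R) i : Cc f -> Cc (partial i f).
Proof.
move=> /CcP[sf [r r0 bf]]; apply/CcP; split; first exact: smooth_partial.
by exists r => //; exact: bsupp_partial.
Qed.

Lemma CcM n (f g : 'rV[R]_n -> R) : Cc f -> smooth g -> Cc (fun z => f z * g z).
Proof.
move=> /CcP[sf [r r0 bf]] sg; apply/CcP; split; first exact: smoothM.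
by exists r => // z i h; rewrite (bf z i h) mul0r.
Qed.

Lemma CcM' n (f g : 'rV[R]_n -> R) : smooth f -> Cc g -> Cc (fun z => f z * g z).
Proof.
move=> sf cg; rewrite (_ : (fun z => _) = (fun z => g z * f z)); first exact: CcM.
by apply/funext => z; rewrite mulrC.
Qed.

Lemma CcD n (f g : 'rV[R]_n -> R) : Cc f -> Cc g -> Cc (fun z => f z + g z).
Proof.
move=> /CcP[sf [r r0 bf]] /CcP[sg [r' r'0 bg]]; apply/CcP; split; first exact: smoothD.
exists (Num.max r r'); first by rewrite le_max r0.
by move=> z i; rewrite gt_max => /andP[h1 h2]; rewrite (bf z i)// (bg z i)// addr0.
Qed.

Lemma Cc0 n : Cc (fun _ : 'rV[R]_n => 0 : R).
Proof. by apply/CcP; split; [exact: smooth_cst|exists 0]. Qed.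

Lemma Cc_affmap n (f : 'rV[R]_n -> R) (c a : 'I_n -> R) : (forall i, c i != 0) ->
  Cc f -> Cc (fun z => f (affmap c a z)).
Proof.
move=> c0 /CcP[sf [r r0 bf]]; apply/CcP; split; first exact: smooth_affmap.
exists (\sum_i (r + `|a i|) / `|c i|).
  by apply: sumr_ge0 => i _; rewrite divr_ge0// addr_ge0.
move=> z i h; apply: (bf _ i); rewrite mxE.
have : (r + `|a i|) / `|c i| < `|z ord0 i|.
  apply: le_lt_trans h; rewrite (bigD1 i)//= lerDl.
  by apply: sumr_ge0 => j _; rewrite divr_ge0// addr_ge0.
rewrite ltr_pdivrMr ?normr_gt0// mulrC -normrM -ltrBrDr => /lt_le_trans; apply.
by rewrite lerBlDr -[X in _ <= _ + X]normrN (le_trans _ (ler_normD _ _))// addrK.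
Qed.

Lemma Cc_bounded n (f : 'rV[R]_n -> R) : Cc f -> exists2 M, 0 <= M & forall z, `|f z| <= M.
Proof.
move=> /[dup] /Cc_continuous cf /CcP[_ [r r0 bf]].
have /compact_bounded[M [_ HM]] : compact (f @` (@box n r)).
  by apply: continuous_compact; [exact: continuous_subspaceT|exact: compact_box].
exists (`|M| + 1); first by rewrite addr_ge0.
move=> z; have [bz|nbz] := pselect (box r z).
  apply: (HM (`|M| + 1)); last by exists z.
  by rewrite (le_lt_trans (ler_norm M))// ltrDl.
by rewrite (bsupp_notin bf nbz) normr0 addr_ge0.
Qed.

Lemma Cc_integrable n (f : 'rV[R]_n -> R) : Cc f -> (mu n).-integrable setT (EFin \o f).
Proof.
move=> cf; have [M _ fM] := Cc_bounded cf; have /CcP[_ [r _ bf]] := cf.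
by apply: integrable_bsupp bf fM; exact: Cc_measurable.
Qed.

Lemma continuous_rcons_l n y : continuous (fun x : 'rV[R]_n => rV_rcons (x, y)).
Proof.
move=> z; apply/(@cvgrPdist_le _ _ _ (nbhs z)) => e e0; near=> w.
rewrite /Num.norm/= mx_normrE; apply: bigmax_le; first exact: ltW.
move=> [i j] _ /=; rewrite !mxE; case: unliftP => [k _|_] /=; last by rewrite subrr normr0 ltW.
apply: (@le_trans _ _ `|z - w|); first by have := coord_le_norm (z - w) k; rewrite !mxE.
by near: w; apply: cvgr_dist_le.
Unshelve. all: by end_near. Qed.

Lemma rcons_addl n (x v : 'rV[R]_n) y (h : R) j :
  rV_rcons (h *: delta_mx ord0 j + x, y) = h *: delta_mx ord0 (lift ord_max j) + rV_rcons (x, y).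
Proof.
apply/rowP => i; rewrite !mxE eqxx/=; case: unliftP => [k ->|->] /=.
  by rewrite !mxE eqxx (inj_eq lift_inj).
by rewrite (negbTE (neq_lift _ _)) mulr0 add0r.
Qed.

Lemma rcons_addr n (x : 'rV[R]_n) y (h : R) :
  rV_rcons (x, h + y) = h *: delta_mx ord0 ord_max + rV_rcons (x, y).
Proof.
apply/rowP => i; rewrite !mxE eqxx/=; case: unliftP => [k ->|->] /=.
  by rewrite eq_sym (negbTE (neq_lift _ _)) mulr0 add0r.
by rewrite eqxx mulr1.
Qed.

Lemma is_derive_slice n (f : 'rV[R]_n.+1 -> R) x y j d :
  is_derive (rV_rcons (x, y)) (delta_mx ord0 (lift ord_max j)) f d ->
  is_derive x (delta_mx ord0 j) (fun x => f (rV_rcons (x, y))) d.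
Proof.
move=> /line_is_derive; apply: is_derive_line => h; congr f.
exact: rcons_addl.
Qed.

Lemma Ck_slice k n (f : 'rV[R]_n.+1 -> R) y : Ck k f -> Ck k (fun x => f (rV_rcons (x, y))).
Proof.
have cc (g : 'rV[R]_n.+1 -> R) : continuous g -> continuous (fun x : 'rV[R]_n => g (rV_rcons (x, y))).
  move=> cg z; apply: (@continuous_comp _ _ _ (fun x : 'rV[R]_n => rV_rcons (x, y)) g); last exact: cg.
  exact: continuous_rcons_l.
elim: k f => [|k IH] f; first by move=> [cf _]; split => //; exact: cc.
move=> [cf [g dg cg]]; split; first exact: cc.
exists (fun i x => g (lift ord_max i) (rV_rcons (x, y))).
  by move=> i x; exact: is_derive_slice.
by move=> i; apply: IH; exact: cg.
Qed.

Lemma smooth_slice n (f : 'rV[R]_n.+1 -> R) y : smooth f -> smooth (fun x => f (rV_rcons (x, y))).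
Proof. by move=> /smoothP sf; apply/smoothP => k; exact: Ck_slice. Qed.

Lemma partial_slice n (f : 'rV[R]_n.+1 -> R) y j : smooth f ->
  partial j (fun x => f (rV_rcons (x, y))) = (fun x => partial (lift ord_max j) f (rV_rcons (x, y))).
Proof.
move=> sf; apply/funext => x.
exact: (@derive_val _ _ _ _ _ _ _ (is_derive_slice (smooth_is_derive _ _ sf))).
Qed.

Lemma Cc_slice n (f : 'rV[R]_n.+1 -> R) y : Cc f -> Cc (fun x => f (rV_rcons (x, y))).
Proof.
move=> /CcP[sf [r r0 bf]]; apply/CcP; split; first exact: smooth_slice.
by exists r => // z i h; apply: (bf _ (lift ord_max i)); rewrite mxE liftK.
Qed.

Lemma is_derive_vslice n (f : 'rV[R]_n.+1 -> R) x (y : R) : smooth f ->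
  is_derive y (1 : R) (fun y => f (rV_rcons (x, y))) (partial ord_max f (rV_rcons (x, y))).
Proof.
move=> sf; have := line_is_derive (smooth_is_derive ord_max (rV_rcons (x, y)) sf) => H.
rewrite (_ : (fun y => _) = (fun h => f (h *: delta_mx ord0 ord_max + rV_rcons (x, y))) \o (fun z => z - y)).
  rewrite -[X in is_derive _ _ _ X]mulr1; apply: is_derive1_comp; first by rewrite subrr.
  exact: is_derive_shift.
by apply/funext => z; rewrite /= -rcons_addr subrK.
Qed.

Lemma continuous_vslice n (f : 'rV[R]_n.+1 -> R) x : smooth f ->
  continuous (fun y : R => f (rV_rcons (x, y))).
Proof.
move=> sf; apply: (@is_derive1_continuous R _ (fun y => partial ord_max f (rV_rcons (x, y)))) => y.
exact: is_derive_vslice.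
Qed.

Lemma FTC2_continuous (F f : R -> R) a b : a < b -> continuous f ->
  (forall x : R, is_derive x (1 : R) F (f x)) ->
  (\int[lebesgue_measure]_(x in `[a, b]) (f x)%:E = (F b - F a)%:E)%E.
Proof.
move=> ab cf dF.
have cF : continuous F by exact: is_derive1_continuous dF.
rewrite (@continuous_FTC2 _ f F a b)//.
- exact: continuous_subspaceT.
- split.
  + by move=> x _; case: (dF x).
  + by apply: cvg_at_right_filter; exact: cF.
  + by apply: cvg_at_left_filter; exact: cF.
- by move=> x _; rewrite derive1E; exact: derive_val.
Qed.

Lemma integral_supp_itv (f : R -> R) (r : R) :
  (forall y, r < `|y| -> f y = 0) ->
  (\int[lebesgue_measure]_y (f y)%:E = \int[lebesgue_measure]_(y in `[(- r)%R, r]) (f y)%:E)%E.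
Proof.
move=> f0; rewrite [RHS]integral_mkcond; apply: eq_integral => y _.
rewrite patchE; case: ifPn => // /negP yr; rewrite f0//.
by rewrite ltNge; apply/negP => h; apply: yr; rewrite inE/= in_itv/= -ler_norml.
Qed.

(** A derivative along one of the first coordinates is a derivative of the slices at constant
    height, handled by induction. The last one is integrated along vertical lines first, where the
    fundamental theorem of calculus gives 0. *)
Lemma Cc_int_partial n (f : 'rV[R]_n -> R) i : Cc f ->
  (\int[mu n]_z (partial i f z)%:E = 0)%E.
Proof.
elim: n f i => [|n IH] f i cf; first by case: i.
have ci := Cc_integrable (Cc_partial i cf).
case: (unliftP ord_max i) => [j|] ij.
  rewrite leb_fubini//; apply: integral0_eq => y _.
  rewrite -[RHS](IH _ j (Cc_slice y cf)); apply: eq_integral => x _.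
  by rewrite partial_slice -?ij//; exact: Cc_smooth.
rewrite leb_fubini'//; apply: integral0_eq => x _.
have /CcP[sf [r r0 bf]] := cf.
(* The radius is enlarged by 1 so that the end points lie strictly outside the support and the
   interval is not reduced to a point. *)
have r1 : - (r + 1) < r + 1 by rewrite gtrN// ltr_wpDl.
rewrite (@integral_supp_itv _ (r + 1)); last first.
  move=> y h; apply: (@bsupp_partial _ _ _ i bf (rV_rcons (x, y)) ord_max); rewrite mxE unlift_none/=.
  by apply: lt_trans h; rewrite ltrDl.
have dF y := is_derive_vslice x y sf.
rewrite ij (FTC2_continuous r1 (continuous_vslice (smooth_partial ord_max sf)) dF).
have B y : r < `|y| -> f (rV_rcons (x, y)) = 0 by move=> h; rewrite (bf _ ord_max)// mxE unlift_none.
by rewrite !B ?subrr// ?normrN ger0_norm ?ltrDl// addr_ge0.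
Qed.

Lemma Cc_ibp n (f g : 'rV[R]_n -> R) i : smooth f -> Cc g ->
  \int[mu n]_z (f z * partial i g z) = - \int[mu n]_z (partial i f z * g z).
Proof.
move=> sf cg; have sg := Cc_smooth cg.
have := Cc_int_partial i (CcM' sf cg); rewrite (partialM _ sf sg) => H.
have i1 := Cc_integrable (CcM' sf (Cc_partial i cg)).
have i2 := Cc_integrable (CcM cg (smooth_partial i sf)).
apply/eqP; rewrite -addr_eq0; apply/eqP.
have -> : \int[mu n]_z (partial i f z * g z) = \int[mu n]_z (g z * partial i f z).
  by apply: eq_Rintegral => z _; rewrite mulrC.
by rewrite -RintegralD// /Rintegral H.
Qed.

End Cc_basics.

(** * Real-valued integrands and dominated convergence *)

Section measure_lemmas.
Context d (T : measurableType d) (R : realType) (mu : {measure set T -> \bar R}).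
Implicit Types (D : set T) (f g : T -> R).

Lemma ge0_le_integral_fin D f g : measurable D -> measurable_fun D f -> measurable_fun D g ->
  (forall x, D x -> 0 <= f x) -> (forall x, D x -> f x <= g x) ->
  (\int[mu]_(x in D) (f x)%:E <= \int[mu]_(x in D) (g x)%:E)%E.
Proof.
move=> mD mf mg f0 fg; apply: ge0_le_integral => //; try (by move=> x Dx; rewrite lee_fin; auto).
- exact/measurable_EFinP.
- exact/measurable_EFinP.
Qed.

Lemma ge0_integralD_fin D f g : measurable D -> measurable_fun D f -> measurable_fun D g ->
  (forall x, D x -> 0 <= f x) -> (forall x, D x -> 0 <= g x) ->
  (\int[mu]_(x in D) (f x + g x)%:E = \int[mu]_(x in D) (f x)%:E + \int[mu]_(x in D) (g x)%:E)%E.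
Proof.
move=> mD mf mg f0 g0; rewrite -ge0_integralD//; try (by move=> x Dx; rewrite lee_fin; auto).
- exact/measurable_EFinP.
- exact/measurable_EFinP.
Qed.

Lemma ge0_integralZl_fin D (k : R) f : measurable D -> measurable_fun D f ->
  (forall x, D x -> 0 <= f x) -> 0 <= k ->
  (\int[mu]_(x in D) (k * f x)%:E = k%:E * \int[mu]_(x in D) (f x)%:E)%E.
Proof.
move=> mD mf f0 k0; rewrite -ge0_integralZl//; try (by move=> x Dx; rewrite lee_fin; auto).
exact/measurable_EFinP.
Qed.

Lemma dct_cvg0 D (f_ : nat -> T -> R) g : measurable D ->
  (forall k, measurable_fun D (f_ k)) -> (forall x, D x -> f_ ^~ x @ \oo --> (0:R)) ->
  (forall k x, D x -> `|f_ k x| <= g x) -> mu.-integrable D (EFin \o g) ->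
  (\int[mu]_(x in D) (f_ k x)%:E)%E @[k --> \oo] --> 0%E.
Proof.
move=> mD mf fc fg ig.
have [|||||_ _] := @dominated_convergence _ _ _ mu D mD (fun k x => (f_ k x)%:E) (cst 0%E) (EFin \o g).
- by move=> k; exact/measurable_EFinP.
- exact: measurable_cst.
- apply: aeW => x Dx; apply: cvg_EFin; first exact: nearW.
  exact: fc.
- exact: ig.
- by apply: aeW => x k Dx; rewrite lee_fin; exact: fg.
by rewrite integral0.
Qed.

Lemma cvge_lt (u : nat -> \bar R) l a : u @ \oo --> l -> (l < a)%E ->
  \forall k \near \oo, (u k < a)%E.
Proof. by move=> ul la; exact: (ul _ (open_ereal_lt' la)). Qed.

End measure_lemmas.

(** * Density of test functions *)

Section approx_sets.
Context {R : realType} (n : nat) (r : R) (r0 : 0 <= r).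
Local Notation mu := (leb R n).
Local Notation B := (@box R n r).
Implicit Types (A : set 'rV[R]_n).

Let mB : measurable B := measurable_box r.

Lemma integrable_box (f : 'rV[R]_n -> R) (M : R) : measurable_fun B f ->
  (forall z, B z -> `|f z| <= M) -> mu.-integrable B (EFin \o f).
Proof.
move=> mf fM; apply: measurable_bounded_integrable => //; first exact: leb_box.
exists `|M|; split; first exact: num_real.
by move=> x Mx z Bz /=; apply: le_trans (fM z Bz) _; apply: ltW; exact: le_lt_trans (ler_norm M) Mx.
Qed.

(** Approximation in L^1 of the box. The bound [0 <= psi z <= C], kept through all operations, makes
    products of approximable functions approximable and later turns an L^1 error into an L^2
    error. *)
Definition sapprox (f : 'rV[R]_n -> R) (C : R) : Prop := forall e : R, 0 < e ->
  exists psi, [/\ smooth psi, forall z, 0 <= psi z <= C &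
  (\int[mu]_(z in B) (`|psi z - f z|)%:E <= e%:E)%E].

(* These sets form a sigma-algebra containing the half-spaces [z_i > a]. *)
Definition approx_set A : Prop := measurable A /\ sapprox (\1_A) 1.

Lemma int_dist_tri (f g h : 'rV[R]_n -> R) (a b : R) :
  measurable_fun setT f -> measurable_fun setT g -> measurable_fun setT h ->
  (\int[mu]_(z in B) (`|f z - g z|)%:E <= a%:E)%E ->
  (\int[mu]_(z in B) (`|g z - h z|)%:E <= b%:E)%E ->
  (\int[mu]_(z in B) (`|f z - h z|)%:E <= (a + b)%:E)%E.
Proof.
move=> mf mg mh fa gb.
have m1 (u v : 'rV[R]_n -> R) : measurable_fun setT u -> measurable_fun setT v ->
    measurable_fun B (fun z => `|u z - v z|).
  move=> mu' mv; apply: measurable_funTS; apply: measurableT_comp => //.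
  exact: measurable_funB.
apply: (@le_trans _ _ (\int[mu]_(z in B) (`|f z - g z| + `|g z - h z|)%:E)%E).
  apply: ge0_le_integral_fin => //; first exact: m1.
    by apply: measurable_funD; exact: m1.
  by move=> z _; rewrite (le_trans _ (ler_normD _ _))// subrKA.
rewrite ge0_integralD_fin//; try exact: m1.
by rewrite EFinD leeD.
Qed.

(** Dominated convergence on a box of finite measure; the common bound [C] provides the dominating
    constant. *)
Lemma approx_lim (f_ : nat -> 'rV[R]_n -> R) f C : (forall k, measurable_fun setT (f_ k)) ->
  (forall k z, 0 <= f_ k z <= C) ->
  (forall z, f_ ^~ z @ \oo --> f z) -> (forall k, sapprox (f_ k) C) -> sapprox f C.
Proof.
move=> mf fC fcv apx e e0.
have mff : measurable_fun setT f by apply: (measurable_fun_cvg mf) => z _; exact: fcv.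
have mB' k : measurable_fun B (fun z => `|f_ k z - f z|).
  by apply: measurable_funTS; apply: measurableT_comp => //; exact: measurable_funB.
have H : (\int[mu]_(z in B) (`|f_ k z - f z|)%:E)%E @[k --> \oo] --> 0%E.
  apply: (@dct_cvg0 _ _ _ mu B _ (cst (C + C))) => //.
  - move=> z _; rewrite -[0](normr0 R) -(subrr (f z)).
    apply: cvg_norm; apply: cvgB; first exact: fcv.
    exact: cvg_cst.
  - move=> k z _; rewrite normr_id (le_trans (ler_normB _ _))// lerD//.
      by have /andP[h1 h2] := fC k z; rewrite ger0_norm.
    have cfz : `|f_ k z| @[k --> \oo] --> `|f z| by apply: cvg_norm; exact: fcv.
    rewrite -(cvg_lim _ cfz)//; apply: limr_le; first by apply/cvg_ex; exists `|f z|.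
    by apply: nearW => j; have /andP[h1 h2] := fC j z; rewrite ger0_norm.
  - by apply: (@integrable_box _ `|C + C|) => // z _.
have e2 : 0 < e / 2 by rewrite divr_gt0.
have : \forall k \near \oo, (\int[mu]_(z in B) (`|f_ k z - f z|)%:E < (e / 2)%:E)%E.
  by apply: (cvge_lt H); rewrite lte_fin.
move=> [k _ /(_ k (leqnn k)) /= /ltW hk].
have [psi [sp pC hpsi]] := apx k _ e2.
exists psi; split => //; rewrite [e]splitr.
exact: (int_dist_tri (smooth_measurable sp) (mf k) mff hpsi hk).
Qed.

Lemma approx_smooth f C : smooth f -> (forall z, 0 <= f z <= C) -> sapprox f C.
Proof.
move=> sf fC e e0; exists f; split => //.
under eq_integral do rewrite subrr normr0.
by rewrite integral0 lee_fin ltW.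
Qed.

Lemma approx_onem (f : 'rV[R]_n -> R) : measurable_fun setT f -> sapprox f 1 -> sapprox (fun z => 1 - f z) 1.
Proof.
move=> mf af e /af[psi [sp p1 hp]]; exists (fun z => 1 + (-1) * psi z); split.
- apply: smoothD; first exact: smooth_cst.
  by apply: smoothM => //; exact: smooth_cst.
- move=> z; have /andP[h1 h2] := p1 z; rewrite mulN1r; apply/andP; split; lra.
- rewrite (eq_integral (fun z => (`|psi z - f z|)%:E))// => z _; congr EFin.
  rewrite -normrN; congr (`|_|); ring.
Qed.

Lemma approx_mul (f g : 'rV[R]_n -> R) : measurable_fun setT f -> measurable_fun setT g ->
  (forall z, 0 <= f z <= 1) -> sapprox f 1 -> sapprox g 1 -> sapprox (fun z => f z * g z) 1.
Proof.
move=> mf mg f1 af ag e e0; have e2 : 0 < e / 2 by rewrite divr_gt0.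
have [p [sp p1 hp]] := af _ e2; have [q [sqint q1 hq]] := ag _ e2.
have mp := smooth_measurable sp; have mq := smooth_measurable sqint.
exists (fun z => p z * q z); split; first exact: smoothM.
  move=> z; have /andP[h1 h2] := p1 z; have /andP[h3 h4] := q1 z.
  by rewrite mulr_ge0//= mulr_ile1.
rewrite [e]splitr.
have mN (u v : 'rV[R]_n -> R) : measurable_fun setT u -> measurable_fun setT v ->
    measurable_fun B (fun z => `|u z - v z|).
  by move=> mu' mv; apply: measurable_funTS; apply: measurableT_comp => //; exact: measurable_funB.
have mM (u v : 'rV[R]_n -> R) : measurable_fun setT u -> measurable_fun setT v ->
    measurable_fun setT (fun z => u z * v z) by move=> mu' mv; exact: measurable_funM.
apply: (@int_dist_tri _ (fun z => f z * q z)); [exact: mM|exact: mM|exact: mM| |].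
- apply: le_trans hp; apply: ge0_le_integral_fin => //; [by apply: mN; exact: mM|exact: mN|].
  move=> z _; rewrite -mulrBl normrM; have /andP[h3 h4] := q1 z.
  by rewrite ler_piMr// ger0_norm.
- apply: le_trans hq; apply: ge0_le_integral_fin => //; [by apply: mN; exact: mM|exact: mN|].
  move=> z _; rewrite -mulrBr normrM; have /andP[h3 h4] := f1 z.
  by rewrite ler_piMl// ger0_norm.
Qed.

Lemma approx_set_setC A : approx_set A -> approx_set (~` A).
Proof.
move=> [mA aA]; split; first exact: measurableC.
rewrite (_ : \1_(~` A) = fun z => 1 - \1_A z); last first.
  by apply/funext => z; rewrite !indicE in_setC; case: (_ \in _); rewrite /= ?subr0 ?subrr.
by apply: approx_onem => //; exact: measurable_indic.
Qed.

Lemma indic01 A z : 0 <= (\1_A z : R) <= 1.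
Proof. by rewrite indicE; case: (_ \in _); rewrite /= ?lexx ?ler01. Qed.

Lemma approx_set_setI A1 A2 : approx_set A1 -> approx_set A2 -> approx_set (A1 `&` A2).
Proof.
move=> [mA1 aA1] [mA2 aA2]; split; first exact: measurableI.
rewrite (_ : \1_(A1 `&` A2) = fun z => \1_A1 z * \1_A2 z); last by rewrite indicI.
apply: approx_mul => //; try exact: measurable_indic.
by move=> z; exact: indic01.
Qed.

Lemma approx_set_bigcup (F : (set 'rV[R]_n)^nat) : (forall k, approx_set (F k)) ->
  approx_set (\bigcup_k F k).
Proof.
move=> aF; have mU : measurable (\bigcup_k F k) by apply: bigcupT_measurable => k; case: (aF k).
split => //.
pose U k := \big[setU/set0]_(j < k) F j.
have aU k : approx_set (U k).
  elim: k => [|k IH]; first rewrite /U big_ord0.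
    split => //; rewrite indic0; apply: approx_smooth; first exact: smooth_cst.
    by move=> z; rewrite /= lexx ler01.
  rewrite /U big_ord_recr/= -/(U k) -[X in approx_set X]setCK setCU.
  by apply/approx_set_setC/approx_set_setI; apply: approx_set_setC.
apply: (@approx_lim (fun k => \1_(U k))) => //.
- by move=> k; apply: measurable_indic; case: (aU k).
- by move=> k z; exact: indic01.
- move=> z; have [[k _ Fkz]|nU] := pselect ((\bigcup_k F k) z); last first.
    rewrite (_ : (fun k => _) = cst 0); last first.
      apply/funext => k; rewrite indicE memNset//= /U -bigcup_mkord => -[j _ Fj].
      by apply: nU; exists j.
    by rewrite indicE memNset//; exact: cvg_cst.
  apply: (@cvg_near_cst _ _ _ _ _ _).
  exists k.+1 => // m /= km; rewrite !indicE !mem_set//; first by exists k.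
  by rewrite /U -bigcup_mkord; exists k.
- by move=> k; case: (aU k).
Qed.

Lemma approx_set_ray i (a : R) : approx_set [set z | a < z ord0 i].
Proof.
have mA : measurable [set z : 'rV[R]_n | a < z ord0 i].
  rewrite (_ : [set z : 'rV[R]_n | a < z ord0 i] = (fun z : 'rV[R]_n => z ord0 i) @^-1` `]a, +oo[).
    rewrite -[X in measurable X]setTI; exact: measurable_coor.
  by apply/seteqP; split => z /=; rewrite in_itv/= andbT.
split => //.
have sk k : smooth (fun z : 'rV[R]_n => sstep (k%:R * (z ord0 i - a))).
  apply: (@smooth_coord _ _ (fun x => sstep (k%:R * (x - a))) i) => m.
  apply: (C1k_comp (f := sstep) (g := fun x => k%:R * (x - a))); first exact: C1k_sstep.
  apply: C1kM; first exact: C1k_cst.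
  by apply: C1kD; [exact: C1k_id|exact: C1k_cst].
apply: (@approx_lim (fun k z => sstep (k%:R * (z ord0 i - a)))).
- by move=> k; exact: smooth_measurable.
- by move=> k z; rewrite sstep_ge0 sstep_le1.
- move=> z; rewrite indicE; have [az|za] := ltP a (z ord0 i).
    rewrite mem_set//=; apply: cvg_near_cst.
    exists (Num.truncn (z ord0 i - a)^-1).+1 => // k /= hk; apply: sstep1.
    rewrite -ler_pdivrMr ?subr_gt0// mul1r.
    by rewrite (le_trans (ltW (truncnS_gt _)))// ler_nat.
  rewrite memNset//=; last by rewrite ltNge za.
  apply: cvg_near_cst; apply: nearW => k; apply: sstep0.
  by rewrite mulr_ge0_le0// subr_le0.
- by move=> k; apply: approx_smooth => // z; rewrite sstep_ge0 sstep_le1.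
Qed.

Lemma approx_set_measurable A : measurable A -> approx_set A.
Proof.
have SA : sigma_algebra setT approx_set.
  split.
  - by rewrite -setCT; apply: approx_set_setC; split => //; rewrite indicT; apply: approx_smooth;
      [exact: smooth_cst|move=> z; rewrite /= ler01 lexx].
  - by move=> A' aA; rewrite setTD; exact: approx_set_setC.
  - exact: approx_set_bigcup.
apply: smallest_sub => // C; rewrite -bigcup_seq => -[i _ [B' mB' <-]].
rewrite setTI; move: B' mB'; apply: smallest_sub.
  split.
  - by rewrite preimage_set0; case: SA.
  - by move=> A' aA; rewrite setTD preimage_setC; exact: approx_set_setC.
  - by move=> F aF; rewrite preimage_bigcup; exact: approx_set_bigcup.
(* The intervals []a, b]] generate the Borel sets of the line; their preimages are differences of
   two half-spaces. *)
move=> _ [[a b] _ <-].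
rewrite (_ : _ @^-1` _ = [set z : 'rV[R]_n | a < z ord0 i] `&` ~` [set z | b < z ord0 i]).
  by apply: approx_set_setI; [|apply: approx_set_setC]; exact: approx_set_ray.
apply/seteqP; split => z /=; rewrite in_itv/=; first by move=> /andP[-> /le_gtF ->].
by move=> [-> /negP]; rewrite -leNgt.
Qed.

Lemma count_le_nat (t : R) (K : nat) : K%:R <= t -> \sum_(j < K) ((j.+1)%:R <= t)%R%:R = K%:R :> R.
Proof.
elim: K => [|K IH] Kt; first by rewrite big_ord0.
have K1 : K%:R <= t by rewrite (le_trans _ Kt)// ler_nat.
by rewrite big_ord_recr/= IH// Kt natr1.
Qed.

(** The sum counts the integers from 1 to [K] that are at most [t]: it is the integer part of
    [t]. *)
Lemma count_le_dist (t : R) (K : nat) : 0 <= t <= K%:R ->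
  `|\sum_(j < K) ((j.+1)%:R <= t)%R%:R - t| <= 1.
Proof.
elim: K t => [|K IH] t /andP[t0 tK].
  by rewrite big_ord0 sub0r normrN ger0_norm// (le_trans tK).
rewrite big_ord_recr/=; have [h|h] := leP t K%:R.
  have -> : (K.+1%:R <= t) = false by apply/negbTE; rewrite -ltNge (le_lt_trans h)// ltr_nat.
  by rewrite addr0 IH// t0.
rewrite count_le_nat; last exact: ltW.
rewrite mulrSr in tK *; have [h2|h2] := leP (K%:R + 1) t; rewrite ler_norml; apply/andP; split => /=; lra.
Qed.

Lemma approxD (f g : 'rV[R]_n -> R) C C' : measurable_fun setT f -> measurable_fun setT g ->
  sapprox f C -> sapprox g C' -> sapprox (fun z => f z + g z) (C + C').
Proof.
move=> mf mg af ag e e0; have e2 : 0 < e / 2 by rewrite divr_gt0.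
have [p [sp p1 hp]] := af _ e2; have [q [sqint q1 hq]] := ag _ e2.
exists (fun z => p z + q z); split; first exact: smoothD.
  by move=> z; have /andP[h1 h2] := p1 z; have /andP[h3 h4] := q1 z; rewrite addr_ge0//= lerD.
have mN (u v : 'rV[R]_n -> R) : measurable_fun setT u -> measurable_fun setT v ->
    measurable_fun B (fun z => `|u z - v z|).
  by move=> mu' mv; apply: measurable_funTS; apply: measurableT_comp => //; exact: measurable_funB.
have mp := smooth_measurable sp; have mq := smooth_measurable sqint.
apply: (@le_trans _ _ (\int[mu]_(z in B) (`|p z - f z| + `|q z - g z|)%:E)%E).
  apply: ge0_le_integral_fin => //.
  - by apply: mN; exact: measurable_funD.
  - by apply: measurable_funD; exact: mN.
  - by move=> z _; rewrite opprD addrACA ler_normD.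
rewrite ge0_integralD_fin//; [|exact: mN|exact: mN].
by rewrite [e]splitr EFinD leeD.
Qed.

Lemma approx_sum (F : nat -> 'rV[R]_n -> R) K : (forall j, measurable_fun setT (F j)) ->
  (forall j, sapprox (F j) 1) -> sapprox (fun z => \sum_(j < K) F j z) K%:R.
Proof.
move=> mF aF; elim: K => [|K IH].
  rewrite (_ : (fun z => _) = cst 0); last by apply/funext => z; rewrite big_ord0.
  by apply: approx_smooth; [exact: smooth_cst|move=> z; rewrite /= lexx].
rewrite (_ : (fun z => _) = (fun z => \sum_(j < K) F j z + F K z)); last first.
  by apply/funext => z; rewrite big_ord_recr.
rewrite -natr1; apply: approxD => //.
by apply: measurable_sum.
Qed.

(** Discrete layer-cake formula: rounding [f] down to a multiple of [1 / (K + 1)] gives an average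
    of indicators of superlevel sets, each of them approximable, with an error uniform in [z]. *)
Lemma approx_bounded (f : 'rV[R]_n -> R) (M : nat) : measurable_fun setT f ->
  (forall z, 0 <= f z <= M%:R) -> sapprox f M%:R.
Proof.
move=> mf fM; pose S K z : R := K.+1%:R^-1 * \sum_(j < (M * K.+1)%N) \1_[set z | j.+1%:R <= f z * K.+1%:R] z.
have mS1 K j : measurable [set z | j.+1%:R <= f z * K.+1%:R].
  rewrite (_ : [set z | _] = (fun z => f z * K.+1%:R) @^-1` `[j.+1%:R, +oo[).
    rewrite -[X in measurable X]setTI.
    have : measurable_fun setT (fun z => f z * K.+1%:R) by exact: measurable_funM.
    by apply.
  by apply/seteqP; split => z /=; rewrite in_itv/= andbT.
have SE K z : S K z = K.+1%:R^-1 * \sum_(j < (M * K.+1)%N) ((j.+1)%:R <= f z * K.+1%:R)%R%:R.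
  congr (_ * _); apply: eq_bigr => j _; rewrite indicE; congr (_%:R); congr nat_of_bool.
  by apply/idP/idP; rewrite inE.
have mS K : measurable_fun setT (S K).
  apply: measurable_funM => //; apply: measurable_sum => j.
  exact: measurable_indic.
have Sd K z : `|S K z - f z| <= K.+1%:R^-1.
  have -> : S K z - f z = K.+1%:R^-1 * (\sum_(j < (M * K.+1)%N) ((j.+1)%:R <= f z * K.+1%:R)%R%:R - f z * K.+1%:R).
    by rewrite SE mulrBr mulrCA mulVf// mulr1.
  rewrite normrM ger0_norm// ler_piMr// count_le_dist//.
  have /andP[h1 h2] := fM z; rewrite mulr_ge0//= natrM ler_wpM2r//.
apply: (@approx_lim S) => //.
- move=> K z; rewrite SE mulr_ge0//=; last by apply: sumr_ge0 => j _; rewrite ler0n.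
  rewrite mulrC ler_pdivrMr// -natrM.
  rewrite (le_trans (ler_sum _ (G := fun=> 1) _))//; last by rewrite sumr_const card_ord.
  by move=> j _; rewrite lern1 leq_b1.
- move=> z; apply/cvgrPdist_le => e e0; near=> K.
  rewrite distrC (le_trans (Sd K z))// invf_ple ?posrE//.
  near: K; exists (Num.truncn e^-1).+1 => // k /= hk.
  by rewrite (le_trans (ltW (truncnS_gt _)))// ler_nat ltnW.
- move=> K e e0.
  have mI j : measurable_fun setT (\1_[set z | j.+1%:R <= f z * K.+1%:R] : 'rV[R]_n -> R).
    exact: measurable_indic.
  have [p [sp p1 hp]] := @approx_sum _ (M * K.+1)%N mI
    (fun j => (approx_set_measurable (mS1 K j)).2) e e0.
  exists (fun z => K.+1%:R^-1 * p z); split.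
  + by apply: smoothM => //; exact: smooth_cst.
  + move=> z; have /andP[h1 h2] := p1 z; rewrite mulr_ge0//=.
    by rewrite mulrC ler_pdivrMr// -natrM.
  + apply: le_trans hp; apply: ge0_le_integral_fin => //.
    * apply: measurable_funTS; apply: measurableT_comp => //; apply: measurable_funB => //.
      by apply: measurable_funM => //; exact: smooth_measurable.
    * apply: measurable_funTS; apply: measurableT_comp => //; apply: measurable_funB => //.
        exact: smooth_measurable.
      by apply: measurable_sum => j; exact: measurable_indic.
    * move=> z _; rewrite -mulrBr normrM ger0_norm// ler_piMl// invf_le1// ler1n//.
Unshelve. all: by end_near. Qed.

End approx_sets.

(** * Square integrals *)

Section sqint.
Context d (T : measurableType d) (R : realType) (mu : {measure set T -> \bar R}).
Implicit Types (D : set T) (f g : T -> R).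

(** The case [p = 2] of [Lpow], for any measure and with an integer power, so that algebraic
    identities apply under the integral. *)
Definition sqint D f : \bar R := (\int[mu]_(x in D) ((f x) ^+ 2)%:E)%E.

Lemma sqint_ge0 D f : (0 <= sqint D f)%E.
Proof. by apply: integral_ge0 => x _; rewrite lee_fin sqr_ge0. Qed.

Lemma measurable_sqr D f : measurable_fun D f -> measurable_fun D (fun x => f x ^+ 2).
Proof. by move=> mf; exact: measurable_funX. Qed.

Lemma sqint_add D f g : measurable D -> measurable_fun D f -> measurable_fun D g ->
  (sqint D (fun x => f x + g x)%R <= 2%:E * sqint D f + 2%:E * sqint D g)%E.
Proof.
move=> mD mf mg; rewrite -!ge0_integralZl_fin ?ler0n//; try exact: measurable_sqr;
  try (by move=> x _; exact: sqr_ge0).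
rewrite -ge0_integralD_fin//; try (by apply: measurable_funM => //; exact: measurable_sqr);
  try (by move=> x _; rewrite mulr_ge0// sqr_ge0).
apply: ge0_le_integral_fin => //.
- by apply: measurable_sqr; exact: measurable_funD.
- by apply: measurable_funD; apply: measurable_funM => //; exact: measurable_sqr.
- by move=> x _; exact: sqr_ge0.
- move=> x _; rewrite -subr_ge0 (_ : _ - _ = (f x - g x) ^+ 2) ?sqr_ge0//; ring.
Qed.

Lemma sqint_opp D f : sqint D (fun x => - f x) = sqint D f.
Proof. by apply: eq_integral => x _; rewrite sqrrN. Qed.

Lemma sqint_lt_add D f g (a b : R) : measurable D -> measurable_fun D f -> measurable_fun D g ->
  (sqint D f <= a%:E)%E -> (sqint D g <= b%:E)%E -> (sqint D (fun x => f x + g x)%R <= (2 * a + 2 * b)%:E)%E.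
Proof.
move=> mD mf mg fa gb; apply: (le_trans (sqint_add mD mf mg)).
by rewrite (EFinD (2 * a) (2 * b)) (EFinM 2 a) (EFinM 2 b); apply: leeD; apply: lee_wpmul2l.
Qed.

Lemma le_sqint D f g : measurable D -> measurable_fun D f -> measurable_fun D g ->
  (forall x, D x -> `|f x| <= `|g x|) -> (sqint D f <= sqint D g)%E.
Proof.
move=> mD mf mg fg; apply: ge0_le_integral_fin => //; try exact: measurable_sqr.
  by move=> x _; exact: sqr_ge0.
move=> x Dx; rewrite -(real_normK (num_real (f x))) -(real_normK (num_real (g x))).
by rewrite ler_sqr ?nnegrE//; exact: fg.
Qed.

Lemma integrable_mulb D f g (M : R) : measurable D -> measurable_fun D g ->
  (forall x, D x -> `|g x| <= M) -> mu.-integrable D (EFin \o f) ->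
  mu.-integrable D (EFin \o (fun x => g x * f x)).
Proof.
move=> mD mg gM fi; have mf : measurable_fun D f by apply/measurable_EFinP; case/integrableP: fi.
apply: (@le_integrable _ _ _ mu D mD _ (EFin \o (fun x => `|M| * f x))) => //.
- by apply/measurable_EFinP; exact: measurable_funM.
- by move=> x Dx /=; rewrite lee_fin !normrM ler_wpM2r// normr_id (le_trans (gM x Dx))// ler_norm.
- rewrite (_ : _ \o _ = fun x => (`|M|%:E * (f x)%:E)%E) //.
  exact: integrableZl.
Qed.

Lemma integrable_prod2 D f g : measurable D -> measurable_fun D f -> measurable_fun D g ->
  (sqint D f < +oo)%E -> (sqint D g < +oo)%E -> mu.-integrable D (EFin \o (fun x => f x * g x)).
Proof.
move=> mD mf mg f2 g2; apply/integrableP; split; first by apply/measurable_EFinP; exact: measurable_funM.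
apply: (@le_lt_trans _ _ (sqint D f + sqint D g)%E); last by rewrite lte_add_pinfty.
rewrite -ge0_integralD_fin//; try exact: measurable_sqr; try (by move=> x _; exact: sqr_ge0).
apply: (@ge0_le_integral_fin _ _ _ _ _ (fun x => `|f x * g x|)) => //.
- by apply: measurableT_comp => //; exact: measurable_funM.
- by apply: measurable_funD; exact: measurable_sqr.
- move=> x _; rewrite normrM -(real_normK (num_real (f x))) -(real_normK (num_real (g x))).
  move: `|f x| `|g x| (normr_ge0 (f x)) (normr_ge0 (g x)) => a b a0 b0.
  rewrite -subr_ge0 (_ : _ - _ = (a - b) ^+ 2 + a * b); last by ring.
  by rewrite addr_ge0// ?sqr_ge0// mulr_ge0.
Qed.

Lemma integrable_sq D f : measurable D -> measurable_fun D f -> (sqint D f < +oo)%E ->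
  mu.-integrable D (EFin \o (fun x => f x ^+ 2)).
Proof.
move=> mD mf f2; rewrite (_ : (fun x => _) = (fun x => f x * f x)).
  exact: integrable_prod2.
by apply/funext => x; rewrite expr2.
Qed.

End sqint.

(** * Density of test functions in L^2 *)

Section L2_density.
Context {R : realType} (n : nat).
Local Notation mu := (leb R n).
Local Notation X := 'rV[R]_n.
Implicit Types f g : X -> R.

Definition clamp (c x : R) : R := Num.max (- c) (Num.min x c).

Lemma clamp_norm c x : 0 <= c -> `|clamp c x| <= c.
Proof.
move=> c0; rewrite /clamp ler_norml; apply/andP; split; first by rewrite le_max lexx.
by rewrite ge_max ge_min lexx orbT andbT; lra.
Qed.

Lemma clamp_id c x : `|x| <= c -> clamp c x = x.
Proof.
rewrite ler_norml => /andP[h1 h2]; rewrite /clamp.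
by rewrite (min_l h2) (max_r h1).
Qed.

Lemma clamp_dist c x : 0 <= c -> `|x - clamp c x| <= `|x|.
Proof.
move=> c0; rewrite /clamp; case: (leP x c) => h; case: (leP (- c) _) => h2.
- by rewrite subrr normr0.
- rewrite opprK (ltr0_norm (x := x + c)) ?(ltr0_norm (x := x)); lra.
- rewrite !ger0_norm; lra.
- lra.
Qed.

Lemma measurable_clamp d (T : measurableType d) (f : T -> R) c :
  measurable_fun setT f -> measurable_fun setT (fun z => clamp c (f z)).
Proof. by move=> mf; apply: measurable_maxr => //; exact: measurable_minr. Qed.

(** Open, unlike [box]: smooth cutoffs that vanish for [|z_i| >= k] can converge to its indicator at
    every point, the boundary included. *)
Definition obox (r : R) : set X := [set z | forall i, `|z ord0 i| < r].

Lemma measurable_obox r : measurable (obox r).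
Proof.
have -> : obox r = \bigcap_(i in [set: 'I_n]) ((fun z : X => z ord0 i) @^-1` `]-r, r[).
  apply/seteqP; split => z /= h i; first by move=> _ /=; rewrite in_itv/= -ltr_norml; exact: h.
  by have := h i I; rewrite /= in_itv/= -ltr_norml.
apply: fin_bigcap_measurable => // i _.
rewrite -[X in measurable X]setTI; exact: measurable_coor.
Qed.

Lemma norm_lt_obox (z : X) (r : R) : `|z| < r -> obox r z.
Proof. by move=> h i; exact: le_lt_trans (coord_le_norm z i) h. Qed.

Let trunc f k z : R := \1_(obox k%:R) z * clamp k%:R (f z).

Let measurable_trunc f k : measurable_fun setT f -> measurable_fun setT (trunc f k).
Proof.
move=> mf; apply: measurable_funM; first (by apply: measurable_indic; exact: measurable_obox).
exact: measurable_clamp.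
Qed.

Let trunc_cvg f : measurable_fun setT f -> (sqint mu setT f < +oo)%E ->
  (sqint mu setT (fun z => f z - trunc f k z)) @[k --> \oo] --> 0%E.
Proof.
move=> mf f2; apply: (@dct_cvg0 _ _ _ mu setT _ (fun z => f z ^+ 2)) => //.
- by move=> k; apply: measurable_sqr; apply: measurable_funB => //; exact: measurable_trunc.
- move=> z _; apply: cvg_near_cst.
  exists (Num.truncn (`|z| + `|f z|)).+1 => // k /= hk.
  have h : `|z| + `|f z| < k%:R by rewrite (lt_le_trans (truncnS_gt _))// ler_nat.
  rewrite /trunc indicE mem_set; last first.
    by apply: norm_lt_obox; apply: le_lt_trans h; rewrite lerDl.
  by rewrite mul1r clamp_id ?subrr ?expr0n//; apply: ltW; apply: le_lt_trans h; rewrite lerDr.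
- move=> k z _; rewrite ger0_norm ?sqr_ge0// -(real_normK (num_real (f z))).
  rewrite -(real_normK (num_real (_ - _))) ler_sqr ?nnegrE// /trunc indicE.
  by case: (_ \in _); rewrite ?mul1r ?mul0r ?subr0//; exact: clamp_dist.
- exact: integrable_sq.
Qed.

Let cutoff (k : nat) (m : nat) (z : X) : R :=
  \prod_i (sstep (m%:R * (z ord0 i + k%:R)) * sstep (m%:R * (k%:R - z ord0 i))).

Let C1k_lin (a b : R) j : C1k j (fun x => sstep (a * (x + b))).
Proof.
apply: (C1k_comp (f := sstep) (g := fun x => a * (x + b))); first exact: C1k_sstep.
apply: C1kM; first exact: C1k_cst.
by apply: C1kD; [exact: C1k_id|exact: C1k_cst].
Qed.

Let smooth_cutoff k m : smooth (cutoff k m).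
Proof.
apply: smooth_prod => i; apply: smoothM.
  by apply: (@smooth_coord _ _ (fun x => sstep (m%:R * (x + k%:R)))) => j; exact: C1k_lin.
rewrite (_ : (fun x => _) = (fun x : X => sstep (- m%:R * (x ord0 i + - k%:R)))).
  by apply: (@smooth_coord _ _ (fun x => sstep (- m%:R * (x + - k%:R)))) => j; exact: C1k_lin.
by apply/funext => z; congr sstep; ring.
Qed.

Let cutoff01 k m z : 0 <= cutoff k m z <= 1.
Proof.
apply/andP; split.
  by apply: prodr_ge0 => i _; rewrite mulr_ge0// sstep_ge0.
by apply: prodr_ile1 => i _; rewrite mulr_ge0 ?sstep_ge0//= mulr_ile1// ?sstep_ge0// sstep_le1.
Qed.

Let cutoff_supp k m (z : X) i : k%:R <= `|z ord0 i| -> cutoff k m z = 0.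
Proof.
move=> h; apply/eqP; rewrite /cutoff prodf_seq_eq0; apply/hasP; exists i; first by rewrite mem_index_enum.
rewrite /= mulf_eq0; move: h; rewrite ler_normr => /orP[h|h]; apply/orP; [right|left].
  by rewrite sstep0// mulr_ge0_le0// subr_le0.
by rewrite sstep0// mulr_ge0_le0//; lra.
Qed.

Let cutoff_cvg k z : cutoff k m z @[m --> \oo] --> (\1_(obox k%:R) z : R).
Proof.
rewrite indicE; have [oz|nz] := pselect (obox k%:R z); last first.
  rewrite memNset//=; move/existsNP: nz => [i /negP]; rewrite -leNgt => hi.
  by apply: cvg_near_cst; apply: nearW => m; exact: cutoff_supp hi.
rewrite mem_set//=; apply: cvg_near_cst.
have [e e0 he] : exists2 e, 0 < e & forall i, `|z ord0 i| + e <= k%:R.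
  have [k0|k0] := ltP 0 (k%:R : R); last first.
    exists 1 => // i; have := oz i.
    by move=> /lt_le_trans /(_ k0); rewrite normr_lt0.
  exists (k%:R - `|z|).
    rewrite subr_gt0 /Num.norm/= mx_normrE.
    by apply: bigmax_lt => // -[i j] _ /=; rewrite (ord1 i); exact: oz.
  by move=> i; rewrite addrCA gerDl subr_le0 coord_le_norm.
exists (Num.truncn e^-1).+1 => // m /= hm.
have me : 1 <= m%:R * e.
  by rewrite -ler_pdivrMr// mul1r (le_trans (ltW (truncnS_gt _)))// ler_nat.
rewrite /cutoff big1// => i _; have := he i; rewrite -lerBrDr ler_norml => /andP[h1 h2].
rewrite !sstep1 ?mul1r//; apply: (le_trans me); rewrite ler_wpM2l//; lra.
Qed.

(** Here [p - K] approximates the clamped value [c], and the smooth cutoff [x] approximates the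
    indicator [i]. All quantities being bounded, squares are dominated by absolute values, so that
    L^1 errors control the L^2 error. *)
Lemma trunc_ineq (K p c x i : R) : 0 <= K -> 0 <= i <= 1 -> 0 <= x <= 1 -> `|c| <= K ->
  0 <= p <= K + K ->
  ((p - K) * x - i * c) ^+ 2 <= 2 * (K + K) * `|p - (c + K)| + 2 * K ^+ 2 * `|x - i|.
Proof.
move=> K0 /andP[i0 i1] /andP[x0 x1]; rewrite ler_norml => /andP[c0 c1] /andP[p0 p2].
have -> : (p - K) * x - i * c = (p - (c + K)) * x + c * (x - i) by ring.
apply: (@le_trans _ _ (2 * ((p - (c + K)) * x) ^+ 2 + 2 * (c * (x - i)) ^+ 2)).
  rewrite -subr_ge0 (_ : _ - _ = ((p - (c + K)) * x - c * (x - i)) ^+ 2) ?sqr_ge0//; ring.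
apply: lerD; rewrite -mulrA ler_wpM2l//.
  rewrite -(real_normK (num_real (_ * _))) expr2 normrM (ger0_norm x0).
  apply: ler_pM; rewrite ?mulr_ge0//; last by rewrite ler_piMr.
  apply: (@le_trans _ _ `|p - (c + K)|); first by rewrite ler_piMr.
  by rewrite ler_norml; apply/andP; split; lra.
rewrite exprMn; apply: ler_pM; rewrite ?sqr_ge0//.
  by rewrite -(real_normK (num_real c)) ler_sqr ?nnegrE// ler_norml; apply/andP; split; lra.
rewrite -(real_normK (num_real (x - i))) expr2 ler_piMr//.
by rewrite ler_norml; apply/andP; split; lra.
Qed.

Lemma L2_dense f (e : R) : measurable_fun setT f -> (sqint mu setT f < +oo)%E -> 0 < e ->
  exists2 phi, Cc phi & (sqint mu setT (fun z => phi z - f z)%R <= e%:E)%E.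
Proof.
move=> mf f2 e0.
have e4 : 0 < e / 4 by rewrite divr_gt0.
have e4' : (0 < (e / 4)%:E)%E by rewrite lte_fin.
have [k _ /(_ k (leqnn k)) /= /ltW hk] := cvge_lt (trunc_cvg mf f2) e4'.
have k0 : 0 <= k%:R :> R by [].
have mc : measurable_fun setT (fun z => clamp k%:R (f z) + k%:R).
  by apply: measurable_funD => //; exact: measurable_clamp.
(* [a] exceeds four times the factor [2 (k + k) + 2 k^2] that [trunc_ineq] puts on the two L^1
   errors, each at most [e / a]. *)
pose a : R := 16 * (k%:R + k%:R) + 8 * k%:R ^+ 2 + 1.
have a0 : 0 < a by rewrite /a ltr_wpDl// addr_ge0 ?mulr_ge0 ?addr_ge0 ?sqr_ge0.
have ea : 0 < e / a by rewrite divr_gt0.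
have ea' : (0 < (e / a)%:E)%E by rewrite lte_fin.
(* [approx_bounded] asks for values in [[0, M]], hence the shift by [k], undone in [phi]. *)
have cl z : 0 <= clamp k%:R (f z) + k%:R <= (k + k)%:R.
  by have := clamp_norm (f z) k0; rewrite ler_norml natrD => /andP[h1 h2]; apply/andP; split; lra.
have [psi [sp p1 hp]] := @approx_bounded R n k%:R k0 (fun z => clamp k%:R (f z) + k%:R) (k + k)%N mc
  cl _ ea.
have mB := @measurable_box R n k%:R.
have mI : measurable_fun setT (\1_(obox k%:R) : X -> R) by apply: measurable_indic; exact: measurable_obox.
have mcut m : measurable_fun setT (cutoff k m) by apply: smooth_measurable; exact: smooth_cutoff.
have H : (\int[mu]_(z in box k%:R) (`|cutoff k m z - \1_(obox k%:R) z|)%:E)%E @[m --> \oo] --> 0%E.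
  apply: (@dct_cvg0 _ _ _ mu (box k%:R) _ (cst 1)) => //.
  - by move=> m; apply: measurable_funTS; apply: measurableT_comp => //; exact: measurable_funB.
  - move=> z _; rewrite -[0](normr0 R) -(subrr (\1_(obox k%:R) z : R)).
    by apply: cvg_norm; apply: cvgB; [exact: cutoff_cvg|exact: cvg_cst].
  - move=> m z _; rewrite normr_id; have /andP[h1 h2] := cutoff01 k m z.
    have := @indic01 R n (obox k%:R) z; move: (\1__ z : R) h1 h2 => i; move: (cutoff k m z) => c c0 c1 /andP[i0 i1].
    by rewrite /= ler_norml; apply/andP; split; lra.
  - by apply: (@integrable_box R n k%:R k0 _ 1) => // z _; rewrite /= normr1.
have [m _ /(_ m (leqnn m)) /= /ltW hm] := cvge_lt H ea'.
pose phi z := (psi z - k%:R) * cutoff k m z.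
have cphi : Cc phi.
  apply/CcP; split.
    apply: smoothM; last exact: smooth_cutoff.
    by apply: smoothD => //; exact: smooth_cst.
  by exists k%:R => // z i h; rewrite /phi (@cutoff_supp _ _ _ i) ?mulr0// ltW.
exists phi => //.
have mphi := Cc_measurable cphi; have mt := measurable_trunc k mf.
have mpsi := smooth_measurable sp.
suff S : (sqint mu setT (fun z => phi z - trunc f k z)%R <= (e / 4)%:E)%E.
  rewrite [e](_ : _ = 2 * (e / 4) + 2 * (e / 4)); last by field.
  rewrite (_ : (fun z => _) = (fun z => (phi z - trunc f k z) + (- (f z - trunc f k z)))); last first.
    by apply/funext => z; ring.
  apply: sqint_lt_add => //; first exact: measurable_funB.
    by apply: measurableT_comp => //; exact: measurable_funB.
  by rewrite sqint_opp.
rewrite /sqint; have -> : (\int[mu]_z ((phi z - trunc f k z) ^+ 2)%:E =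
    \int[mu]_(z in box k%:R) ((phi z - trunc f k z) ^+ 2)%:E)%E.
  rewrite [RHS]integral_mkcond; apply: eq_integral => z _; rewrite patchE; case: ifPn => // /negP nz.
  have /existsNP[i /negP] : ~ box k%:R z by move=> h; apply: nz; rewrite inE.
  rewrite -ltNge => hi; rewrite /phi /trunc (@cutoff_supp _ _ _ i) ?(ltW hi)//.
  by rewrite indicE memNset ?mulr0 ?mul0r ?subr0 ?expr0n// => /(_ i); rewrite ltNge ltW.
have mabs (u v : X -> R) : measurable_fun setT u -> measurable_fun setT v ->
    measurable_fun (box k%:R) (fun z => `|u z - v z|).
  by move=> mu' mv; apply: measurable_funTS; apply: measurableT_comp => //; exact: measurable_funB.
apply: (@le_trans _ _ (\int[mu]_(z in box k%:R) ((2 * (k%:R + k%:R)) * `|psi z - (clamp k%:R (f z) + k%:R)| +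
    (2 * k%:R ^+ 2) * `|cutoff k m z - \1_(obox k%:R) z|)%:E)%E).
  apply: ge0_le_integral_fin => //.
  - by apply: measurable_funTS; apply: measurable_sqr; exact: measurable_funB.
  - by apply: measurable_funD; apply: measurable_funM => //; exact: mabs.
  - by move=> z _; exact: sqr_ge0.
  move=> z _; rewrite /phi /trunc.
  apply: trunc_ineq => //; first exact: indic01.
  - exact: clamp_norm.
  - by rewrite -natrD; exact: p1.
have m1 : measurable_fun (box k%:R) (fun z => `|psi z - (clamp k%:R (f z) + k%:R)|) by exact: mabs.
have m2 : measurable_fun (box k%:R) (fun z => `|cutoff k m z - \1_(obox k%:R) z|) by exact: mabs.
have q0 : 0 <= 2 * (k%:R + k%:R) :> R by rewrite mulr_ge0// addr_ge0.
have q1 : 0 <= 2 * k%:R ^+ 2 :> R by rewrite mulr_ge0// sqr_ge0.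
rewrite ge0_integralD_fin//; try (by move=> z _; rewrite mulr_ge0); try exact: measurable_funM.
rewrite !ge0_integralZl_fin//.
apply: (@le_trans _ _ ((2 * (k%:R + k%:R))%:E * (e / a)%:E + (2 * k%:R ^+ 2)%:E * (e / a)%:E)%E).
  by apply: leeD; apply: lee_wpmul2l.
rewrite -!EFinM -EFinD lee_fin -mulrDl mulrCA ler_pM2l// ler_pdivrMr// /a mulrC.
move: q0 q1; move: (k%:R + k%:R : R) (k%:R ^+ 2 : R) => x y; lra.
Qed.

End L2_density.

(** * Lipschitz and second-order bounds for test functions *)

Section Lipschitz.
Context {R : realType}.

Lemma rV_unrconsK n (z : 'rV[R]_n.+1) : rV_rcons (rV_unrcons z) = z.
Proof. by apply/rowP => i; rewrite mxE; case: unliftP => [j|] -> //=; rewrite mxE. Qed.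

Lemma MVT_bound (f f' : R -> R) (M a b : R) : (forall x : R, is_derive x (1 : R) f (f' x)) ->
  (forall x, `|f' x| <= M) -> `|f b - f a| <= M * `|b - a|.
Proof.
move=> df fM; wlog ab : a b / a <= b => [H|].
  by have [ab|/ltW ba] := leP a b; [exact: H|rewrite distrC (distrC b); exact: H].
have [x _ ->] := @MVT_segment _ f f' a b ab (fun x _ => df x)
  (continuous_subspaceT (is_derive1_continuous df)).
by rewrite normrM ler_wpM2r.
Qed.

Lemma smooth_lipschitz n (f : 'rV[R]_n -> R) (M : R) : smooth f ->
  (forall i z, `|partial i f z| <= M) -> forall z w, `|f z - f w| <= M * \sum_i `|z ord0 i - w ord0 i|.
Proof.
elim: n f => [|n IH] f sf fM z w.
  have -> : z = w by apply/rowP => -[].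
  by rewrite subrr normr0 big_ord0 mulr0.
rewrite -(rV_unrconsK z) -(rV_unrconsK w); case: (rV_unrcons z) (rV_unrcons w) => [x y] [x' y'].
have h1 : `|f (rV_rcons (x, y)) - f (rV_rcons (x', y))| <= M * \sum_i `|x ord0 i - x' ord0 i|.
  apply: (IH _ (smooth_slice y sf)) => i v.
  by rewrite (partial_slice y i sf).
have h2 : `|f (rV_rcons (x', y)) - f (rV_rcons (x', y'))| <= M * `|y - y'|.
  exact: (@MVT_bound _ _ M y' y (fun t => is_derive_vslice x' t sf)).
rewrite (le_trans (ler_distD (f (rV_rcons (x', y))) _ _))//.
rewrite (le_trans (lerD h1 h2))// -mulrDr le_eqVlt; apply/orP; left; apply/eqP; congr (_ * _).
rewrite big_ord_recr/=; congr (_ + _).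
  apply: eq_bigr => i _; have -> : widen_ord (leqnSn n) i = lift ord_max i.
    by apply: val_inj; rewrite /= /bump leqNgt ltn_ord.
  by rewrite !mxE liftK.
by rewrite !mxE unlift_none.
Qed.

Lemma Cc_partials_bounded n (f : 'rV[R]_n -> R) : Cc f ->
  exists2 M, 0 <= M & forall i z, `|partial i f z| <= M.
Proof.
move=> cf.
have H i : exists M, 0 <= M /\ forall z, `|partial i f z| <= M.
  by have [M M0 hM] := Cc_bounded (Cc_partial i cf); exists M.
have [M HM] := choice H.
exists (\sum_i M i); first by apply: sumr_ge0 => i _; case: (HM i).
move=> i z; rewrite (le_trans ((HM i).2 z))// (bigD1 i)//= lerDl.
by apply: sumr_ge0 => j _; case: (HM j).
Qed.

Lemma sum_coord_le n (z : 'rV[R]_n) : \sum_i `|z ord0 i| <= n%:R * `|z|.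
Proof.
rewrite (le_trans (ler_sum _ (G := fun=> `|z|) _))//; last first.
  by rewrite sumr_const card_ord mulr_natl.
by move=> i _; exact: coord_le_norm.
Qed.

Lemma Cc_lipschitz n (f : 'rV[R]_n -> R) : Cc f ->
  exists2 L, 0 <= L & forall z w, `|f z - f w| <= L * `|z - w|.
Proof.
move=> cf; have [M M0 hM] := Cc_partials_bounded cf.
exists (M * n%:R); first by rewrite mulr_ge0.
move=> z w; rewrite (le_trans (smooth_lipschitz (Cc_smooth cf) hM z w))// -mulrA ler_wpM2l//.
rewrite (le_trans _ (sum_coord_le _))//; apply: ler_sum => i _.
by rewrite !mxE.
Qed.

(** The point is uniformity in [z]: it justifies differentiating a convolution under the integral
    sign against an arbitrary integrable function. *)
Lemma Cc_taylor n (f : 'rV[R]_n -> R) i : Cc f ->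
  exists2 L, 0 <= L & forall z (h : R),
   `|f (h *: delta_mx ord0 i + z) - f z - h * partial i f z| <= L * `|h| ^+ 2.
Proof.
move=> cf; have [L L0 hL] := Cc_lipschitz (Cc_partial i cf).
exists L => // z h.
pose g t := f (t *: delta_mx ord0 i + z) - t * partial i f z.
pose g' t := partial i f (t *: delta_mx ord0 i + z) - partial i f z.
have dg (t : R) : is_derive t (1 : R) g (g' t).
  apply: is_deriveB; last first.
    rewrite -[X in is_derive _ _ _ X]mul1r.
    have -> : (fun t : R => t * partial i f z) = (fun t => partial i f z * t) by apply/funext => u; rewrite mulrC.
    have := @is_deriveZ _ _ _ id (partial i f z) t 1 1 (is_derive_id _ _).
    by rewrite (_ : (partial i f z) *: 1 = partial i f z) ?mul1r//; exact: mulr1.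
  have := line_is_derive (smooth_is_derive i (t *: delta_mx ord0 i + z) (Cc_smooth cf)) => H.
  rewrite (_ : (fun y => _) = (fun h => f (h *: delta_mx ord0 i + (t *: delta_mx ord0 i + z))) \o (fun y => y - t)).
    rewrite -[X in is_derive _ _ _ X]mulr1; apply: is_derive1_comp; first by rewrite subrr.
    exact: is_derive_shift.
  by apply/funext => y; rewrite /= addrA -scalerDl subrK.
have H : forall t : R, `|t| <= `|h| -> `|g' t| <= L * `|h|.
  move=> t th; rewrite /g' (le_trans (hL _ _))// ler_wpM2l// addrK normrZ.
  rewrite (le_trans _ th)// ler_piMr//.
  rewrite /Num.norm/= mx_normrE; apply: bigmax_le => // -[a b] _ /=; rewrite mxE.
  by case: (_ && _); rewrite ?normr1 ?normr0.
have -> : f (h *: delta_mx ord0 i + z) - f z - h * partial i f z = g h - g 0.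
  by rewrite /g mul0r subr0 scale0r add0r addrAC.
have cg := is_derive1_continuous dg.
have [h0|h0] := leP 0 h.
  have [c hc ->] := @MVT_segment _ g g' 0 h h0 (fun x _ => dg x) (continuous_subspaceT cg).
  rewrite subr0 normrM expr2 mulrA ler_wpM2r// H//.
  by move: hc; rewrite in_itv/= => /andP[c0 ch]; rewrite !ger0_norm.
have [c hc] := @MVT_segment _ g g' h 0 (ltW h0) (fun x _ => dg x) (continuous_subspaceT cg).
rewrite sub0r distrC => ->.
rewrite normrM normrN expr2 mulrA ler_wpM2r// H//.
by move: hc; rewrite in_itv/= => /andP[c0 ch]; rewrite !ler0_norm ?lerN2// ltW.
Qed.

End Lipschitz.

(** * Convolution and mollifiers *)

Section convolution.
Context {R : realType} (n : nat).
Local Notation mu := (leb R n).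
Local Notation X := 'rV[R]_n.
Implicit Types (f g rho : X -> R).

Lemma sub_affmap (z w : X) : z - w = affmap (fun=> -1) (z ord0) w.
Proof. by apply/rowP => i; rewrite !mxE mulN1r addrC. Qed.

Lemma Cc_sub rho z : Cc rho -> Cc (fun w => rho (z - w)).
Proof.
move=> cr; rewrite (_ : (fun w => _) = (fun w => rho (affmap (fun=> -1) (z ord0) w))).
  by apply: Cc_affmap => // i; rewrite oppr_eq0 oner_eq0.
by apply/funext => w; rewrite sub_affmap.
Qed.

Lemma partial_sub rho z i : Cc rho ->
  partial i (fun w => rho (z - w)) = (fun w => - partial i rho (z - w)).
Proof.
move=> cr; rewrite (_ : (fun w => _) = (fun w => rho (affmap (fun=> -1) (z ord0) w))).
  rewrite partial_affmap; last exact: Cc_smooth.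
  by apply/funext => w; rewrite mulN1r sub_affmap.
by apply/funext => w; rewrite sub_affmap.
Qed.

Lemma ge0_integral_sub (F : X -> \bar R) z : measurable_fun setT F -> (forall w, (0 <= F w)%E) ->
  (\int[mu]_w F (z - w)%R = \int[mu]_w F w)%E.
Proof.
move=> mF F0; rewrite -(ge0_integral_affmap (c := fun=> -1) (z ord0) _ mF F0); last first.
  by move=> i; rewrite oppr_eq0 oner_eq0.
rewrite big1; last by move=> i _; rewrite normrN normr1.
by rewrite mul1e; apply: eq_integral => w _; rewrite sub_affmap.
Qed.

Lemma ge0_integral_shift (F : X -> \bar R) w : measurable_fun setT F -> (forall w, (0 <= F w)%E) ->
  (\int[mu]_z F (z - w)%R = \int[mu]_z F z)%E.
Proof.
move=> mF F0; rewrite -(ge0_integral_affmap (c := fun=> 1) (fun i => - w ord0 i) _ mF F0); last first.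
  by move=> i; rewrite oner_eq0.
rewrite big1; last by move=> i _; rewrite normr1.
rewrite mul1e; apply: eq_integral => z _; congr F.
by apply/rowP => i; rewrite !mxE mul1r.
Qed.

Definition conv rho f z : R := \int[mu]_w (rho (z - w) * f w).

Let L1 f := mu.-integrable setT (EFin \o f).

Lemma conv_integrable rho f z : Cc rho -> L1 f ->
  mu.-integrable setT (EFin \o (fun w => rho (z - w) * f w)).
Proof.
move=> cr fi; have [M _ hM] := Cc_bounded (Cc_sub z cr).
by apply: (integrable_mulb (M := M)) => //; apply: Cc_measurable; exact: Cc_sub.
Qed.

Let L1norm f : R := \int[mu]_w `|f w|.

Let L1norm_ge0 f : 0 <= L1norm f. Proof. by apply: Rintegral_ge0 => w _. Qed.

Lemma norm_int_le (h f : X -> R) (c : R) : L1 f -> measurable_fun setT h -> 0 <= c ->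
  (forall w, `|h w| <= c * `|f w|) -> `|\int[mu]_w h w| <= c * L1norm f.
Proof.
move=> fi mh c0 hf.
have mf : measurable_fun setT f by apply/measurable_EFinP; case/integrableP: fi.
have fa : mu.-integrable setT (EFin \o (fun w => `|f w|)) by exact: integrable_norm.
have cfi : mu.-integrable setT (EFin \o (fun w => c * `|f w|)).
  by apply: (integrable_mulb (M := `|c|)) => // w _; rewrite ler_norm.
have hi : mu.-integrable setT (EFin \o h).
  apply: (le_integrable measurableT _ _ cfi); first exact/measurable_EFinP.
  by move=> w _ /=; rewrite lee_fin [X in _ <= X]ger0_norm// mulr_ge0.
rewrite (le_trans (le_normr_Rintegral measurableT hi))//.
rewrite /L1norm -RintegralZl//; apply: le_Rintegral => //.
exact: integrable_norm.
Qed.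

Lemma conv_lipschitz rho f : Cc rho -> L1 f ->
  exists2 L, 0 <= L & forall z z', `|conv rho f z - conv rho f z'| <= L * `|z - z'|.
Proof.
move=> cr fi; have [L L0 hL] := Cc_lipschitz cr.
exists (L * L1norm f) => [|z z']; first by rewrite mulr_ge0.
have mf : measurable_fun setT f by apply/measurable_EFinP; case/integrableP: fi.
rewrite /conv -RintegralB//; try exact: conv_integrable.
rewrite mulrAC; apply: norm_int_le => //; last 2 first.
- by rewrite mulr_ge0.
- move=> w; rewrite -mulrBl normrM ler_wpM2r// (le_trans (hL _ _))//.
  by rewrite opprB addrA subrK.
by apply: measurable_funB; apply: measurable_funM => //; apply: Cc_measurable; exact: Cc_sub.
Qed.

Lemma lipschitz_continuous (f : X -> R) L : 0 <= L ->
  (forall z z', `|f z - f z'| <= L * `|z - z'|) -> continuous f.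
Proof.
move=> L0 hL z; apply/(@cvgrPdist_le _ _ _ (nbhs z)) => e e0; near=> w.
rewrite (le_trans (hL _ _))//.
have L1' : 0 < L + 1 by rewrite ltr_wpDl.
apply: (@le_trans _ _ ((L + 1) * `|z - w|)); first by rewrite ler_wpM2r// lerDl.
rewrite mulrC -ler_pdivlMr//.
near: w; apply: cvgr_dist_le => //.
by rewrite divr_gt0// ltr_wpDl.
Unshelve. all: by end_near. Qed.

(** By [Cc_taylor] the difference quotient differs from the claimed derivative by at most [L |h|]
    times the L^1 norm of [f]. *)
Lemma is_derive_conv rho f i z : Cc rho -> L1 f ->
  is_derive z (delta_mx ord0 i) (conv rho f) (conv (partial i rho) f z).
Proof.
move=> cr fi; have [L L0 hL] := Cc_taylor i cr.
have mf : measurable_fun setT f by apply/measurable_EFinP; case/integrableP: fi.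
have H : ((fun h : R => h^-1 *: ((conv rho f \o shift z) (h *: delta_mx ord0 i) - conv rho f z)) @ 0^')
    --> (conv (partial i rho) f z).
  apply/cvgrPdist_le => e e0; near=> h.
  have h0 : h != 0 by near: h; exact: nbhs_dnbhs_neq.
  have -> : conv (partial i rho) f z - h^-1 *: ((conv rho f \o shift z) (h *: delta_mx ord0 i) - conv rho f z) =
      - h^-1 * \int[mu]_w (rho (h *: delta_mx ord0 i + z - w) * f w - rho (z - w) * f w - h * (partial i rho (z - w) * f w)).
    have ci : mu.-integrable setT (EFin \o (fun w => h * (partial i rho (z - w) * f w))).
      apply: (integrable_mulb (M := `|h|)) => //.
      by apply: conv_integrable => //; exact: Cc_partial.
    rewrite RintegralB//; last first.
      by rewrite /comp; under eq_fun do rewrite EFinB; apply: integrableB => //; exact: conv_integrable.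
    rewrite RintegralB//; try exact: conv_integrable.
    rewrite RintegralZl//; last by apply: conv_integrable => //; exact: Cc_partial.
    rewrite -/(conv _ _ _) -/(conv rho f z) -/(conv (partial i rho) f z) /= /GRing.scale/=.
    by field.
  rewrite normrM normrN normfV mulrC ler_pdivrMr ?normr_gt0//.
  apply: (@le_trans _ _ ((L * `|h| ^+ 2) * L1norm f)).
    apply: norm_int_le => //.
    - apply: measurable_funB; [apply: measurable_funB|]; repeat (apply: measurable_funM => //);
        by apply: Cc_measurable; apply: Cc_sub => //; exact: Cc_partial.
    - by rewrite mulr_ge0// exprn_ge0.
    - move=> w; rewrite mulrA -!mulrBl normrM; apply: ler_wpM2r => //.
      by have := hL (z - w) h; rewrite addrA.
  have -> : L * `|h| ^+ 2 * L1norm f = `|h| * (L1norm f * L) * `|h| by ring.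
  apply: ler_wpM2r => //.
  have q0 : 0 < L1norm f * L + 1 by rewrite ltr_wpDl// mulr_ge0.
  apply: (@le_trans _ _ (`|h| * (L1norm f * L + 1))).
    by rewrite ler_wpM2l// lerDl.
  rewrite -ler_pdivlMr//; near: h; apply: dnbhs0_le.
  by rewrite divr_gt0// ltr_wpDl// mulr_ge0.
apply: DeriveDef; last exact: cvg_lim H.
by apply/cvg_ex; exists (conv (partial i rho) f z).
Unshelve. all: by end_near. Qed.

Lemma smooth_conv rho f : Cc rho -> L1 f -> smooth (conv rho f).
Proof.
move=> cr fi; apply/smoothP => k; elim: k rho cr => [|k IH] rho cr.
  by split => //; have [L L0 hL] := conv_lipschitz cr fi; exact: lipschitz_continuous hL.
split; first by have [L L0 hL] := conv_lipschitz cr fi; exact: lipschitz_continuous hL.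
exists (fun i => conv (partial i rho) f); first by move=> i z; exact: is_derive_conv.
by move=> i; apply: IH; exact: Cc_partial.
Qed.

Lemma partial_conv rho f i : Cc rho -> L1 f ->
  partial i (conv rho f) = conv (partial i rho) f.
Proof.
move=> cr fi; apply/funext => z.
exact: (@derive_val _ _ _ _ _ _ _ (is_derive_conv i z cr fi)).
Qed.

Lemma bsupp_conv rho f r r' : bsupp r rho -> bsupp r' f -> bsupp (r + r') (conv rho f).
Proof.
move=> br bf z i h; rewrite /conv (_ : (fun w => _) = cst 0).
  by rewrite /Rintegral integral0.
apply/funext => w; have [hw|hw] := ltP r' `|w ord0 i|.
  by rewrite (bf w i hw) mulr0.
rewrite (br (z - w) i) ?mul0r// !mxE.
apply: (@lt_le_trans _ _ (`|z ord0 i| - `|w ord0 i|)); last exact: lerB_dist.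
lra.
Qed.

Lemma Cc_conv rho f r : Cc rho -> L1 f -> bsupp r f -> Cc (conv rho f).
Proof.
move=> cr fi bf; apply/CcP; split; first exact: smooth_conv.
have /CcP[_ [r' r'0 br]] := cr.
exists (r' + `|r|); first by rewrite addr_ge0.
apply: bsupp_conv br _ => z i h; apply: (bf z i); exact: le_lt_trans (ler_norm r) h.
Qed.

Lemma sqint_integrable_bsupp f r : measurable_fun setT f -> (sqint mu setT f < +oo)%E -> bsupp r f ->
  L1 f.
Proof.
move=> mf f2 bf.
have mB := @measurable_box R n `|r|.
have -> : f = (fun z => f z * \1_(box `|r|) z).
  apply/funext => z; rewrite indicE; have [bz|nbz] := pselect (box `|r| z).
    by rewrite mem_set// mulr1.
  rewrite memNset// mulr0; apply: bsupp_notin nbz => w i h; apply: (bf w i).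
  exact: le_lt_trans (ler_norm r) h.
apply: integrable_prod2 => //; try exact: measurable_indic.
rewrite /sqint; have -> : (\int[mu]_z ((\1_(box `|r|) z : R) ^+ 2)%:E = \int[mu]_z ((\1_(box `|r|) z : R))%:E)%E.
  by apply: eq_integral => z _; rewrite indicE; case: (_ \in _); rewrite ?expr1n ?expr0n.
by rewrite integral_indic// setIT leb_box.
Qed.

Section mollify.
Variables (rho : X -> R) (cr : Cc rho) (r0 : forall z, 0 <= rho z)
  (r1 : (\int[mu]_z (rho z)%:E = 1)%E).

Let mrho : measurable_fun setT (fun p : X * X => rho (p.1 - p.2)).
Proof.
apply: measurableT_comp; first exact: Cc_measurable.
apply: measurable_fun_rV => i; under eq_fun do rewrite !mxE.
apply: measurable_funB.
  apply: (@measurableT_comp _ _ _ _ _ _ (fun x : X => x ord0 i) _ fst); last exact: measurable_fst.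
  exact: measurable_coor.
apply: (@measurableT_comp _ _ _ _ _ _ (fun x : X => x ord0 i) _ snd); last exact: measurable_snd.
exact: measurable_coor.
Qed.

Lemma conv_sqint_le f : measurable_fun setT f -> L1 f -> (sqint mu setT f < +oo)%E ->
  (sqint mu setT (conv rho f) <= sqint mu setT f)%E.
Proof.
move=> mf fi f2.
have f2i : L1 (fun w => f w ^+ 2) by exact: integrable_sq.
(* Jensen's inequality: the integral of [(f w - c) ^ 2] against the probability density
   [rho (z - w)] is nonnegative, and expanding it at the mean [c] gives the bound. *)
have jensen z : (((conv rho f z) ^+ 2)%:E <= \int[mu]_w (rho (z - w) * f w ^+ 2)%:E)%E.
  have ir : mu.-integrable setT (EFin \o (fun w => rho (z - w))) by apply: Cc_integrable; exact: Cc_sub.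
  have i1 := conv_integrable z cr fi; have i2 := conv_integrable z cr f2i.
  have e1 : \int[mu]_w (rho (z - w)) = 1.
    rewrite /Rintegral (ge0_integral_sub (F := fun w => (rho w)%:E)) ?r1//.
    by apply/measurable_EFinP; exact: Cc_measurable.
  pose c := conv rho f z.
  have i3 : mu.-integrable setT (EFin \o (fun w => 2 * c * (rho (z - w) * f w))).
    by apply: (integrable_mulb (M := `|2 * c|)).
  have i4 : mu.-integrable setT (EFin \o (fun w => c ^+ 2 * rho (z - w))).
    by apply: (integrable_mulb (M := `|c ^+ 2|)).
  have H : 0 <= \int[mu]_w (rho (z - w) * f w ^+ 2 - 2 * c * (rho (z - w) * f w) + c ^+ 2 * rho (z - w)).
    apply: Rintegral_ge0 => w _.
    have -> : rho (z - w) * f w ^+ 2 - 2 * c * (rho (z - w) * f w) + c ^+ 2 * rho (z - w) =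
      rho (z - w) * (f w - c) ^+ 2 by ring.
    by rewrite mulr_ge0// sqr_ge0.
  rewrite RintegralD// in H; last first.
    by rewrite /comp; under eq_fun do rewrite EFinB; exact: integrableB.
  rewrite RintegralB// RintegralZl// RintegralZl// e1 -/(conv _ _ _) -/c mulr1 in H.
  rewrite -[leRHS]fineK; last exact: integrable_fin_num.
  rewrite lee_fin -/(Rintegral mu setT (fun w => rho (z - w) * f w ^+ 2)) -/c.
  rewrite -[\int[mu]_x (rho (z - x) * f x)]/c in H.
  rewrite -[\int[mu]_w _]/(conv rho (fun w => f w ^+ 2) z).
  move: H; move: (conv _ _ _) => I; nra.
have mrf : measurable_fun setT (fun p : X * X => (rho (p.1 - p.2) * f p.2 ^+ 2)%:E).
  apply/measurable_EFinP; apply: measurable_funM => //.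
  by apply: measurable_sqr; exact: measurableT_comp.
apply: (@le_trans _ _ (\int[mu]_z \int[mu]_w (rho (z - w) * f w ^+ 2)%:E)%E).
  apply: ge0_le_integral => //.
  - by move=> z _; rewrite lee_fin sqr_ge0.
  - apply/measurable_EFinP; apply: measurable_sqr; apply: smooth_measurable.
    exact: smooth_conv.
  - apply: (measurable_fun_fubini_tonelli_F (fun p : X * X => (rho (p.1 - p.2) * f p.2 ^+ 2)%:E)) => //.
    by move=> p; rewrite lee_fin mulr_ge0// sqr_ge0.
rewrite (fubini_tonelli (fun p : X * X => (rho (p.1 - p.2) * f p.2 ^+ 2)%:E))//=; last first.
  by move=> p; rewrite lee_fin mulr_ge0// sqr_ge0.
rewrite le_eqVlt; apply/orP; left; apply/eqP; apply: eq_integral => w _.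
rewrite (eq_integral (fun z : X => ((f w ^+ 2)%:E * (rho (z - w)%R)%:E)%E)); last first.
  by move=> z _; rewrite -EFinM mulrC.
have ms : measurable_fun setT (fun z : X => rho (z - w)).
  exact: (measurable_fun_pair1 (f := fun p : X * X => rho (p.1 - p.2))).
rewrite ge0_integralZl//; last 3 first.
- exact/measurable_EFinP.
- by move=> z _; rewrite lee_fin.
- by rewrite lee_fin sqr_ge0.
rewrite (ge0_integral_shift (F := fun z => (rho z)%:E)) ?r1 ?mule1//.
by apply/measurable_EFinP; exact: Cc_measurable.
Qed.

Lemma conv_dist phi L e z : Cc phi -> bsupp e rho -> 0 <= e ->
  (forall z w, `|phi z - phi w| <= L * `|z - w|) -> 0 <= L ->
  `|conv rho phi z - phi z| <= L * e.
Proof.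
move=> cp br e0 hL L0.
have ir : mu.-integrable setT (EFin \o (fun w => rho (z - w))) by apply: Cc_integrable; exact: Cc_sub.
have i1 := conv_integrable z cr (Cc_integrable cp).
have e1 : \int[mu]_w (rho (z - w)) = 1.
  rewrite /Rintegral (ge0_integral_sub (F := fun w => (rho w)%:E)) ?r1//.
  by apply/measurable_EFinP; exact: Cc_measurable.
have i2 : mu.-integrable setT (EFin \o (fun w => phi z * rho (z - w))).
  by apply: (integrable_mulb (M := `|phi z|)).
have -> : conv rho phi z - phi z = \int[mu]_w (rho (z - w) * phi w - phi z * rho (z - w)).
  by rewrite RintegralB// RintegralZl// e1 mulr1.
have := @norm_int_le (fun w => rho (z - w) * phi w - phi z * rho (z - w)) (fun w => rho (z - w)) (L * e) ir _ _ _.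
have -> : L1norm (fun w => rho (z - w)) = 1.
  by rewrite -e1; apply: eq_Rintegral => w _; rewrite ger0_norm.
rewrite mulr1; apply.
- apply: measurable_funB; apply: measurable_funM => //.
  + by apply: Cc_measurable; exact: Cc_sub.
  + exact: Cc_measurable.
  + by apply: Cc_measurable; exact: Cc_sub.
- by rewrite mulr_ge0.
- move=> w; rewrite (mulrC (phi z)) -mulrBr normrM mulrC.
  have [bw|nbw] := pselect (box e (z - w)); last by rewrite (bsupp_notin br nbw) normr0 !mulr0.
  rewrite ler_wpM2r// (le_trans (hL _ _))// ler_wpM2l// -normrN opprB.
  exact: norm_le_box.
Qed.

End mollify.

Lemma mollifier_exists (e : R) : 0 < e -> exists rho : X -> R,
  [/\ Cc rho, bsupp e rho, forall z, 0 <= rho z & (\int[mu]_z (rho z)%:E = 1)%E].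
Proof.
(* Each factor vanishes for [|z_i| >= e] and is 1 for [|z_i| <= e / 2], which makes the integral
   positive and allows normalization. *)
move=> e0; pose b (z : X) : R := \prod_i sstep (2 * (1 - (z ord0 i / e) ^+ 2)).
have sb : smooth b.
  apply: smooth_prod => i.
  apply: (@smooth_coord _ _ (fun x => sstep (2 * (1 - (x / e) ^+ 2)))) => k.
  apply: (C1k_comp (f := sstep) (g := fun x => 2 * (1 - (x / e) ^+ 2))); first exact: C1k_sstep.
  apply: C1kM; first exact: C1k_cst.
  rewrite (_ : (fun x => _) = (fun x => 1 + (- (e^-1) ^+ 2) * (x * x))).
    by apply: C1kD; [exact: C1k_cst|apply: C1kM; [exact: C1k_cst|apply: C1kM; exact: C1k_id]].
  by apply/funext => x; ring.
have b0 z : 0 <= b z by apply: prodr_ge0 => i _; exact: sstep_ge0.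
have bs : bsupp e b.
  move=> z i h; apply/eqP; rewrite /b prodf_seq_eq0; apply/hasP; exists i; first by rewrite mem_index_enum.
  rewrite /= sstep0// pmulr_rle0// subr_le0 -(real_normK (num_real (z ord0 i / e))) normrM normfV (gtr0_norm e0).
  by rewrite exprn_ege1// ler_pdivlMr// mul1r ltW.
have cb : Cc b by apply/CcP; split => //; exists e => //; exact: ltW.
have bi := Cc_integrable cb.
have e2 : 0 <= e / 2 by rewrite divr_ge0// ltW.
have I0 : 0 < \int[mu]_z b z.
  rewrite -lte_fin /Rintegral fineK; last exact: integrable_fin_num.
  apply: (@lt_le_trans _ _ (mu (box (e / 2)))).
    by rewrite leb_boxE// lte_fin exprn_gt0// pmulrn_lgt0// divr_gt0.
  rewrite -[X in mu X]setIT -integral_indic//; last exact: measurable_box.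
  apply: ge0_le_integral_fin => //.
  - by apply: measurable_indic; exact: measurable_box.
  - exact: Cc_measurable.
  move=> z _; rewrite indicE; have [bz|nbz] := pselect (box (e / 2) z); last by rewrite memNset.
  rewrite mem_set// /b big1// => i _; apply: sstep1.
  suff : (z ord0 i / e) ^+ 2 <= 1 / 2 by lra.
  have : `|z ord0 i / e| <= 1 / 2.
    rewrite normrM normfV (gtr0_norm e0) ler_pdivrMr// (le_trans (bz i))//; lra.
  rewrite -(real_normK (num_real (z ord0 i / e))); move: (normr_ge0 (z ord0 i / e)).
  move: (`|_|) => x; nra.
exists (fun z => (\int[mu]_z b z)^-1 * b z); split.
- exact: (CcM' (smooth_cst _) cb).
- by move=> z i h; rewrite (bs z i h) mulr0.
- by move=> z; rewrite mulr_ge0// invr_ge0 ltW.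
- rewrite ge0_integralZl_fin//; last 2 first.
  + exact: Cc_measurable.
  + by rewrite invr_ge0 ltW.
  rewrite -[X in (_ * X)%E]fineK; last exact: integrable_fin_num.
  by rewrite -EFinM -/(Rintegral mu setT b) mulVf// gt_eqF.
Qed.

(** [f] is first replaced by a test function: convolution contracts the L^2 norm, so this error does
    not grow, and on the test function the convergence is uniform with supports in a fixed box.
    Since [d] serves every mollifier of smaller support, a single mollifier can be chosen for a
    function and its whole gradient. *)
Lemma mollify_cvg f r (e : R) : measurable_fun setT f -> (sqint mu setT f < +oo)%E -> bsupp r f -> 0 < e ->
  exists2 d, 0 < d & forall rho, Cc rho -> bsupp d rho -> (forall z, 0 <= rho z) ->
   (\int[mu]_z (rho z)%:E = 1)%E -> (sqint mu setT (fun z => conv rho f z - f z)%R <= e%:E)%E.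
Proof.
move=> mf f2 bf e0.
have e12 : 0 < e / 10 by rewrite divr_gt0.
have [phi cp hp] := L2_dense mf f2 e12.
have [L L0 hL] := Cc_lipschitz cp.
have /CcP[sp [r' r'0 bp]] := cp.
have V0 : 0 <= (((r' + 1) *+ 2) ^+ n : R) by rewrite exprn_ge0// mulrn_wge0// addr_ge0.
set V := ((r' + 1) *+ 2) ^+ n in V0.
(* [d <= 1] keeps the support of [conv rho phi] in the box of radius [r' + 1], of volume [V]; the
   other bound makes [(L d) ^ 2 V] at most [e / 10]. *)
pose d := Num.min 1 (e / (10 * (L ^+ 2 * V + 1))).
have q0 : 0 < 10 * (L ^+ 2 * V + 1) by rewrite mulr_gt0// ltr_wpDl// mulr_ge0// sqr_ge0.
have d0 : 0 < d by rewrite lt_min ltr01 divr_gt0.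
exists d => // rho cr br rho0 rho1.
have fi := sqint_integrable_bsupp mf f2 bf.
have pi := Cc_integrable cp.
have mp := Cc_measurable cp.
have mfp : measurable_fun setT (fun z => f z - phi z) by exact: measurable_funB.
have hp' : (sqint mu setT (fun z => f z - phi z)%R <= (e / 10)%:E)%E.
  by rewrite -sqint_opp; under eq_fun do rewrite opprB.
have fpi : L1 (fun z => f z - phi z).
  by rewrite /L1 /comp; under eq_fun do rewrite EFinB; exact: integrableB.
have -> : (fun z => conv rho f z - f z) =
   (fun z => (conv rho (fun z => f z - phi z) z + (conv rho phi z - phi z)) + (phi z - f z)).
  apply/funext => z.
  have -> : conv rho (fun z => f z - phi z) z = conv rho f z - conv rho phi z.
    rewrite /conv -RintegralB//; try exact: conv_integrable.
    by apply: eq_Rintegral => w _; rewrite mulrBr.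
  ring.
have mc g : L1 g -> measurable_fun setT (conv rho g) by move=> gi; apply: smooth_measurable; exact: smooth_conv.
rewrite (_ : e = 2 * (2 * (e / 10) + 2 * (e / 10)) + 2 * (e / 10)); last by field.
apply: sqint_lt_add => //.
- by apply: measurable_funD; [exact: mc|apply: measurable_funB => //; exact: mc].
- exact: measurable_funB.
apply: sqint_lt_add => //.
- exact: mc.
- by apply: measurable_funB => //; exact: mc.
- apply: (le_trans _ hp'); apply: conv_sqint_le => //.
  exact: le_lt_trans hp' (ltry _).
have bs : bsupp (r' + 1) (fun z => conv rho phi z - phi z).
  move=> z i h; rewrite (bp z i); last by apply: le_lt_trans h; rewrite lerDl.
  rewrite (@bsupp_conv _ _ d r' br bp z i) ?subr0//.
  by apply: le_lt_trans h; rewrite addrC lerD2l ge_min lexx.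
have mB := @measurable_box R n (r' + 1).
have r'1 : 0 <= r' + 1 by rewrite addr_ge0.
apply: (@le_trans _ _ (\int[mu]_z ((L * d) ^+ 2 * \1_(box (r' + 1)) z)%:E)%E).
  apply: ge0_le_integral_fin => //.
  - by apply: measurable_sqr; apply: measurable_funB => //; exact: mc.
  - by apply: measurable_funM => //; exact: measurable_indic.
  - by move=> z _; exact: sqr_ge0.
  move=> z _; rewrite indicE; have [bz|nbz] := pselect (box (r' + 1) z); last first.
    by rewrite (bsupp_notin bs nbz) expr0n/= memNset// mulr0.
  rewrite mem_set// mulr1 -(real_normK (num_real (_ - _))) ler_sqr ?nnegrE// ?mulr_ge0// ?(ltW d0)//.
  by apply: conv_dist => //; exact: ltW.
rewrite ge0_integralZl_fin//; try exact: measurable_indic; try exact: sqr_ge0.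
have -> : (\int[mu]_z (\1_(box (r' + 1)) z : R)%:E = V%:E)%E.
  by rewrite integral_indic// setIT; exact: leb_boxE.
rewrite -EFinM lee_fin.
have d1 : d <= 1 by rewrite ge_min lexx.
have de : d * (10 * (L ^+ 2 * V + 1)) <= e by rewrite -ler_pdivlMr// ge_min lexx orbT.
have LV : 0 <= L ^+ 2 * V by rewrite mulr_ge0// sqr_ge0.
have -> : (L * d) ^+ 2 * V = (L ^+ 2 * V) * d * d by ring.
move: LV de; move: (L ^+ 2 * V) => K K0 de.
have : K * d * d <= K * d by rewrite ler_piMr// mulr_ge0// ltW.
nra.
Qed.

End convolution.

(** * Weak derivatives, cutoffs and density in H^1 *)

Section weak.
Context {R : realType} (n : nat).
Local Notation mu := (leb R n).
Local Notation X := 'rV[R]_n.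
Implicit Types (D : set X) (u f : X -> R) (g : 'I_n -> X -> R).

Lemma Lpow2E D f : Lpow D 2 f = sqint mu D f.
Proof.
apply: eq_integral => z _; congr EFin.
by rewrite powR_mulrn// real_normK// num_real.
Qed.

Lemma L2P D f : L2 D f <-> measurable_fun D f /\ (sqint mu D f < +oo)%E.
Proof. by rewrite /L2 Lpow2E. Qed.

Lemma L2_Cc D f : measurable D -> Cc f -> L2 D f.
Proof.
move=> mD cf; apply/L2P; split; first by apply: measurable_funTS; exact: Cc_measurable.
have c2 : Cc (fun z => f z * f z) by apply: CcM => //; exact: Cc_smooth.
have /integrableP[_] := integrableS measurableT mD (@subsetT _ D) (Cc_integrable c2).
apply: le_lt_trans; apply: ge0_le_integral_fin => //.
- by apply: measurable_funTS; apply: measurable_sqr; exact: Cc_measurable.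
- by apply: measurable_funTS; apply: measurableT_comp => //; exact: Cc_measurable.
- by move=> z _; exact: sqr_ge0.
- by move=> z _; rewrite expr2 ler_norm.
Qed.

Lemma L2_integrableM D u f : measurable D -> L2 D u -> L2 D f ->
  mu.-integrable D (EFin \o (fun z => u z * f z)).
Proof. by move=> mD /L2P[mf f2] /L2P[mg g2]; exact: integrable_prod2. Qed.

Lemma L2D D u f : measurable D -> L2 D u -> L2 D f -> L2 D (fun z => u z + f z).
Proof.
move=> mD /L2P[mf f2] /L2P[mg g2]; apply/L2P; split; first exact: measurable_funD.
apply: le_lt_trans (sqint_add mu mD mf mg) _.
by rewrite lte_add_pinfty// lte_mul_pinfty// ?sqint_ge0.
Qed.

Lemma L2_mulb D f (h : X -> R) (M : R) : measurable D -> measurable_fun D h -> (forall z, D z -> `|h z| <= M) ->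
  L2 D f -> L2 D (fun z => h z * f z).
Proof.
move=> mD mh hM /L2P[mf f2]; apply/L2P; split; first exact: measurable_funM.
apply: (@le_lt_trans _ _ (sqint mu D (fun z => M * f z))).
  apply: le_sqint => //; [exact: measurable_funM|exact: measurable_funM|].
  by move=> z Dz; rewrite !normrM ler_wpM2r// (le_trans (hM z Dz))// ler_norm.
rewrite /sqint; under eq_integral do rewrite exprMn.
rewrite ge0_integralZl_fin//; [|exact: measurable_sqr|by move=> z _; exact: sqr_ge0|exact: sqr_ge0].
by rewrite lte_mul_pinfty// ?lee_fin ?sqr_ge0.
Qed.

Lemma Lpow_patch D D' f p : p != 0 -> D `<=` D' -> Lpow D' p (f \_ D) = Lpow D p f.
Proof.
move=> p0 DD; rewrite /Lpow integral_mkcond [RHS]integral_mkcond; apply: eq_integral => z _.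
rewrite !patchE; case: ifPn => zD'; case: ifPn => // zD.
- by rewrite normr0 powR0.
- by exfalso; move: zD'; rewrite (mem_set (DD _ (set_mem zD))).
Qed.

Lemma L2_patch D D' f : measurable D -> measurable D' -> D `<=` D' -> L2 D f -> L2 D' (f \_ D).
Proof.
move=> mD mD' DD [mf f2]; split; last by rewrite Lpow_patch// pnatr_eq0.
by apply/measurable_restrict => //; rewrite setIidr.
Qed.

#[local] Opaque smooth Cc L2 Lpow.

Lemma integral_patch D D' f (h : X -> R) : D `<=` D' ->
  \int[mu]_(z in D') ((f \_ D) z * h z) = \int[mu]_(z in D) (f z * h z).
Proof.
move=> DD; rewrite Rintegral_mkcond [RHS]Rintegral_mkcond; apply: eq_Rintegral => z _.
rewrite !patchE; case: ifPn => zD'; case: ifPn => // zD.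
- by rewrite mul0r.
- by exfalso; move: zD'; rewrite (mem_set (DD _ (set_mem zD))).
Qed.

(** Leibniz rule together with extension by zero from [D] to [D']. The last hypothesis makes
    [phi * eta] an admissible test function on [D]. It covers a cutoff at infinity, with [D = D'],
    as well as a cutoff that removes one face of a strip. *)
Lemma weak_partial_cut D D' u f eta i : measurable D -> measurable D' -> D `<=` D' ->
  L2 D u -> L2 D f -> is_weak_partial D i u f -> smooth eta ->
  (forall phi, Cc phi -> fsupport phi `<=` D' -> fsupport (fun z => phi z * eta z) `<=` D) ->
  is_weak_partial D' i ((fun z => eta z * u z) \_ D)
     ((fun z => eta z * f z + partial i eta z * u z) \_ D).
Proof.
move=> mD mD' DD Lu Lf wf se hs phi cphi sphi.
rewrite !integral_patch//.
have sphi' := Cc_smooth cphi.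
have cpe : Cc (fun z => phi z * eta z) by exact: CcM.
have := wf _ cpe (hs _ cphi sphi); rewrite (partialM _ sphi' se).
have cdp := Cc_partial i cphi.
have i1 : mu.-integrable D (EFin \o (fun z => u z * (phi z * partial i eta z))).
  by apply: (L2_integrableM mD Lu); apply: (L2_Cc mD); apply: (CcM cphi); exact: smooth_partial.
have i2 : mu.-integrable D (EFin \o (fun z => u z * (partial i phi z * eta z))).
  by apply: (L2_integrableM mD Lu); apply: (L2_Cc mD); exact: (CcM cdp).
have i3 : mu.-integrable D (EFin \o (fun z => f z * (phi z * eta z))).
  by apply: (L2_integrableM mD Lf); apply: (L2_Cc mD).
have -> : \int[mu]_(z in D) (u z * (phi z * partial i eta z + eta z * partial i phi z)) =
   \int[mu]_(z in D) (u z * (phi z * partial i eta z)) + \int[mu]_(z in D) (u z * (partial i phi z * eta z)).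
  by rewrite -RintegralD//; apply: eq_Rintegral => z _; ring.
have -> : \int[mu]_(z in D) (eta z * u z * partial i phi z) = \int[mu]_(z in D) (u z * (partial i phi z * eta z)).
  by apply: eq_Rintegral => z _; ring.
have -> : \int[mu]_(z in D) ((eta z * f z + partial i eta z * u z) * phi z) =
   \int[mu]_(z in D) (f z * (phi z * eta z)) + \int[mu]_(z in D) (u z * (phi z * partial i eta z)).
  by rewrite -RintegralD//; apply: eq_Rintegral => z _; ring.
lra.
Qed.

Lemma H1_cut D D' u g eta (M : R) : measurable D -> measurable D' -> D `<=` D' ->
  H1 D u g -> smooth eta -> (forall z, `|eta z| <= M) -> (forall i z, `|partial i eta z| <= M) ->
  (forall phi, Cc phi -> fsupport phi `<=` D' -> fsupport (fun z => phi z * eta z) `<=` D) ->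
  H1 D' ((fun z => eta z * u z) \_ D)
     (fun i => (fun z => eta z * g i z + partial i eta z * u z) \_ D).
Proof.
move=> mD mD' DD [Lu Hg] se eM deM hs.
have me : measurable_fun D eta by apply: measurable_funTS; exact: smooth_measurable.
have mde i : measurable_fun D (partial i eta).
  by apply: measurable_funTS; apply: smooth_measurable; exact: smooth_partial.
split; first by apply: (L2_patch mD mD' DD); exact: (L2_mulb mD me (fun z _ => eM z) Lu).
move=> i; have [Lg wg] := Hg i; split; last exact: weak_partial_cut.
apply: (L2_patch mD mD' DD); apply: (L2D mD).
  exact: (L2_mulb mD me (fun z _ => eM z) Lg).
exact: (L2_mulb mD (mde i) (fun z _ => deM i z) Lu).
Qed.

(** Equal to 1 for [|z| <= k + 1]. Being a dilation of a fixed function it has a gradient of order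
    [1 / k], so that cutting off at infinity costs nothing in the limit. *)
Definition cutn (k : nat) : X -> R :=
  fun z => \prod_i sstep (2 - ((k.+1%:R)^-1 * z ord0 i) ^+ 2).

Let cut1 (z : X) : R := \prod_i sstep (2 - (z ord0 i) ^+ 2).

Lemma Cc_cut1 : Cc cut1.
Proof.
apply/CcP; split.
  apply: smooth_prod => i.
  apply: (@smooth_coord _ _ (fun x => sstep (2 - x ^+ 2))) => k.
  apply: (C1k_comp (f := sstep) (g := fun x => 2 - x ^+ 2)); first exact: C1k_sstep.
  rewrite (_ : (fun x => _) = (fun x => 2 + (-1) * (x * x))).
    by apply: C1kD; [exact: C1k_cst|apply: C1kM; [exact: C1k_cst|apply: C1kM; exact: C1k_id]].
  by apply/funext => x; ring.
exists 2 => // z i h; apply/eqP; rewrite /cut1 prodf_seq_eq0; apply/hasP; exists i; first by rewrite mem_index_enum.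
rewrite /= sstep0// subr_le0 -(real_normK (num_real (z ord0 i))).
move: h; move: (`|_|) => x; nra.
Qed.

Lemma cutnE k : cutn k = fun z => cut1 (affmap (fun=> k.+1%:R^-1) (fun=> 0) z).
Proof. by apply/funext => z; apply: eq_bigr => i _; rewrite !mxE addr0. Qed.

Lemma Cc_cutn k : Cc (cutn k).
Proof.
rewrite cutnE; apply: Cc_affmap; last exact: Cc_cut1.
by move=> i; rewrite invr_eq0 pnatr_eq0.
Qed.

Lemma cutn01 k z : 0 <= cutn k z <= 1.
Proof.
apply/andP; split; first by apply: prodr_ge0 => i _; exact: sstep_ge0.
by apply: prodr_ile1 => i _; rewrite sstep_ge0 sstep_le1.
Qed.

Lemma cutn_eq1 k z : `|z| <= k.+1%:R -> cutn k z = 1.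
Proof.
move=> h; rewrite /cutn big1// => i _; rewrite sstep1//.
have : `|k.+1%:R^-1 * z ord0 i| <= 1.
  rewrite normrM normfV (ger0_norm (ler0n _ _)) mulrC ler_pdivrMr ?ltr0n// mul1r.
  exact: le_trans (coord_le_norm z i) h.
rewrite -(real_normK (num_real (_ * _))); move: (normr_ge0 (k.+1%:R^-1 * z ord0 i)); move: (`|_|) => x; nra.
Qed.

Lemma cutn_partial : exists2 M : R, 0 <= M & forall k i z, `|partial i (cutn k) z| <= M / k.+1%:R.
Proof.
have [M M0 hM] := Cc_partials_bounded Cc_cut1; exists M => // k i z.
rewrite cutnE partial_affmap; last exact: Cc_smooth Cc_cut1.
by rewrite normrM mulrC normfV (ger0_norm (ler0n _ _)); apply: ler_wpM2r => //; rewrite invr_ge0.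
Qed.

Lemma fin_exists_pos (P : 'I_n -> R -> Prop) : (forall i, exists2 d, 0 < d & forall d', 0 < d' <= d -> P i d') ->
  exists2 d, 0 < d & forall i, P i d.
Proof.
move=> H; have H' i : exists d, 0 < d /\ forall d', 0 < d' <= d -> P i d'.
  by have [d d0 hd] := H i; exists d.
have [d Hd] := choice H'.
have p0 : 0 < \big[Num.min/1]_i d i.
  by elim/big_ind: _ => // [x y x0 y0|i _]; [rewrite lt_min x0|case: (Hd i)].
exists (\big[Num.min/1]_i d i) => // i; apply: (Hd i).2; rewrite p0/=.
exact: bigmin_le.
Qed.

Lemma trunc_L2_cvg f : L2 setT f -> (sqint mu setT (fun z => cutn k z * f z - f z)%R) @[k --> \oo] --> 0%E.
Proof.
move=> /L2P[mf f2]; have mc k := Cc_measurable (Cc_cutn k).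
apply: (@dct_cvg0 _ _ _ mu setT _ (fun z => f z ^+ 2)) => //.
- by move=> k; apply: measurable_sqr; apply: measurable_funB => //; exact: measurable_funM.
- move=> z _; apply: cvg_near_cst; exists (Num.truncn `|z|) => // k /= hk.
  rewrite cutn_eq1 ?mul1r ?subrr ?expr0n//.
  by rewrite (le_trans (ltW (truncnS_gt _)))// ler_nat.
- move=> k z _; rewrite ger0_norm ?sqr_ge0//.
  have /andP[h1 h2] := cutn01 k z.
  rewrite (_ : _ - _ = (cutn k z - 1) * f z); last by ring.
  rewrite exprMn ler_piMl ?sqr_ge0//; nra.
- exact: integrable_sq.
Qed.

Lemma trunc_grad_cvg f i : L2 setT f -> (sqint mu setT (fun z => partial i (cutn k) z * f z)%R) @[k --> \oo] --> 0%E.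
Proof.
move=> /L2P[mf f2]; have mc k := Cc_measurable (Cc_partial i (Cc_cutn k)).
have [M M0 hM] := cutn_partial.
apply: (@dct_cvg0 _ _ _ mu setT _ (fun z => M ^+ 2 * f z ^+ 2)) => //.
- by move=> k; apply: measurable_sqr; exact: measurable_funM.
- move=> z _; apply/cvgrPdist_le => e e0; near=> k.
  rewrite sub0r normrN normrX normrM exprMn.
  apply: (@le_trans _ _ ((M / k.+1%:R) ^+ 2 * `|f z| ^+ 2)).
    rewrite ler_wpM2r ?sqr_ge0// ler_sqr ?nnegrE ?divr_ge0//; exact: hM.
  have k1 : 1 <= k.+1%:R :> R by rewrite ler1n.
  have k2 : M ^+ 2 * `|f z| ^+ 2 / e <= k.+1%:R.
    by near: k; exists (Num.truncn (M ^+ 2 * `|f z| ^+ 2 / e)) => // k /= hk;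
      rewrite (le_trans (ltW (truncnS_gt _)))// ler_nat.
  rewrite expr_div_n mulrAC ler_pdivrMr ?exprn_gt0//.
  move: k2; rewrite ler_pdivrMr// mulrC => k2; apply: (le_trans k2).
  by rewrite mulrC; apply: ler_wpM2l; [exact: ltW|rewrite expr2 ler_peMl// (le_trans ler01 k1)].
- move=> k z _; rewrite ger0_norm ?sqr_ge0// exprMn ler_wpM2r ?sqr_ge0//.
  rewrite -(real_normK (num_real (partial _ _ _))) ler_sqr ?nnegrE//.
  by rewrite (le_trans (hM _ _ _))// ler_pdivrMr// ler_peMr// ler1n.
- by apply: (integrable_mulb (M := `|M ^+ 2|)) => //; exact: integrable_sq.
Unshelve. all: by end_near. Qed.

Lemma fsupportT f : fsupport f `<=` setT. Proof. by []. Qed.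

(** [rho (z - w)] is a test function of [w], so the definition of the weak derivative moves the
    derivative from [rho] to [u]; the sign from [z - w] cancels the one from integration by
    parts. *)
Lemma conv_weak rho u f i z : Cc rho -> L2 setT u -> is_weak_partial setT i u f ->
  conv (partial i rho) u z = conv rho f z.
Proof.
move=> cr Lu wu; have := wu _ (Cc_sub z cr) (@fsupportT _).
rewrite partial_sub// => H.
have -> : conv rho f z = \int[mu]_w (f w * rho (z - w)).
  by apply: eq_Rintegral => w _; rewrite mulrC.
rewrite -[RHS]opprK -H -mulN1r -RintegralZl//.
  by apply: eq_Rintegral => w _; ring.
apply: (L2_integrableM measurableT Lu); rewrite (_ : (fun w => _) = (fun w => (-1) * partial i rho (z - w))).
  apply: (@L2_mulb setT _ (fun=> -1) 1 measurableT (measurable_cst _)); first by move=> w _; rewrite normrN normr1.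
  by apply: (L2_Cc measurableT); apply: Cc_sub; exact: Cc_partial.
by apply/funext => w; rewrite mulN1r.
Qed.

Lemma bsupp_le r r' f : r <= r' -> bsupp r f -> bsupp r' f.
Proof. by move=> rr bf z i h; apply: (bf z i); exact: le_lt_trans h. Qed.

(** The cutoff precedes the mollification because the convolution lemmas need integrability, and a
    function of L^2 is integrable once its support is bounded. *)
Lemma H1_dense u g (e : R) : H1 setT u g -> 0 < e ->
  exists2 phi, Cc phi & (H1dist2 setT u g phi < e%:E)%E.
Proof.
move=> [Lu Hg] e0.
have Lg i : L2 setT (g i) by case: (Hg i).
have wg i : is_weak_partial setT i u (g i) by case: (Hg i).
(* The total error will be at most [(4 + 10 n) (e / c)]. *)
pose c : R := 12 * n.+1%:R.
have c0 : 0 < c by rewrite mulr_gt0// ltr0n.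
have ec : (0 < (e / c)%:E)%E by rewrite lte_fin divr_gt0.
have near1 := cvge_lt (trunc_L2_cvg Lu) ec.
have near2 : \forall k \near \oo, forall i, (sqint mu setT (fun z => cutn k z * g i z - g i z)%R < (e / c)%:E)%E.
  by apply: filter_forall => i; exact: cvge_lt (trunc_L2_cvg (Lg i)) ec.
have near3 : \forall k \near \oo, forall i, (sqint mu setT (fun z => partial i (cutn k) z * u z)%R < (e / c)%:E)%E.
  by apply: filter_forall => i; exact: cvge_lt (trunc_grad_cvg i Lu) ec.
have [k [k1 k2 k3]] : exists k, [/\ (sqint mu setT (fun z => cutn k z * u z - u z)%R < (e / c)%:E)%E,
    forall i, (sqint mu setT (fun z => cutn k z * g i z - g i z)%R < (e / c)%:E)%E &
    forall i, (sqint mu setT (fun z => partial i (cutn k) z * u z)%R < (e / c)%:E)%E].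
  have [k _ /(_ k (leqnn k)) [h1 [h2 h3]]] := filterI near1 (filterI near2 near3).
  by exists k.
pose v z := cutn k z * u z.
pose h i z := cutn k z * g i z + partial i (cutn k) z * u z.
have cc := Cc_cutn k; have /CcP[_ [r r0 br]] := cc.
have [M M0 hM] := Cc_bounded cc; have [M' M'0 hM'] := Cc_partials_bounded cc.
have H1v : H1 setT v h.
  have := @H1_cut setT setT u g (cutn k) (M + M') measurableT measurableT (fun _ h => h) (conj Lu Hg)
    (Cc_smooth cc) _ _ _.
  rewrite patch_setT; under [X in H1 _ _ X]eq_fun do rewrite patch_setT.
  apply => //.
  - by move=> z; rewrite (le_trans (hM z))// lerDl.
  - by move=> i z; rewrite (le_trans (hM' i z))// lerDr.
have [Lv Hh] := H1v.
have bv : bsupp r v by move=> z i hz; rewrite /v (br z i hz) mul0r.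
have bh i : bsupp r (h i).
  by move=> z j hz; rewrite /h (br z j hz) (bsupp_partial i br hz) !mul0r addr0.
have ec' : 0 < e / c by rewrite divr_gt0.
have /L2P[mv v2] := Lv.
have [d0 d00 Hd0] := mollify_cvg mv v2 bv ec'.
have Hd i : exists2 d, 0 < d & forall d', 0 < d' <= d -> forall rho, Cc rho -> bsupp d' rho -> (forall z, 0 <= rho z) ->
   (\int[mu]_z (rho z)%:E = 1)%E -> (sqint mu setT (fun z => conv rho (h i) z - h i z)%R <= (e / c)%:E)%E.
  have [/L2P[mh h2] _] := Hh i.
  have [d d0' Hd] := mollify_cvg mh h2 (bh i) ec'.
  exists d => // d' /andP[_ dd] rho cr bd; apply: Hd => //; exact: bsupp_le bd.
have [d1 d10 Hd1] := fin_exists_pos Hd.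
have dm : 0 < Num.min d0 d1 by rewrite lt_min d00.
have [rho [cr brho rho0 rho1]] := @mollifier_exists R n _ dm.
have b0 : bsupp d0 rho by apply: bsupp_le brho; rewrite ge_min lexx.
have b1 : bsupp d1 rho by apply: bsupp_le brho; rewrite ge_min lexx orbT.
have vi := sqint_integrable_bsupp mv v2 bv.
exists (conv rho v); first exact: Cc_conv vi bv.
have mcv : measurable_fun setT (conv rho v) by apply: smooth_measurable; exact: smooth_conv.
have /L2P[mu_ u2] := Lu.
have E1 : (sqint mu setT (fun z => conv rho v z - u z)%R <= (4 * (e / c))%:E)%E.
  rewrite (_ : (fun z => _) = (fun z => (conv rho v z - v z) + (v z - u z))); last by apply/funext => z; ring.
  rewrite (_ : 4 * (e / c) = 2 * (e / c) + 2 * (e / c)); last by ring.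
  apply: sqint_lt_add => //; [exact: measurable_funB|exact: measurable_funB|exact: Hd0|exact: ltW].
have E2 i : (sqint mu setT (fun z => partial i (conv rho v) z - g i z)%R <= (10 * (e / c))%:E)%E.
  have [/L2P[mh h2] wh] := Hh i.
  have hi := sqint_integrable_bsupp mh h2 (bh i).
  have -> : partial i (conv rho v) = conv rho (h i).
    by rewrite partial_conv//; apply/funext => z; exact: conv_weak.
  have mch : measurable_fun setT (conv rho (h i)) by apply: smooth_measurable; exact: smooth_conv.
  have /L2P[mg g2] := Lg i.
  have mk : measurable_fun setT (cutn k) by exact: Cc_measurable.
  have mpk : measurable_fun setT (partial i (cutn k)) by apply: Cc_measurable; exact: Cc_partial.
  rewrite (_ : (fun z => _) = (fun z => (conv rho (h i) z - h i z) + ((cutn k z * g i z - g i z) + partial i (cutn k) z * u z))); last first.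
    by apply/funext => z; rewrite /h; ring.
  rewrite (_ : 10 * (e / c) = 2 * (e / c) + 2 * (2 * (e / c) + 2 * (e / c))); last by ring.
  have m1 : measurable_fun setT (fun z => cutn k z * g i z - g i z).
    by apply: measurable_funB => //; exact: measurable_funM.
  have m2 : measurable_fun setT (fun z => partial i (cutn k) z * u z) by exact: measurable_funM.
  apply: sqint_lt_add => //.
  - exact: measurable_funB.
  - exact: measurable_funD.
  - exact: Hd1.
  - by apply: sqint_lt_add => //; apply: ltW.
rewrite /H1dist2 /dirichlet !Lpow2E.
apply: (@le_lt_trans _ _ ((4 * (e / c))%:E + \sum_(i < n) (10 * (e / c))%:E)%E).
  by apply: leeD => //; apply: lee_sum => i _; rewrite Lpow2E; exact: E2.
rewrite sumEFin -EFinD lte_fin sumr_const card_ord -mulr_natl.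
have n0 : 0 <= n%:R :> R by [].
have q : e / c * c = e by rewrite divfK// gt_eqF.
move: q ec' n0; rewrite /c -natr1; move: (n%:R : R) (e / _) => N t; nra.
Qed.

End weak.

(** * The Gagliardo-Nirenberg inequality *)

Section powers.
Context {R : realType}.

Lemma powRD_ge0 (x a b : R) : 0 <= a -> 0 <= b -> x `^ (a + b) = x `^ a * x `^ b.
Proof.
move=> a0 b0; have [ab|ab] := eqVneq (a + b) 0; last by apply: powRD; rewrite (negbTE ab).
have a1 : a = 0 by lra.
have b1 : b = 0 by lra.
by rewrite a1 b1 addr0 !powRr0 mulr1.
Qed.

Lemma measurable_powR_comp d (T : measurableType d) (D : set T) (f : T -> R) p : measurable_fun D f ->
  measurable_fun D (fun x => f x `^ p).
Proof. by move=> mf; exact: (measurableT_comp (measurable_powR p) mf). Qed.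

Lemma normr_powR2 (x p : R) : (x ^+ 2) `^ p = `|x| `^ (2 * p).
Proof. by rewrite powRrM powR_mulrn// real_normK// num_real. Qed.

(** The weight [th = 0], whose exponent [1 / th] would be infinite, is treated apart: it occurs in
    [GN_step] when [n = 0]. *)
Lemma ge0_hoelder_powR d (T : measurableType d) (mu : {measure set T -> \bar R}) (f g : T -> R) (th : R) :
  measurable_fun setT f -> measurable_fun setT g -> (forall x, 0 <= f x) -> (forall x, 0 <= g x) ->
  0 <= th < 1 ->
  (\int[mu]_x (f x `^ th * g x `^ (1 - th))%:E <=
   (\int[mu]_x (f x)%:E) `^ th * (\int[mu]_x (g x)%:E) `^ (1 - th))%E.
Proof.
move=> mf mg f0 g0 /andP[]; rewrite le_eqVlt => /predU1P[<- _|th0 th1].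
  rewrite subr0 poweRe0 mul1e poweRe1 ?integral_ge0//; last by move=> x _; rewrite lee_fin.
  by apply: ge0_le_integral_fin => //; [apply: measurable_funM; exact: measurable_powR_comp|
    move=> x _; rewrite mulr_ge0 ?powR_ge0|move=> x _; rewrite powRr0 mul1r powRr1].
have th1' : 0 < 1 - th by lra.
have := @hoelder _ T R mu (fun x => f x `^ th) (fun x => g x `^ (1 - th)) th^-1 (1 - th)^-1
  (measurable_powR_comp _ mf) (measurable_powR_comp _ mg).
rewrite !invr_gt0 => /(_ th0 th1'); rewrite !invrK => /(_ _)/wrap[]; first by ring.
rewrite Lnorm1 unlock /= !invrK => H; apply: le_trans (le_trans H _).
  have mfg : measurable_fun setT (fun x => f x `^ th * g x `^ (1 - th)).
    by apply: measurable_funM; exact: measurable_powR_comp.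
  apply: ge0_le_integral_fin => //.
  - exact: measurableT_comp.
  - by move=> x _; rewrite mulr_ge0 ?powR_ge0.
  - by move=> x _; rewrite ler_norm.
apply: lee_pmul; rewrite ?poweR_ge0//.
  rewrite le_eqVlt; apply/orP; left; apply/eqP; congr (_ `^ _)%E; apply: eq_integral => x _.
  by rewrite /= ger0_norm ?powR_ge0// -powRrM mulfV ?gt_eqF// powRr1.
rewrite le_eqVlt; apply/orP; left; apply/eqP; congr (_ `^ _)%E; apply: eq_integral => x _.
by rewrite /= ger0_norm ?powR_ge0// -powRrM mulfV ?gt_eqF// powRr1.
Qed.

End powers.

#[local] Opaque smooth Cc L2.

(** * Slices of test functions and induction on the dimension *)

Section GN.
Context {R : realType}.
Local Notation mu n := (leb R n).

Definition rmass n (f : 'rV[R]_n -> R) : R := fine (sqint (mu n) setT f).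
Definition rdir n (f : 'rV[R]_n -> R) : R := fine (dirichlet setT (fun i => partial i f)).

Lemma Cc_sqint n (f : 'rV[R]_n -> R) : Cc f -> sqint (mu n) setT f \is a fin_num.
Proof.
move=> cf; have /L2P[_ h] := L2_Cc measurableT cf.
by rewrite ge0_fin_numE// sqint_ge0.
Qed.

Lemma rmassE n (f : 'rV[R]_n -> R) : Cc f -> sqint (mu n) setT f = (rmass f)%:E.
Proof. by move=> cf; rewrite fineK// Cc_sqint. Qed.

Lemma rdirE n (f : 'rV[R]_n -> R) : Cc f -> dirichlet setT (fun i => partial i f) = (rdir f)%:E.
Proof.
move=> cf; rewrite fineK// /dirichlet sum_fin_num; apply/allP => x /mapP[i _ ->].
by rewrite Lpow2E; apply: Cc_sqint; exact: Cc_partial.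
Qed.

Lemma rmass_ge0 n (f : 'rV[R]_n -> R) : 0 <= rmass f.
Proof. by rewrite fine_ge0// sqint_ge0. Qed.

Lemma dirichlet_ge0 n (D : set 'rV[R]_n) g : (0 <= dirichlet D g)%E.
Proof. by apply: sume_ge0 => i _; rewrite Lpow2E sqint_ge0. Qed.

Lemma rdir_ge0 n (f : 'rV[R]_n -> R) : 0 <= rdir f.
Proof. by rewrite fine_ge0// dirichlet_ge0. Qed.

Lemma rdir_partial n (f : 'rV[R]_n -> R) i : Cc f -> rmass (partial i f) <= rdir f.
Proof.
move=> cf; rewrite -lee_fin -rdirE// -rmassE; last exact: Cc_partial.
rewrite /dirichlet (bigD1 i)//= Lpow2E leeDl// sume_ge0// => j _.
by rewrite Lpow2E sqint_ge0.
Qed.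

(** On a vertical line, the value of [f ^ 2] at height [y] is the integral of twice [f] times its
    vertical derivative from below the support up to [y]. Integrating over the lines and applying
    Cauchy-Schwarz gives a bound that is uniform in [y]. *)
Lemma slice_mass_le n (f : 'rV[R]_n.+1 -> R) y : Cc f ->
  rmass (fun x => f (rV_rcons (x, y))) <= 2 * (rmass f `^ 2^-1 * rdir f `^ 2^-1).
Proof.
move=> cf; have /CcP[sf [r r0 bf]] := cf.
pose g z := f z * partial ord_max f z.
have cg : Cc g by apply: (CcM cf); exact: smooth_partial.
have mg : measurable_fun setT g by exact: Cc_measurable.
have mag : measurable_fun setT (fun z => (`|g z|%:E)).
  by apply/measurable_EFinP; apply: measurableT_comp.
have half : 1 - 2^-1 = 2^-1 :> R by lra.
have CS : (\int[mu n.+1]_z `|g z|%:E <= (rmass f `^ 2^-1 * rdir f `^ 2^-1)%:E)%E.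
  have mf := Cc_measurable cf; have mdf := Cc_measurable (Cc_partial ord_max cf).
  have := @ge0_hoelder_powR R _ _ (mu n.+1) (fun z => f z ^+ 2) (fun z => partial ord_max f z ^+ 2) 2^-1
   (measurable_sqr mf) (measurable_sqr mdf) (fun z => sqr_ge0 _) (fun z => sqr_ge0 _).
  rewrite half => /(_ _)/wrap[]; first lra.
  under eq_integral do rewrite !normr_powR2 mulfV ?pnatr_eq0// !powRr1// -normrM.
  move=> H; apply: (le_trans H); rewrite -/(sqint _ _ f) -/(sqint _ _ (partial ord_max f)).
  rewrite (rmassE cf) (rmassE (Cc_partial ord_max cf)) !poweR_EFin -EFinM lee_fin.
  by apply: ler_wpM2l; rewrite ?powR_ge0//; apply: ge0_ler_powR; rewrite ?nnegrE ?rmass_ge0 ?rdir_ge0// rdir_partial.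
rewrite -lee_fin -rmassE; last exact: Cc_slice.
rewrite EFinM; apply: le_trans (lee_wpmul2l _ CS) => //.
rewrite ge0_leb_fubini'// -ge0_integralZl//; last 2 first.
  by apply: (measurable_int_rcons' (f := fun z => `|g z|%:E)).
  by move=> x _; exact: integral_ge0.
apply: ge0_le_integral => //.
- by move=> x _; rewrite lee_fin sqr_ge0.
- apply/measurable_EFinP; apply: measurable_sqr; apply: Cc_measurable; exact: Cc_slice.
- by apply: measurable_funeM; apply: (measurable_int_rcons' (f := fun z => `|g z|%:E)).
move=> x _.
pose F (t : R) := f (rV_rcons (x, t)) ^+ 2.
pose dF (t : R) := 2 * g (rV_rcons (x, t)).
have dFP t : is_derive t (1 : R) F (dF t).
  have h := is_derive_vslice x t sf; rewrite /F /dF.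
  have := is_deriveM h h; rewrite /GRing.mul/= => hM.
  apply: (is_derive_eq (f := fun y => f (rV_rcons (x, y)) * f (rV_rcons (x, y))) hM).
  rewrite -[LHS]/(f (rV_rcons (x, t)) * partial ord_max f (rV_rcons (x, t)) + f (rV_rcons (x, t)) * partial ord_max f (rV_rcons (x, t))).
  by rewrite -[RHS]/(2 * (f (rV_rcons (x, t)) * partial ord_max f (rV_rcons (x, t)))); ring.
(* Below [y] and below the support, so that [F] starts from 0. *)
pose a := Num.min (- (r + 1)) (y - 1).
have ay : a < y by rewrite /a gt_min; apply/orP; right; lra.
have cdF : continuous dF.
  exact: (@continuous_vslice _ _ (fun z => 2 * g z) x (smoothM (@smooth_cst R _ 2) (Cc_smooth cg))).
have Fa : F a = 0.
  rewrite /F (bf _ ord_max) ?expr0n// mxE unlift_none/=.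
  have : a <= - (r + 1) by rewrite /a ge_min lexx.
  by move=> h; rewrite ltr0_norm; lra.
have := FTC2_continuous ay cdF dFP; rewrite Fa subr0 => H.
have mdF : measurable_fun setT (EFin \o dF) by apply/measurable_EFinP; exact: continuous_measurable_fun.
rewrite -/(F y) -H; apply: le_trans (lee_abs _) _.
apply: le_trans (le_abse_integral _ _ _) _ => //; first exact: measurable_funTS.
apply: (@le_trans _ _ (\int[lebesgue_measure]_t (`|(dF t)%:E|))%E).
  by apply: ge0_subset_integral => //; exact: measurableT_comp.
rewrite -ge0_integralZl//; last exact: (measurable_rcons_r x mag).
by apply: ge0_le_integral => //; 
  [exact: measurableT_comp|apply: measurable_funeM; exact: (measurable_rcons_r x mag)
  |move=> t _; rewrite /dF -EFinM abse_EFin lee_fin normrM ger0_norm].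
Qed.

(* GN_full n is the inequality in dimension n + 1. GN_slice n interpolates the
   inequality in dimension n with L^2 to reach the exponent of dimension n + 1,
   at which it is applied to slices. *)
Definition GN_slice n := exists2 C : R, 0 <= C & forall f : 'rV[R]_n -> R, Cc f ->
  (Lpow setT (2 + 4 / n.+1%:R) f <= (C * (rdir f `^ (n%:R / n.+1%:R) * rmass f `^ (3 / n.+1%:R)))%:E)%E.

Definition GN_full n := exists2 C : R, 0 <= C & forall f : 'rV[R]_n.+1 -> R, Cc f ->
  (Lpow setT (2 + 4 / n.+1%:R) f <= (C * (rdir f * rmass f `^ (2 / n.+1%:R)))%:E)%E.

(** In dimension 0 the measure is a Dirac mass and both sides are [|f 0| ^ 6]. *)
Lemma GN_slice0 : GN_slice 0.
Proof.
exists 1 => // f cf; rewrite mul1r mul0r powRr0 mul1r.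
have mf := Cc_measurable cf.
rewrite /Lpow /rmass /sqint /= !integral_dirac//; last 2 first.
- by apply/measurable_EFinP; exact: measurable_sqr.
- by apply/measurable_EFinP; apply: measurable_powR_comp; exact: measurableT_comp.
rewrite !diracT !mul1e /= normr_powR2 lee_fin.
by rewrite (_ : 2 + 4 / 1 = 2 * (3 / 1) :> R)//; field.
Qed.

Lemma GN_step n : GN_slice n -> GN_full n.
Proof.
move=> [C C0 HC].
pose k : R := n.+1%:R.
have k0 : 0 < k by rewrite ltr0n.
have kn : n%:R = k - 1 :> R by rewrite /k -natr1 addrK.
exists (C * 2 `^ (2 / k)); first by rewrite mulr_ge0// powR_ge0.
move=> f cf; rewrite -/k.
pose s y := fun x : 'rV[R]_n => f (rV_rcons (x, y)).
have cs y : Cc (s y) by exact: Cc_slice.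
pose m := 2 * (rmass f `^ 2^-1 * rdir f `^ 2^-1).
have m0 : 0 <= m by rewrite !mulr_ge0 ?powR_ge0.
have mf := Cc_measurable cf.
have mp : measurable_fun setT (fun z => (`|f z| `^ (2 + 4 / k))%:E).
  by apply/measurable_EFinP; apply: measurable_powR_comp; exact: measurableT_comp.
have mM : measurable_fun setT (fun y : R => rmass (s y)).
  apply: measurableT_comp => //.
  apply: (measurable_int_rcons (f := fun z => (f z ^+ 2)%:E)).
    by apply/measurable_EFinP; exact: measurable_sqr.
  by move=> z; rewrite lee_fin sqr_ge0.
have dE y : dirichlet setT (fun i => partial i (s y)) =
    (\sum_(i < n) \int[mu n]_x (partial (lift ord_max i) f (rV_rcons (x, y)) ^+ 2)%:E)%E.
  apply: eq_bigr => i _; rewrite Lpow2E; apply: eq_integral => x _.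
  by rewrite (partial_slice _ _ (Cc_smooth cf)).
have md2 i : measurable_fun setT (fun z => (partial i f z ^+ 2)%:E).
  by apply/measurable_EFinP; apply: measurable_sqr; apply: Cc_measurable; exact: Cc_partial.
have mds i : measurable_fun setT (fun y : R => \int[mu n]_x (partial (lift ord_max i) f (rV_rcons (x, y)) ^+ 2)%:E)%E.
  apply: (measurable_int_rcons (f := fun z => (partial (lift ord_max i) f z ^+ 2)%:E)) => //.
  by move=> z; rewrite lee_fin sqr_ge0.
have mD : measurable_fun setT (fun y : R => rdir (s y)).
  apply: measurableT_comp => //.
  rewrite (_ : (fun y => _) = (fun y => (\sum_(i < n) \int[mu n]_x (partial (lift ord_max i) f (rV_rcons (x, y)) ^+ 2)%:E)%E)).
    exact: emeasurable_sum.
  by apply/funext => y; exact: dE.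
have intM : (\int[lebesgue_measure]_y (rmass (s y))%:E = (rmass f)%:E)%E.
  rewrite -(rmassE cf) /sqint ge0_leb_fubini//.
  - by apply: eq_integral => y _; rewrite -(rmassE (cs y)).
  - by apply/measurable_EFinP; exact: measurable_sqr.
  - by move=> z; rewrite lee_fin sqr_ge0.
have intD : (\int[lebesgue_measure]_y (rdir (s y))%:E <= (rdir f)%:E)%E.
  rewrite -(rdirE cf) /dirichlet (bigD1_ord ord_max)//=.
  apply: (@le_trans _ _ (\sum_(i < n) Lpow setT 2 (partial (lift ord_max i) f))%E); last first.
    by rewrite leeDr// Lpow2E sqint_ge0.
  under eq_integral do rewrite -(rdirE (cs _)) dE.
  rewrite ge0_integral_sum//; last by move=> i y _; apply: integral_ge0 => x _; rewrite lee_fin sqr_ge0.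
  apply: lee_sum => i _; rewrite Lpow2E /sqint ge0_leb_fubini//.
  by move=> z; rewrite lee_fin sqr_ge0.
rewrite /Lpow ge0_leb_fubini//.
apply: (@le_trans _ _ (\int[lebesgue_measure]_y (C * m `^ (2 / k) * (rdir (s y) `^ (n%:R / k) * rmass (s y) `^ (1 - n%:R / k)))%:E)%E).
  apply: ge0_le_integral => //.
  - by move=> y _; apply: integral_ge0 => x _; rewrite lee_fin powR_ge0.
  - by apply: (measurable_int_rcons (f := fun z => (`|f z| `^ (2 + 4 / k))%:E)) => // z; rewrite lee_fin powR_ge0.
  - apply/measurable_EFinP; apply: measurable_funM => //; apply: measurable_funM; exact: measurable_powR_comp.
  move=> y _; apply: (le_trans (HC _ (cs y))); rewrite lee_fin -/k.
  rewrite -!mulrA; apply: ler_wpM2l => //.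
  rewrite mulrCA; apply: ler_wpM2l; first exact: powR_ge0.
  (* Of the power [3 / k] of the slice mass, [2 / k] is estimated by the uniform bound [m]. The
     remaining [1 / k] is complementary to the power [n / k] of the gradient, so that Hölder applies
     in [y]. *)
  rewrite (_ : 3 / k = 2 / k + (1 - n%:R / k)); last by rewrite kn; field; rewrite gt_eqF.
  have h2 : 0 <= 2 / k by rewrite divr_ge0// ltW.
  rewrite powRD_ge0//; last by rewrite kn mulrBl mulfV ?gt_eqF// opprB addrC subrK divr_ge0// ltW.
  apply: ler_wpM2r; first exact: powR_ge0.
  by apply: ge0_ler_powR; rewrite ?nnegrE ?rmass_ge0//; exact: slice_mass_le.
rewrite ge0_integralZl_fin//; last 3 first.
- by apply: measurable_funM; exact: measurable_powR_comp.
- by move=> y _; rewrite mulr_ge0 ?powR_ge0.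
- by rewrite mulr_ge0 ?powR_ge0.
have H := @ge0_hoelder_powR R _ _ lebesgue_measure _ _ (n%:R / k) mD mM (fun y => rdir_ge0 _) (fun y => rmass_ge0 _).
have kk : 0 <= n%:R / k < 1.
  rewrite divr_ge0 ?(ltW k0)//= ltr_pdivrMr// mul1r kn; lra.
apply: le_trans (lee_wpmul2l _ (H kk)) _; first by rewrite lee_fin mulr_ge0// powR_ge0.
rewrite intM poweR_EFin.
apply: (@le_trans _ _ ((C * m `^ (2 / k))%:E * ((rdir f `^ (n%:R / k))%:E * (rmass f `^ (1 - n%:R / k))%:E))%E).
  apply: lee_wpmul2l; first by rewrite lee_fin mulr_ge0// powR_ge0.
  apply: lee_wpmul2r; first by rewrite lee_fin powR_ge0.
  rewrite -poweR_EFin; apply: gt0_ler_poweR => //; first by case/andP: kk.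
  - by rewrite in_itv/= leey andbT; apply: integral_ge0 => y _; rewrite lee_fin rdir_ge0.
  - by rewrite in_itv/= leey andbT lee_fin rdir_ge0.
rewrite -!EFinM lee_fin /m powRM// ?mulr_ge0 ?powR_ge0// powRM ?powR_ge0// -!powRrM.
(* [m ^ (2 / k)] contributes the power [1 / k] of the gradient and of the mass. The totals are
   [n / k + 1 / k = 1] and [1 / k + 1 / k = 2 / k]. *)
rewrite (_ : 2^-1 * (2 / k) = 1 / k); last by field; rewrite gt_eqF.
have k1 : 0 <= 1 / k by rewrite divr_ge0// ltW.
have e1 : 1 - n%:R / k = 1 / k by rewrite kn; field; rewrite gt_eqF.
rewrite e1 (_ : 2 / k = 1 / k + 1 / k); last by field; rewrite gt_eqF.
rewrite !powRD_ge0//.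
have hd : rdir f = rdir f `^ (n%:R / k) * rdir f `^ (1 / k).
  case/andP: kk => kk _; rewrite -powRD_ge0// (_ : n%:R / k + 1 / k = 1) ?powRr1 ?rdir_ge0//.
  by rewrite kn; field; rewrite gt_eqF.
rewrite [X in _ <= _ * (X * _)]hd le_eqVlt; apply/orP; left; apply/eqP; ring.
Qed.

Lemma GN_interp n : GN_full n -> GN_slice n.+1.
Proof.
move=> [C C0 HC].
pose k : R := n.+1%:R.
have k0 : 0 < k by rewrite ltr0n.
have kS : n.+2%:R = k + 1 :> R by rewrite natr1.
(* The weight for which interpolating the exponents [2 + 4 / k] and [2] gives [2 + 4 / (k + 1)]. *)
pose th := k / (k + 1).
have k1 : 0 < k + 1 by rewrite addr_gt0.
have nz := gt_eqF k0; have nz1 := gt_eqF k1.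
have th01 : 0 <= th < 1 by rewrite /th divr_ge0/= ?ltW// ltr_pdivrMr// mul1r ltrDl.
exists (C `^ th); first exact: powR_ge0.
move=> f cf; rewrite kS.
have mf := Cc_measurable cf.
have mp : measurable_fun setT (fun z => `|f z| `^ (2 + 4 / k)).
  by apply: measurable_powR_comp; exact: measurableT_comp.
have := ge0_hoelder_powR (mu n.+1) mp (measurable_sqr mf) (fun z => powR_ge0 _ _) (fun z => sqr_ge0 _) th01.
have eth (x : R) : 0 < x -> (2 + 4 / x) * (x / (x + 1)) + 2 * (1 - x / (x + 1)) = 2 + 4 / (x + 1).
  move=> x0; have x1 : 0 < x + 1 by rewrite addr_gt0.
  by field; rewrite ?(gt_eqF x0) ?(gt_eqF x1).
under eq_integral.
  move=> z _; rewrite -powRrM normr_powR2 -powRD; last first.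
    apply/implyP => /eqP h; exfalso.
    have : 0 < (2 + 4 / k) * th + 2 * (1 - th).
      have : 0 <= 4 / k by rewrite divr_ge0// ltW.
      by case/andP: th01; move: (4 / k) => u; nra.
    by rewrite h ltxx.
  rewrite /th (eth _ k0).
  over.
move=> H; apply: (le_trans H); rewrite -/(sqint _ _ f) (rmassE cf) poweR_EFin.
have HCf := HC _ cf; rewrite -/k in HCf.
apply: (@le_trans _ _ ((C * (rdir f * rmass f `^ (2 / k)))%:E `^ th * (rmass f `^ (1 - th))%:E)%E).
  apply: lee_wpmul2r; first by rewrite lee_fin powR_ge0.
  apply: gt0_ler_poweR => //; first by case/andP: th01.
  - by rewrite in_itv/= leey andbT; apply: integral_ge0 => y _; rewrite lee_fin powR_ge0.
  - by rewrite in_itv/= leey andbT lee_fin !mulr_ge0 ?rdir_ge0 ?powR_ge0.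
rewrite poweR_EFin -EFinM lee_fin powRM// ?mulr_ge0 ?rdir_ge0 ?powR_ge0// powRM ?rdir_ge0 ?powR_ge0// -powRrM.
have eth2 (x : R) : 0 < x -> 3 / (x + 1) = 2 / x * (x / (x + 1)) + (1 - x / (x + 1)).
  move=> x0; have x1 : 0 < x + 1 by rewrite addr_gt0.
  by field; rewrite ?(gt_eqF x0) ?(gt_eqF x1).
rewrite (eth2 _ k0) -/th.
rewrite (@powRD_ge0 _ (rmass f) (2 / k * th)).
- by rewrite le_eqVlt; apply/orP; left; apply/eqP; ring.
- by case/andP: th01 => h _; rewrite mulr_ge0// divr_ge0// ltW.
- by case/andP: th01 => _ h; rewrite subr_ge0 ltW.
Qed.

Lemma GN_Cc n : GN_full n.
Proof. by apply: GN_step; elim: n => [|n IH]; [exact: GN_slice0|apply: GN_interp; exact: GN_step]. Qed.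

End GN.

(** * Tools for passing to the limit *)

Section generic.
Context d (T : measurableType d) {R : realType} (mu : {measure set T -> \bar R}).
Implicit Types (D : set T) (f g u : T -> R).

(** Young's inequality with a weight: a coefficient [1 + t] close to 1 on the main term preserves
    sharp constants, at the price of [1 + 1 / t] on the error. *)
Lemma sqr_add_le (t a b : R) : 0 < t -> (a + b) ^+ 2 <= (1 + t) * a ^+ 2 + (1 + t^-1) * b ^+ 2.
Proof.
move=> t0; rewrite -subr_ge0.
rewrite (_ : _ - _ = t^-1 * (t * a - b) ^+ 2); last by field; rewrite gt_eqF.
by rewrite mulr_ge0 ?sqr_ge0// invr_ge0 ltW.
Qed.

Lemma sqint_addt D f g (t : R) : measurable D -> measurable_fun D f -> measurable_fun D g -> 0 < t ->
  (sqint mu D (fun x => f x + g x)%R <= (1 + t)%:E * sqint mu D f + (1 + t^-1)%:E * sqint mu D g)%E.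
Proof.
move=> mD mf mg t0; have t1 : 0 <= 1 + t by rewrite addr_ge0// ltW.
have t2 : 0 <= 1 + t^-1 by rewrite addr_ge0// invr_ge0 ltW.
rewrite /sqint -!ge0_integralZl_fin//; do 1? [exact: measurable_sqr|by move=> x _; exact: sqr_ge0].
rewrite -ge0_integralD_fin//; last 4 first.
- by apply: measurable_funM => //; exact: measurable_sqr.
- by apply: measurable_funM => //; exact: measurable_sqr.
- by move=> x _; rewrite mulr_ge0// sqr_ge0.
- by move=> x _; rewrite mulr_ge0// sqr_ge0.
apply: ge0_le_integral_fin => //.
- by apply: measurable_sqr; exact: measurable_funD.
- by apply: measurable_funD; apply: measurable_funM => //; exact: measurable_sqr.
- by move=> x _; exact: sqr_ge0.
- by move=> x _; exact: sqr_add_le.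
Qed.

Lemma sqint_eq0_ae D f : measurable D -> measurable_fun D f -> sqint mu D f = 0%E ->
  {ae mu, forall x, D x -> f x = 0}.
Proof.
move=> mD mf; rewrite /sqint => H.
have /(ae_eq_integral_abs mu mD) : measurable_fun D (fun x => (f x ^+ 2)%:E).
  by apply/measurable_EFinP; exact: measurable_sqr.
move=> [/(_ _)/wrap[]].
  by rewrite -[RHS]H; apply: eq_integral => x _; rewrite gee0_abs// lee_fin sqr_ge0.
move=> HH _; case: HH => N [mN N0 HN]; exists N; split => // x /= h; apply: HN => /= hx; apply: h => Dx.
by have /eqP := hx Dx; rewrite eqe sqrf_eq0 => /eqP.
Qed.

Lemma fatou_ae (f_ : nat -> T -> R) u (b_ : nat -> R) (b : R) :
  (forall n, measurable_fun setT (f_ n)) -> measurable_fun setT u ->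
  (forall n x, 0 <= f_ n x) -> (forall x, 0 <= u x) ->
  {ae mu, forall x, f_ ^~ x @ \oo --> u x} ->
  (forall n, (\int[mu]_x (f_ n x)%:E <= (b_ n)%:E)%E) -> b_ @ \oo --> b ->
  (\int[mu]_x (u x)%:E <= b%:E)%E.
Proof.
move=> mf mu_ f0 u0 [N [mN N0 HN]] fb bb.
have mEf n : measurable_fun setT (fun x => (f_ n x)%:E) by apply/measurable_EFinP.
have mC : measurable (setT `\` N) by exact: measurableD.
rewrite (ge0_negligible_integral mN measurableT _ _ N0); last 2 first.
- exact/measurable_EFinP.
- by move=> x _; rewrite lee_fin.
have mEf' n : measurable_fun (setT `\` N) (fun x => (f_ n x)%:E) by exact: measurable_funTS.
have f0' n x : (setT `\` N) x -> (0 <= (f_ n x)%:E)%E by rewrite lee_fin.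
have := fatou mu mC mEf' f0'.
have -> : (\int[mu]_(x in setT `\` N) limn_einf (fun n => (f_ n x)%:E))%E = (\int[mu]_(x in setT `\` N) (u x)%:E)%E.
  apply: eq_integral => x /set_mem[_ Nx].
  have fx : f_ ^~ x @ \oo --> u x by apply: contrapT => h; apply: Nx; apply: HN.
  have /cvg_limn_einf_sup[] // : (fun n => (f_ n x)%:E) @ \oo --> (u x)%:E.
  by apply: (cvg_EFin _ fx); exact: nearW.
move/le_trans; apply.
have bE : (fun n => (b_ n)%:E) @ \oo --> b%:E by apply: cvg_EFin => //; exact: nearW.
rewrite -(cvg_lim _ bE)// limn_einf_lim; apply: lee_lim.
- exact: is_cvg_einfs.
- by apply/cvg_ex; exists b%:E.
apply: nearW => n; apply: (@le_trans _ _ (\int[mu]_(x in setT `\` N) (f_ n x)%:E)%E); first by apply: ereal_inf_lbound; exists n => /=.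
by rewrite -(ge0_negligible_integral mN measurableT (mEf n) _ N0)// => x _; rewrite lee_fin.
Qed.

(** The series of the squared errors has integral at most 1, hence is finite almost everywhere and
    its terms tend to 0. The geometric rate spares the extraction of a subsequence. *)
Lemma ae_cvg_sqint (f_ : nat -> T -> R) u :
  (forall n, measurable_fun setT (f_ n)) -> measurable_fun setT u ->
  (forall n, (sqint mu setT (fun x => f_ n x - u x)%R <= (1 / (2 ^ n.+1)%:R)%:E)%E) ->
  {ae mu, forall x, f_ ^~ x @ \oo --> u x}.
Proof.
move=> mf mu_ H.
pose h (x : T) := (\sum_(n <oo) ((f_ n x - u x) ^+ 2)%:E)%E.
have m2 n : measurable_fun setT (fun x => ((f_ n x - u x) ^+ 2)%:E).
  by apply/measurable_EFinP; apply: measurable_sqr; exact: measurable_funB.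
have h0 n x : (0 <= ((f_ n x - u x) ^+ 2)%:E)%E by rewrite lee_fin sqr_ge0.
have mh : measurable_fun setT h by apply: ge0_emeasurable_sum => // k x _ _.
have ih : (\int[mu]_x h x <= 1)%E.
  rewrite integral_nneseries//; apply: le_trans (epsilon_trick0 xpredT ler01).
  apply: lee_nneseries => [n _ _|n _]; first exact: integral_ge0.
  exact: H.
have Ih : mu.-integrable setT h.
  apply/integrableP; split => //; apply: le_lt_trans (ltry 1).
  apply: le_trans ih; rewrite le_eqVlt; apply/orP; left; apply/eqP; apply: eq_integral => x _.
  by rewrite gee0_abs//; apply: nneseries_ge0.
have [N [mN N0 HN]] := integrable_ae measurableT Ih.
exists N; split => // x /= nx; apply: HN => /= /(_ I) hx; apply: nx.
have s0 : (fun n => (f_ n x - u x) ^+ 2) @ \oo --> (0:R).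
  apply: cvg_series_cvg_0; apply: nondecreasing_is_cvgn.
    by apply: nondecreasing_series => n _ _; exact: sqr_ge0.
  exists (fine (h x)) => _ [n _ <-]; rewrite -lee_fin fineK// /series/= -sumEFin.
  by apply: nneseries_lim_ge.
apply/cvgrPdist_lt => e e0.
have e2 : 0 < e ^+ 2 by rewrite exprn_gt0.
move/cvgrPdist_lt : s0 => /(_ _ e2); apply: filterS => n.
rewrite sub0r normrN normrX distrC => hh.
by rewrite -(@ltr_pXn2r _ 2)// nnegrE// ltW.
Qed.

Lemma cvg_powR (b_ : nat -> R) (b s : R) : 0 < b -> b_ @ \oo --> b -> (fun n => b_ n `^ s) @ \oo --> b `^ s.
Proof.
move=> b0 hb; have b1 : b \in `]0, +oo[%R by rewrite in_itv/= b0.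
have c : {for b, continuous (fun x => x `^ s)}.
  by apply: differentiable_continuous; apply/derivable1_diffP; exact: derivable_powR.
exact: (cvg_comp _ _ hb c).
Qed.

(** For [r = 0] the convention [0^-1 = +oo] is what makes this true: a positive numerator over a
    zero denominator violates every real bound, and so does the product form. *)
Lemma ediv_le (A : \bar R) (r k : R) : (0 <= A)%E -> 0 <= r -> 0 <= k ->
  (A / r%:E <= k%:E)%E = (A <= (k * r)%:E)%E.
Proof.
move=> A0; rewrite le_eqVlt => /predU1P[<-|r0] k0; last first.
  by rewrite inver gt_eqF// lee_pdivrMr// EFinM.
rewrite inve0 mulr0; move: A0; rewrite le_eqVlt => /predU1P[<-|A0].
  by rewrite mul0e lee_fin k0 lexx.
by rewrite gt0_muley// leye_eq/= leNgt A0.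
Qed.

End generic.

(** * From quotients to inequalities, and from test functions to H^1 *)

Section constants.
Context {R : realType} (N : nat).
Local Notation X := 'rV[R]_N.+1.
Local Notation mu := (leb R N.+1).
Local Notation q := (two_star R N).
Local Notation s := (2 / N.+1%:R : R).
Implicit Types (D : set X) (u : X -> R) (g : 'I_N.+1 -> X -> R).

Lemma two_star_gt0 : 0 < q.
Proof. by rewrite /two_star ltr_wpDr// divr_ge0. Qed.

Lemma sexp_gt0 : 0 < s. Proof. by rewrite divr_gt0// ltr0n. Qed.

(** With the denominator cleared the inequality makes sense for the zero class, which the supremum
    excludes. The exponent [s] combines the square root and the power [q - 2], see
    [norm_two_star]. *)
Definition gn D (k : R) u g : Prop :=
  (Lpow D q u <= k%:E * (dirichlet D g * Lpow D 2 u `^ s))%E.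

Lemma Lpow_ge0 D p u : (0 <= Lpow D p u)%E.
Proof. by apply: integral_ge0 => z _; rewrite lee_fin powR_ge0. Qed.

Lemma H1_fin D u g : H1 D u g -> Lpow D 2 u \is a fin_num /\ dirichlet D g \is a fin_num.
Proof.
move=> [/L2P[_ h] Hg]; split; first by rewrite Lpow2E ge0_fin_numE ?sqint_ge0.
rewrite /dirichlet sum_fin_num; apply/allP => x /mapP[i _ ->].
by have [/L2P[_ hg] _] := Hg i; rewrite inE/= Lpow2E ge0_fin_numE ?sqint_ge0.
Qed.

Lemma Lpow_eq0 D p u : measurable D -> measurable_fun D u -> p != 0 -> Lpow D 2 u = 0%E -> Lpow D p u = 0%E.
Proof.
move=> mD mu_ p0; rewrite Lpow2E => /(sqint_eq0_ae mD mu_)[M [mM M0 HM]].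
rewrite /Lpow (ge0_negligible_integral mM mD _ _ M0)//; last first.
  by apply/measurable_EFinP; apply: measurable_powR_comp; exact: measurableT_comp.
apply: integral0_eq => z [Dz Mz]; suff -> : u z = 0 by rewrite normr0 powR0.
by apply: contrapT => h; apply: Mz; apply: HM => /= /(_ Dz).
Qed.

Lemma norm_two_star (M : \bar R) : (0 <= M)%E -> ((M `^ 2^-1) `^ (q - 2) = M `^ s)%E.
Proof.
move=> M0; rewrite -poweRrM; congr (_ `^ _)%E.
rewrite /two_star addrAC subrr add0r (_ : 4 = 2 * 2)%R; last by ring.
by rewrite !mulrA mulVf ?mul1r// pnatr_eq0.
Qed.

Lemma K_domain_le D (k : R) : measurable D -> 0 <= k -> (forall u g, H1 D u g -> gn D k u g) ->
  (K_domain D <= k%:E)%E.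
Proof.
move=> mD k0 H; apply: ub_ereal_sup => _ [u [g [h u0 ->]]].
have [f1 f2] := H1_fin h; have := H _ _ h; rewrite /gn norm_two_star ?Lpow_ge0//.
rewrite -(fineK f1) -(fineK f2) poweR_EFin -!EFinM.
by rewrite ediv_le// ?Lpow_ge0// mulr_ge0 ?powR_ge0// fine_ge0// dirichlet_ge0.
Qed.

Lemma K_domain_gn D (k : R) u g : measurable D -> 0 <= k -> (K_domain D <= k%:E)%E -> H1 D u g -> gn D k u g.
Proof.
move=> mD k0 Kk h; have [f1 f2] := H1_fin h.
have [u0|u0] := eqVneq (Lpow D 2 u) 0%E.
  rewrite /gn Lpow_eq0//; last by rewrite gt_eqF// two_star_gt0.
  - by rewrite !mule_ge0 ?lee_fin ?poweR_ge0 ?dirichlet_ge0.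
  - by case: h => -[].
have : (Lpow D q u / (dirichlet D g * (Lpow D 2 u `^ 2^-1) `^ (q - 2)) <= k%:E)%E.
  by apply: le_trans Kk; apply: ereal_sup_ubound; exists u, g.
rewrite /gn norm_two_star ?Lpow_ge0//.
rewrite -(fineK f1) -(fineK f2) poweR_EFin -!EFinM.
by rewrite ediv_le// ?Lpow_ge0// mulr_ge0 ?powR_ge0// fine_ge0// dirichlet_ge0.
Qed.

Lemma gn_limit (k : R) : 0 <= k -> (forall phi : X -> R, Cc phi -> gn setT k phi (fun i => partial i phi)) ->
  forall u g, H1 setT u g -> gn setT k u g.
Proof.
move=> k0 Hk u g h; have [f1 f2] := H1_fin h.
have [[mu_ _] Hg] := h.
have [u0|u0] := eqVneq (Lpow setT 2 u) 0%E.
  rewrite /gn Lpow_eq0//; last by rewrite gt_eqF// two_star_gt0.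
  by rewrite !mule_ge0 ?lee_fin ?poweR_ge0 ?dirichlet_ge0.
pose m := fine (Lpow setT 2 u); pose d := fine (dirichlet setT g).
have m0 : 0 < m by rewrite fine_gt0// lt0e u0 Lpow_ge0/= -ge0_fin_numE ?Lpow_ge0.
have d0 : 0 <= d by rewrite fine_ge0// dirichlet_ge0.
(* The test functions are taken within [t j ^ 2]: this is at most [2 ^ -(j + 1)], as [ae_cvg_sqint]
   requires, and the error term [(1 + 1 / t) t ^ 2] of [sqint_addt] still tends to 0. *)
pose t (j : nat) : R := 1 / (2 ^ j.+1)%:R.
have t0 j : 0 < t j by rewrite /t divr_gt0// ltr0n expn_gt0.
have t1 j : t j <= 1 by rewrite /t ler_pdivrMr ?ltr0n ?expn_gt0// mul1r ler1n expn_gt0.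
have tc : t @ \oo --> (0 : R).
  rewrite (_ : t = geometric (2^-1) (2^-1)).
    by apply: cvg_geometric; rewrite ger0_norm ?invr_ge0// invf_lt1// ltr1n.
  by apply/funext => j; rewrite /t /geometric/= natrX exprS invfM exprVn mul1r.
have [phi Hphi] := choice (fun j => (let: ex_intro2 x a b := H1_dense h (exprn_gt0 2 (t0 j)) in
  ex_intro (fun p => Cc p /\ (H1dist2 setT u g p < (t j ^+ 2)%:E)%E) x (conj a b))).
have cphi j := (Hphi j).1.
have mphi j := Cc_measurable (cphi j).
have tE j : (1 + (t j)^-1) * t j ^+ 2 = t j ^+ 2 + t j by field; rewrite gt_eqF.
have t2 j : t j ^+ 2 + t j <= 2 * t j by move: (t0 j) (t1 j); nra.
have D0 j : (sqint mu setT (fun z => phi j z - u z)%R <= (t j ^+ 2)%:E)%E.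
  apply: le_trans (ltW (Hphi j).2); rewrite /H1dist2 Lpow2E leeDl//; exact: dirichlet_ge0.
have D1 j i : (sqint mu setT (fun z => partial i (phi j) z - g i z)%R <= (t j ^+ 2)%:E)%E.
  apply: le_trans (ltW (Hphi j).2); rewrite /H1dist2 Lpow2E /dirichlet (bigD1 i)//= Lpow2E.
  rewrite addeCA leeDl// adde_ge0 ?sqint_ge0//; apply: sume_ge0 => l _; exact: Lpow_ge0.
pose bm j := m + t j * (m + 2).
pose bd j := d + t j * (d + 2 * N.+1%:R).
have Bm j : rmass (phi j) <= bm j.
  rewrite -lee_fin -rmassE//.
  rewrite (_ : phi j = (fun z => u z + (phi j z - u z))); last by apply/funext => z; rewrite addrC subrK.
  apply: le_trans (sqint_addt _ measurableT mu_ (measurable_funB (mphi j) mu_) (t0 j)) _.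
  apply: (@le_trans _ _ ((1 + t j)%:E * m%:E + (1 + (t j)^-1)%:E * (t j ^+ 2)%:E)%E).
    rewrite -Lpow2E fineK//; apply: leeD => //; apply: lee_wpmul2l (D0 j).
    by rewrite lee_fin addr_ge0// invr_ge0 ltW.
  by rewrite -!EFinM -EFinD lee_fin tE /bm; move: (t2 j); lra.
have Bd j : rdir (phi j) <= bd j.
  rewrite -lee_fin -rdirE//.
  apply: (@le_trans _ _ (\sum_(i < N.+1) ((1 + t j)%:E * Lpow setT 2 (g i) + (2 * t j)%:E))%E).
    apply: lee_sum => i _; have [[mg _] _] := Hg i.
    have mp := Cc_measurable (Cc_partial i (cphi j)).
    rewrite Lpow2E (_ : partial i (phi j) = (fun z => g i z + (partial i (phi j) z - g i z))); last first.
      by apply/funext => z; rewrite addrC subrK.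
    apply: le_trans (sqint_addt _ measurableT mg (measurable_funB mp mg) (t0 j)) _.
    rewrite -Lpow2E; apply: leeD => //.
    apply: (@le_trans _ _ ((1 + (t j)^-1)%:E * (t j ^+ 2)%:E)%E).
      by apply: lee_wpmul2l (D1 j i); rewrite lee_fin addr_ge0// invr_ge0 ltW.
    by rewrite -EFinM tE lee_fin.
  rewrite big_split/= -ge0_sume_distrr; last by move=> i _; exact: Lpow_ge0.
  rewrite -/(dirichlet setT g) -(fineK f2) sumEFin -EFinM -EFinD lee_fin sumr_const card_ord -/d.
  by rewrite /bd -mulr_natl; lra.
have cbm : bm @ \oo --> m.
  rewrite -[X in _ --> X]addr0; apply: cvgD; first exact: cvg_cst.
  rewrite -[X in _ --> X](mul0r (m + 2)); apply: cvgM => //; exact: cvg_cst.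
have cbd : bd @ \oo --> d.
  rewrite -[X in _ --> X]addr0; apply: cvgD; first exact: cvg_cst.
  rewrite -[X in _ --> X](mul0r (d + 2 * N.+1%:R)); apply: cvgM => //; exact: cvg_cst.
have aec : {ae mu, forall z, phi ^~ z @ \oo --> u z}.
  apply: ae_cvg_sqint => // j; apply: (le_trans (D0 j)).
  by rewrite lee_fin -/(t j); move: (t0 j) (t1 j); nra.
rewrite /gn -(fineK f1) -(fineK f2) poweR_EFin -!EFinM -/m -/d.
apply: (fatou_ae (f_ := fun j z => `|phi j z| `^ q) (b_ := fun j => k * (bd j * bm j `^ s))).
- by move=> j; apply: measurable_powR_comp; exact: measurableT_comp.
- by apply: measurable_powR_comp; exact: measurableT_comp.
- by move=> j z; exact: powR_ge0.
- by move=> z; exact: powR_ge0.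
- case: aec => M [mM M0 HM]; exists M; split => // z /= hz; apply: HM => /= hh; apply: hz.
  have [uz|uz] := eqVneq (u z) 0; last first.
    have uz0 : 0 < `|u z| by rewrite normr_gt0.
    have hn : (fun j => `|phi j z|) @ \oo --> `|u z| by exact: cvg_norm.
    exact: (cvg_powR uz0 hn).
  rewrite uz normr0 powR0 ?gt_eqF ?two_star_gt0//.
  apply/cvgrPdist_lt => e e0.
  have e1 : 0 < e `^ q^-1 by rewrite powR_gt0.
  move: hh; rewrite uz => /cvgrPdist_lt/(_ _ e1); apply: filterS => j.
  rewrite !sub0r !normrN => hj.
  rewrite (ger0_norm (powR_ge0 _ _)).
  rewrite -[ltRHS](@powRr1 _ e) ?ltW// -(@mulVf _ q) ?gt_eqF ?two_star_gt0// powRrM.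
  by apply: gt0_ltr_powR; rewrite ?two_star_gt0 ?nnegrE ?powR_ge0.
- move=> j; have := Hk _ (cphi j); rewrite /gn (rdirE (cphi j)) Lpow2E (rmassE (cphi j)) poweR_EFin -!EFinM.
  move/le_trans; apply; rewrite lee_fin; apply: ler_wpM2l => //.
  apply: ler_pM; rewrite ?rdir_ge0 ?powR_ge0//.
  apply: ge0_ler_powR; rewrite ?nnegrE ?rmass_ge0 ?(ltW sexp_gt0)//.
  exact: le_trans (rmass_ge0 _) (Bm j).
- apply: cvgM; first exact: cvg_cst.
  by apply: cvgM => //; exact: cvg_powR.
Qed.

Lemma K_setT_le_Cc (k : R) : 0 <= k -> (forall phi : X -> R, Cc phi -> gn setT k phi (fun i => partial i phi)) ->
  (K_domain [set: X] <= k%:E)%E.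
Proof. by move=> k0 H; apply: K_domain_le => //; exact: gn_limit. Qed.

Lemma K_setT_lty : (K_domain [set: X] < +oo)%E.
Proof.
have [C C0 HC] := @GN_Cc R N.
apply: le_lt_trans (ltry C); apply: K_setT_le_Cc => // phi cphi.
have := HC _ cphi; rewrite /gn (rdirE cphi) Lpow2E (rmassE cphi) poweR_EFin -!EFinM.
by [].
Qed.

Lemma fsupport0 n (f : 'rV[R]_n -> R) z : ~ fsupport f z -> f z = 0.
Proof.
by move=> h; apply/eqP/negPn/negP => fz; apply: h; apply: subset_closure.
Qed.

Lemma fsupport_partial n (f : 'rV[R]_n -> R) i : fsupport (partial i f) `<=` fsupport f.
Proof.
rewrite [X in _ `<=` X](closure_id _).1; last exact: closed_closure.
apply: closureS => z /= /eqP dz; apply: contrapT => hz; apply: dz.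
have near0 : \near z, f z = cst 0 z.
  have : open_nbhs z (~` fsupport f) by split => //; apply: closed_openC; exact: closed_closure.
  by move/open_nbhs_nbhs; apply: filterS => w; exact: fsupport0.
by rewrite /partial (near_eq_derive _ near0) derive_cst.
Qed.

(** A function tested against is supported in [D], so its integrals extend to the whole space and
    integration by parts there leaves no boundary term, whatever the values of [phi] on the boundary
    of [D]. *)
Lemma H1_Cc D (phi : X -> R) : measurable D -> Cc phi -> H1 D phi (fun i => partial i phi).
Proof.
move=> mD cphi; split; first exact: L2_Cc.
move=> i; split; first by apply: L2_Cc => //; exact: Cc_partial.
move=> psi cpsi spsi.
have E (f h : X -> R) : fsupport h `<=` D -> \int[mu]_(z in D) (f z * h z) = \int[mu]_z (f z * h z).
  move=> sh; rewrite Rintegral_mkcond; apply: eq_Rintegral => z _; rewrite patchE; case: ifPn => // nz.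
  rewrite (@fsupport0 _ h) ?mulr0// => /sh Dz.
  by move: nz; rewrite mem_set.
rewrite !E//; first by apply: Cc_ibp => //; exact: Cc_smooth.
by move=> z /fsupport_partial; exact: spsi.
Qed.

End constants.

(** * Reflection, gluing and bisection *)

Section reflection.
Context {R : realType} (N : nat).
Local Notation X := 'rV[R]_N.+1.
Local Notation mu := (leb R N.+1).
Implicit Types (D : set X) (u f : X -> R) (g : 'I_N.+1 -> X -> R).

Definition rsgn (i : 'I_N.+1) : R := if i == ord_max then -1 else 1.

(** [a = 0] is the reflection across [y = 0], and [a = l] exchanges the two ends of the strip
    [0 < y < l]. *)
Definition refl (a : R) : X -> X := affmap rsgn (fun i => if i == ord_max then a else 0).

Lemma rsgn_neq0 i : rsgn i != 0.
Proof. by rewrite /rsgn; case: ifP => _; rewrite ?oppr_eq0 oner_eq0. Qed.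

Lemma rsgn_sqr i : rsgn i * rsgn i = 1.
Proof. by rewrite /rsgn; case: ifP => _; rewrite ?mulrNN mulr1. Qed.

Lemma rsgn_norm i : `|rsgn i| = 1.
Proof. by rewrite /rsgn; case: ifP => _; rewrite ?normrN normr1. Qed.

Lemma reflK a : involutive (refl a).
Proof.
move=> z; apply/rowP => i; rewrite !mxE mulrDr mulrA rsgn_sqr mul1r -addrA; rewrite /rsgn.
by case: ifP => _; rewrite ?mulN1r ?addNr ?mulr0 ?addr0 // addNr addr0.
Qed.

Lemma refl_last a z : refl a z ord0 ord_max = a - z ord0 ord_max.
Proof. by rewrite !mxE /rsgn eqxx mulN1r addrC. Qed.

Lemma refl_rcons a x y : refl a (rV_rcons (x, y)) = rV_rcons (x, a - y).
Proof.
apply/rowP => i; rewrite !mxE /rsgn; case: unliftP => [j|] ->/=.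
  by rewrite eq_sym (negbTE (neq_lift _ _)) mul1r addr0.
by rewrite eqxx mulN1r addrC.
Qed.

Lemma measurable_refl a : measurable_fun setT (refl a).
Proof. exact: measurable_affmap. Qed.

Lemma continuous_refl a : continuous (refl a).
Proof. exact: continuous_affmap. Qed.

Lemma Cc_refl a f : Cc f -> Cc (fun z => f (refl a z)).
Proof. by move=> cf; apply: Cc_affmap => // i; exact: rsgn_neq0. Qed.

Lemma partial_refl a f i : smooth f ->
  partial i (fun z => f (refl a z)) = (fun z => rsgn i * partial i f (refl a z)).
Proof. by move=> sf; rewrite partial_affmap. Qed.

Lemma ge0_integral_refl a (F : X -> \bar R) : measurable_fun setT F -> (forall z, (0 <= F z)%E) ->
  (\int[mu]_z F (refl a z) = \int[mu]_z F z)%E.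
Proof.
move=> mF F0; have := ge0_integral_affmap (fun i => if i == ord_max then a else 0) rsgn_neq0 mF F0.
by rewrite big1 ?mul1e// => i _; exact: rsgn_norm.
Qed.

Lemma integral_refl a (F : X -> \bar R) : measurable_fun setT F ->
  (\int[mu]_z F (refl a z) = \int[mu]_z F z)%E.
Proof.
move=> mF; rewrite integralE [RHS]integralE; congr (_ - _)%E.
  rewrite -(ge0_integral_refl a (measurable_funepos mF) (funepos_ge0 F)).
  by apply: eq_integral => z _; rewrite !funeposE.
rewrite -(ge0_integral_refl a (measurable_funeneg mF) (funeneg_ge0 F)).
by apply: eq_integral => z _; rewrite !funenegE.
Qed.

Section sets.
Variables (a : R) (D D' : set X).
Hypotheses (mD : measurable D) (DD : forall z, D' z <-> D (refl a z)).

Lemma measurable_reflset : measurable D'.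
Proof.
have -> : D' = refl a @^-1` D by apply/seteqP; split => z /DD.
rewrite -[X in measurable X]setTI; exact: (@measurable_refl a).
Qed.

Lemma reflset z : D z <-> D' (refl a z).
Proof. by split => [h|/DD]; [apply/DD|]; rewrite reflK. Qed.

Lemma patch_refl f z : ((fun z => f (refl a z)) \_ D') z = (f \_ D) (refl a z).
Proof.
rewrite !patchE; case: ifPn => zD'; case: ifPn => // zD.
- by move: zD; rewrite mem_set//; apply/DD; exact: set_mem.
- by move: zD'; rewrite mem_set//; apply/DD; exact: set_mem.
Qed.

Lemma measurable_fun_refl f : measurable_fun D f -> measurable_fun D' (fun z => f (refl a z)).
Proof.
have mD' := measurable_reflset.
move=> mf; apply/(measurable_restrictT _ mD').
rewrite (_ : _ \_ _ = (f \_ D) \o refl a); last by apply/funext => z; exact: patch_refl.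
apply: measurableT_comp (measurable_refl a); exact/(measurable_restrictT _ mD).
Qed.

Lemma Rintegral_refl f : measurable_fun D f ->
  \int[mu]_(z in D') f (refl a z) = \int[mu]_(z in D) f z.
Proof.
move=> mf; rewrite Rintegral_mkcond [RHS]Rintegral_mkcond /Rintegral; congr fine.
rewrite -[RHS](@integral_refl a).
  by apply: eq_integral => z _; rewrite patch_refl.
by apply/measurable_EFinP; exact/(measurable_restrictT _ mD).
Qed.

Lemma Lpow_refl p f : measurable_fun D f -> Lpow D' p (fun z => f (refl a z)) = Lpow D p f.
Proof.
move=> mf; rewrite /Lpow integral_mkcond [RHS]integral_mkcond.
have mp : measurable_fun D (fun z => (`|f z| `^ p)%:E).
  by apply/measurable_EFinP; apply: measurable_powR_comp; exact: measurableT_comp.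
rewrite -[RHS](@integral_refl a); last exact/(measurable_restrictT _ mD).
apply: eq_integral => z _; rewrite !patchE; case: ifPn => zD'; case: ifPn => // zD.
- by move: zD; rewrite mem_set//; apply/DD; exact: set_mem.
- by move: zD'; rewrite mem_set//; apply/DD; exact: set_mem.
Qed.

Lemma L2_refl f : L2 D f -> L2 D' (fun z => f (refl a z)).
Proof. by move=> [mf f2]; split; [exact: measurable_fun_refl|rewrite Lpow_refl]. Qed.

Definition reflg g : 'I_N.+1 -> X -> R := fun i z => rsgn i * g i (refl a z).

Lemma fsupport_refl f : fsupport f `<=` D' -> fsupport (fun z => f (refl a z)) `<=` D.
Proof.
move=> sf z hz; apply/reflset; apply: sf => B Bz.
have [w [fw Bw]] := hz _ (@continuous_refl a z _ Bz).
by exists (refl a w).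
Qed.

Lemma Lpow_rsgn D0 p i f : Lpow D0 p (fun z => rsgn i * f z) = Lpow D0 p f.
Proof. by apply: eq_integral => z _; rewrite normrM rsgn_norm mul1r. Qed.

Lemma L2_rsgn D0 i f : L2 D0 f -> L2 D0 (fun z => rsgn i * f z).
Proof. by move=> [mf f2]; split; [exact: measurable_funM|rewrite Lpow_rsgn]. Qed.

Lemma H1_refl u g : H1 D u g -> H1 D' (fun z => u (refl a z)) (reflg g).
Proof.
move=> [Lu Hg]; split; first exact: L2_refl.
move=> i; have [Lg wg] := Hg i; split; first by apply: (L2_rsgn i); exact: L2_refl.
move=> psi cpsi spsi.
pose phi z := psi (refl a z).
have cphi : Cc phi by exact: Cc_refl.
have psiE : psi = (fun z => phi (refl a z)) by apply/funext => z; rewrite /phi reflK.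
have := wg _ cphi (fsupport_refl spsi).
have dE z : partial i psi z = rsgn i * partial i phi (refl a z).
  by rewrite psiE (partial_refl _ _ (Cc_smooth cphi)).
have mu_ : measurable_fun D u by case: Lu.
have mg : measurable_fun D (g i) by case: Lg.
have mp : measurable_fun D phi by apply: measurable_funTS; exact: Cc_measurable.
have mdp : measurable_fun D (partial i phi).
  by apply: measurable_funTS; apply: Cc_measurable; exact: Cc_partial.
have i1 : mu.-integrable D (EFin \o (fun z => u z * partial i phi z)).
  by apply: (L2_integrableM mD Lu); apply: (L2_Cc mD); exact: Cc_partial.
have i2 : mu.-integrable D (EFin \o (fun z => g i z * phi z)).
  by apply: (L2_integrableM mD Lg); exact: (L2_Cc mD).
have -> : \int[mu]_(z in D') (u (refl a z) * partial i psi z) =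
    rsgn i * \int[mu]_(z in D) (u z * partial i phi z).
  rewrite -RintegralZl// -(@Rintegral_refl (fun z => rsgn i * (u z * partial i phi z))); last first.
    by apply: measurable_funM => //; exact: measurable_funM.
  by apply: eq_Rintegral => z _; rewrite dE; ring.
have -> : \int[mu]_(z in D') (reflg g i z * psi z) = rsgn i * \int[mu]_(z in D) (g i z * phi z).
  rewrite -RintegralZl// -(@Rintegral_refl (fun z => rsgn i * (g i z * phi z))); last first.
    by apply: measurable_funM => //; exact: measurable_funM.
  by apply: eq_Rintegral => z _; rewrite /reflg /phi reflK; ring.
by move=> ->; rewrite mulrN.
Qed.

#[local] Opaque Lpow.

Lemma is_trace_refl u g y h : H1 D u g -> is_trace D u g y h ->
  is_trace D' (fun z => u (refl a z)) (reflg g) (a - y) h.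
Proof.
move=> [[mu_ _] Hg] [Lh [phi [cphi p1 p2]]]; split => //; exists (fun k z => phi k (refl a z)); split.
- by move=> k; exact: Cc_refl.
- have E k : H1dist2 D' (fun z => u (refl a z)) (reflg g) (fun z => phi k (refl a z)) = H1dist2 D u g (phi k).
    have mp : measurable_fun D (phi k) by apply: measurable_funTS; exact: Cc_measurable.
    have e1 : Lpow D' 2 ((fun z => phi k (refl a z)) \- (fun z => u (refl a z)))%R = Lpow D 2 (phi k \- u)%R := Lpow_refl 2 (measurable_funB mp mu_).
    have e2 i : Lpow D' 2 (partial i (fun z => phi k (refl a z)) \- reflg g i) = Lpow D 2 (partial i (phi k) \- g i).
      have [[mg _] _] := Hg i.
      have mdp : measurable_fun D (partial i (phi k)).
        by apply: measurable_funTS; apply: Cc_measurable; exact: Cc_partial.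
      rewrite -(Lpow_refl 2 (measurable_funB mdp mg)) -(Lpow_rsgn D' 2 i (fun z => (partial i (phi k) \- g i) (refl a z))).
      rewrite (partial_refl _ _ (Cc_smooth (cphi k))).
      by congr (Lpow D' 2 _); apply/funext => z; rewrite /reflg /= mulrBr.
    by rewrite /H1dist2 /dirichlet e1 (eq_bigr _ (fun i _ => e2 i)).
  by rewrite (funext E).
- by under [X in X @ _ --> _]eq_fun do under eq_fun do rewrite refl_rcons subKr.
Qed.

End sets.

End reflection.

(** * The derivative of the smooth step *)

Section sstep_derivative.
Context {R : realType}.

Definition dsstep (x : R) : R := 'D_1 (@sstep R) x.

Lemma is_derive_sstep (x : R) : is_derive x (1 : R) sstep (dsstep x).
Proof.
have [s' ds _] := @C1k_sstep R 1.
by rewrite /dsstep (@derive_val _ _ _ _ _ _ _ (ds x)).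
Qed.

Lemma continuous_dsstep : continuous dsstep.
Proof.
have [s' ds cs] := @C1k_sstep R 1.
rewrite (_ : dsstep = s'); first exact: cs.
by apply/funext => x; rewrite /dsstep (@derive_val _ _ _ _ _ _ _ (ds x)).
Qed.

Lemma dsstep_out x : x < 0 \/ 1 < x -> dsstep x = 0.
Proof.
move=> x01; rewrite /dsstep -[RHS](@derive_cst _ _ _ (sstep x) x 1).
apply: near_eq_derive; case: x01 => hx.
  by near=> y; rewrite /cst !sstep0// ltW//; near: y; exact: lt_nbhsl.
by near=> y; rewrite /cst !sstep1// ltW//; near: y; exact: lt_nbhsr.
Unshelve. all: by end_near. Qed.

Lemma dsstep_bounded : exists2 M : R, 0 <= M & forall x, `|dsstep x| <= M.
Proof.
have [] := @EVT_max R (fun x => `|dsstep x|) 0 1 ler01.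
  apply: continuous_subspaceT => x; apply: (@cvg_norm _ R _ _ _ dsstep); exact: continuous_dsstep.
move=> c _ hc; exists `|dsstep c|; first exact: normr_ge0.
move=> x.
have [x0|x0] := ltP x 0; first by rewrite dsstep_out ?normr0//; left.
have [x1|x1] := ltP 1 x; first by rewrite dsstep_out ?normr0//; right.
by apply: hc; rewrite in_itv/= x0.
Qed.

End sstep_derivative.

(** This lemma and the next conclude [H1_glue] in its two sign cases: [rsgn i] is -1 for the last
    coordinate and 1 for the others. *)
Lemma eq_addN_odd (R : realType) (a b c d : R) : a + b = c + d -> a + -1 * c = - (b + -1 * d).
Proof. lra. Qed.

Lemma eq_addN_even (R : realType) (a b c d : R) : a + b = 0 -> c + d = 0 -> a + 1 * c = - (b + 1 * d).
Proof. lra. Qed.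

Section integrable_fin.
Context d (T : measurableType d) {R : realType} (mu : {measure set T -> \bar R}).
Variables (D : set T) (f g : T -> R).
Hypotheses (mD : measurable D) (fi : mu.-integrable D (EFin \o f)) (gi : mu.-integrable D (EFin \o g)).

Lemma integrableD_fin : mu.-integrable D (EFin \o (fun z => f z + g z)).
Proof. by have := integrableD mD fi gi. Qed.

Lemma integrableB_fin : mu.-integrable D (EFin \o (fun z => f z - g z)).
Proof. by have := integrableB mD fi gi. Qed.

End integrable_fin.

(** * Half-spaces: boundary terms and gluing *)

Section half.
Context {R : realType} (N : nat).
Local Notation X := 'rV[R]_N.+1.
Local Notation mu := (leb R N.+1).
Local Notation half := (@half_space R N).
Implicit Types (D : set X) (u f : X -> R) (g : 'I_N.+1 -> X -> R).

Lemma measurable_half : measurable half.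
Proof.
rewrite (_ : half = (fun z : X => z ord0 ord_max) @^-1` `]0, +oo[%classic); last first.
  by apply/seteqP; split => z /=; rewrite /half_space/= in_itv/= andbT.
by rewrite -[X in measurable X]setTI; exact: (measurable_coor (ord_max : 'I_N.+1)).
Qed.

Lemma measurable_strip (l : R) : measurable (@strip R N l).
Proof.
rewrite (_ : strip l = (fun z : X => z ord0 ord_max) @^-1` `]0, l[%classic); last first.
  by apply/seteqP; split => z /=; rewrite /strip/= in_itv/=.
by rewrite -[X in measurable X]setTI; exact: (measurable_coor (ord_max : 'I_N.+1)).
Qed.

Definition ystep (a b : R) (z : X) : R := sstep (a * z ord0 ord_max + b).

Lemma ystep_C1k a b k : C1k k (fun x : R => sstep (a * x + b)).
Proof.
apply: (C1k_comp (f := sstep) (g := fun x => a * x + b)); first exact: C1k_sstep.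
by apply: C1kD; [apply: C1kM; [exact: C1k_cst|exact: C1k_id]|exact: C1k_cst].
Qed.

Lemma smooth_ystep a b : smooth (ystep a b).
Proof. by apply: (@smooth_coord _ _ (fun x => sstep (a * x + b))); exact: ystep_C1k. Qed.

Lemma partial_ystep a b i : partial i (ystep a b) =
  (fun z => if ord_max == i then a * dsstep (a * z ord0 ord_max + b) else 0).
Proof.
apply: (@partial_coord _ _ (fun x => sstep (a * x + b)) (fun x => a * dsstep (a * x + b))) => x.
have d1 : is_derive x (1 : R) (fun x => a * x + b) a.
  have := is_deriveD (is_deriveM (is_derive_cst a x 1) (is_derive_id x 1)) (is_derive_cst b x 1).
  by rewrite scaler0 !addr0 (_ : cst a x *: 1 = a)//; exact: mulr1.
rewrite mulrC; exact: (is_derive1_comp (is_derive_sstep _) d1).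
Qed.

Lemma ystep01 a b z : 0 <= ystep a b z <= 1.
Proof. by rewrite sstep_ge0 sstep_le1. Qed.

(* Multiply psi by sstep (k y - 1), which vanishes for y <= 1 / k: its
   derivative, of size k, lives where y <= 2 / k, where psi = O(1 / k). *)
Lemma half_weak i u g psi : H1 half u g -> Cc psi ->
  (i = ord_max -> forall x, psi (rV_rcons (x, 0)) = 0) ->
  \int[mu]_(z in half) (u z * partial i psi z + g i z * psi z) = 0.
Proof.
move=> [Lu Hg] cpsi psi0; have mD := measurable_half.
have [Lg wg] := Hg i.
have spsi := Cc_smooth cpsi.
pose eta k := ystep k.+1%:R (-1).
have se k : smooth (eta k) by exact: smooth_ystep.
have cpe k : Cc (fun z => psi z * eta k z) by exact: (CcM cpsi (se k)).
have sub k : fsupport (fun z => psi z * eta k z) `<=` half.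
  move=> z hz; rewrite /half_space/=.
  have cl : closed [set z : X | k.+1%:R^-1 <= z ord0 ord_max].
    rewrite (_ : [set _ | _] = (fun z : X => z ord0 ord_max) @^-1` [set y | k.+1%:R^-1 <= y])//.
    apply: closed_comp; last exact: closed_ge.
    by move=> w _; exact: coord_continuous.
  have : closure [set z | psi z * eta k z != 0] `<=` [set z : X | k.+1%:R^-1 <= z ord0 ord_max].
    rewrite [X in _ `<=` X](closure_id _).1//; apply: closureS => w /= hw.
    rewrite leNgt; apply/negP => wk; move/eqP: hw; apply; rewrite /eta /ystep sstep0 ?mulr0//.
    rewrite subr_le0; apply: (le_trans (ler_wpM2l (ler0n _ _) (ltW wk))).
    by rewrite mulfV ?pnatr_eq0.
  by move=> /(_ _ hz) /=; apply: lt_le_trans; rewrite invr_gt0 ltr0n.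
pose F z := u z * partial i psi z + g i z * psi z.
have cdp := Cc_partial i cpsi.
have iF : mu.-integrable half (EFin \o F).
  have i1 := L2_integrableM mD Lu (L2_Cc mD cdp).
  have i2 := L2_integrableM mD Lg (L2_Cc mD cpsi).
  exact: integrableD_fin.
pose f k z := (1 - eta k z) * F z - u z * (partial i (eta k) z * psi z).
have cpd k : Cc (fun z => partial i (eta k) z * psi z).
  exact: (CcM' (smooth_partial i (se k)) cpsi).
have me k : measurable_fun half (fun z => 1 - eta k z).
  by apply: (measurable_funB (measurable_cst _)); apply: measurable_funTS; exact: (smooth_measurable (se k)).
have mF : measurable_fun half F by have /integrableP[/measurable_EFinP] := iF.
have if1 k : mu.-integrable half (EFin \o (fun z => (1 - eta k z) * F z)).
  apply: (integrable_mulb (M := 1)) => // z _; have /andP[h1 h2] := ystep01 k.+1%:R (-1) z.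
  by rewrite -/(eta k z) in h1 h2; rewrite ger0_norm; lra.
have if2 k : mu.-integrable half (EFin \o (fun z => u z * (partial i (eta k) z * psi z))).
  exact: (L2_integrableM mD Lu (L2_Cc mD (cpd k))).
have Ef k : \int[mu]_(z in half) f k z = \int[mu]_(z in half) F z.
  have w := wg _ (cpe k) (sub k).
  have j1 := L2_integrableM mD Lu (L2_Cc mD (Cc_partial i (cpe k))).
  have j2 := L2_integrableM mD Lg (L2_Cc mD (cpe k)).
  rewrite /f RintegralB//.
  have -> : \int[mu]_(z in half) ((1 - eta k z) * F z) =
     \int[mu]_(z in half) F z - \int[mu]_(z in half) (eta k z * F z).
    rewrite -RintegralB//; first by apply: eq_Rintegral => z _; ring.
    apply: (integrable_mulb (M := 1)) => //.
      by apply: measurable_funTS; exact: (smooth_measurable (se k)).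
    move=> z _; have /andP[h1 h2] := ystep01 k.+1%:R (-1) z.
    by rewrite -/(eta k z) in h1 h2; rewrite ger0_norm; lra.
  have -> : \int[mu]_(z in half) (eta k z * F z) =
    \int[mu]_(z in half) (u z * partial i (fun z => psi z * eta k z) z)
    + \int[mu]_(z in half) (g i z * (psi z * eta k z))
    - \int[mu]_(z in half) (u z * (partial i (eta k) z * psi z)).
    rewrite -RintegralD// -RintegralB//; last exact: integrableD_fin.
    by apply: eq_Rintegral => z _; rewrite (partialM _ spsi (se k)) /F; ring.
  by rewrite w; lra.
have [M M0 hM] := @dsstep_bounded R.
have [L L0 hL] := Cc_bounded (Cc_partial ord_max cpsi).
have /CcP[_ [r r0 br]] := cpsi.
(* The half-space has infinite measure, so the constant bound on the cutoff term is multiplied by a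
   test function [c] equal to 1 on the support of [psi]; it then pairs with [u] to an integrable
   function. *)
pose K := Num.truncn r.
pose c := cutn (R := R) (n := N.+1) K.
have cc : Cc c by exact: Cc_cutn.
have c1 z : psi z != 0 -> c z = 1.
  move=> hz; apply: cutn_eq1; apply: (@le_trans _ _ r); last exact: ltW (truncnS_gt _).
  by apply: norm_le_box => // j; rewrite leNgt; apply/negP => /br h; move/eqP: hz.
have c0 z : 0 <= c z by have /andP[] := cutn01 K z.
have dom k z : half z -> `|partial i (eta k) z * psi z| <= 2 * M * L * c z.
  rewrite /half_space/= => z0.
  have [->|pz] := eqVneq (psi z) 0; first by rewrite mulr0 normr0 !mulr_ge0.
  rewrite (c1 _ pz) mulr1 /eta partial_ystep; case: eqP => [ii|_]; last by rewrite mul0r normr0 !mulr_ge0.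
  set y := z ord0 ord_max in z0 *.
  have k0 : 0 < k.+1%:R :> R by rewrite ltr0n.
  have [y1|y1] := ltP 1 (k.+1%:R * y + -1).
    by rewrite dsstep_out ?mulr0 ?mul0r ?normr0 ?mulr_ge0//; right.
  have pL : `|psi z| <= L * y.
    have zE := rV_unrconsK z; rewrite /rV_unrcons in zE.
    set x := (\row_j _) in zE.
    have := @MVT_bound R (fun t => psi (rV_rcons (x, t))) (fun t => partial ord_max psi (rV_rcons (x, t))) L 0 y
      (fun t => is_derive_vslice x t spsi) (fun t => hL _).
    by rewrite (psi0 (esym ii)) !subr0 -/y zE (gtr0_norm z0).
  rewrite !normrM (gtr0_norm k0).
  apply: (@le_trans _ _ (k.+1%:R * M * (L * y))).
    apply: ler_pM => //; last by apply: ler_wpM2l; [exact: ltW|exact: hM].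
  have : k.+1%:R * y <= 2 by lra.
  have : 0 <= M * L by exact: mulr_ge0.
  move=> h1 h2; rewrite (_ : _ * M * (L * y) = (k.+1%:R * y) * (M * L)); last by ring.
  by rewrite -[leRHS]mulrA; exact: (ler_wpM2r h1 h2).
have H0 : (\int[mu]_(z in half) (f k z)%:E)%E @[k --> \oo] --> 0%E.
  apply: (@dct_cvg0 _ _ _ mu half _ (fun z => `|F z| + `|u z * (2 * M * L * c z)|)) => //.
  - move=> k; apply: measurable_funB; first exact: measurable_funM.
    have [mu_ _] := Lu; apply: measurable_funM => //.
    by apply: measurable_funTS; exact: Cc_measurable.
  - move=> z z0; rewrite /half_space/= in z0.
    apply: cvg_near_cst; near=> k.
    have k2 : 2 < k.+1%:R * z ord0 ord_max.
      rewrite -ltr_pdivrMr//; near: k; exists (Num.truncn (2 / z ord0 ord_max)) => // k /= hk.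
      by apply: (lt_le_trans (truncnS_gt _)); rewrite ler_nat ltnS.
    rewrite /f /eta partial_ystep /ystep sstep1; last by lra.
    rewrite dsstep_out; last by right; lra.
    by rewrite mulr0 subrr mul0r; case: ifP; rewrite mul0r mulr0 subr0.
  - move=> k z z0; rewrite /f; apply: (le_trans (ler_normB _ _)); apply: lerD.
      rewrite normrM ler_piMl//; have /andP[h1 h2] := ystep01 k.+1%:R (-1) z.
      by rewrite -/(eta k z) in h1 h2; rewrite ger0_norm; lra.
    rewrite !normrM -normrM; apply: ler_wpM2l => //.
    apply: (le_trans (dom k z z0)); rewrite -!normrM; exact: ler_norm.
  - have j1 : mu.-integrable half (EFin \o (fun z => u z * (2 * M * L * c z))).
      by apply: (L2_integrableM mD Lu); apply: (L2_Cc mD); apply: (CcM' _ cc); exact: smooth_cst.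
    apply: (integrableD_fin mD (integrable_abse iF) (integrable_abse j1)).
have E k : (\int[mu]_(z in half) (f k z)%:E)%E = (\int[mu]_(z in half) F z)%:E.
  rewrite -(Ef k) fineK//; apply: integrable_fin_num => //.
  exact: integrableB_fin.
rewrite (funext E) in H0.
by move/(cvg_lim (@ereal_hausdorff R)) : H0; rewrite lim_cst// => -[].
Unshelve. all: by end_near. Qed.

(* By Green's formula, on the half-space this is minus the integral of the trace
   of u times psi on y = 0: it depends on u through its trace only. *)
Definition bdry D u g psi : R :=
  \int[mu]_(z in D) (u z * partial ord_max psi z + g ord_max z * psi z).

Lemma integrable_bdry D u g psi i : measurable D -> H1 D u g -> Cc psi ->
  mu.-integrable D (EFin \o (fun z => u z * partial i psi z + g i z * psi z)).
Proof.
move=> mD [Lu Hg] cpsi; have [Lg _] := Hg i.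
have i1 := L2_integrableM mD Lu (L2_Cc mD (Cc_partial i cpsi)).
have i2 := L2_integrableM mD Lg (L2_Cc mD cpsi).
exact: integrableD_fin.
Qed.

(** [u2] fills [y < 0] after reflection. The two supports are disjoint, so that all power integrals
    add up. *)
Definition glue u1 u2 : X -> R := fun z => (u1 \_ half) z + (u2 \_ half) (refl 0 z).

Definition glueg g1 g2 : 'I_N.+1 -> X -> R :=
  fun i => glue (g1 i) (fun z => rsgn i * g2 i z).

Lemma measurable_patch D f : measurable D -> measurable_fun D f -> measurable_fun setT (f \_ D).
Proof. by move=> mD mf; apply/(measurable_restrictT _ mD). Qed.

Lemma Lpow_glue p u1 u2 : p != 0 -> measurable_fun half u1 -> measurable_fun half u2 ->
  Lpow setT p (glue u1 u2) = (Lpow half p u1 + Lpow half p u2)%E.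
Proof.
move=> p0 m1 m2; have mD := measurable_half.
have mp1 := measurable_patch mD m1; have mp2 := measurable_patch mD m2.
have TT : forall z : X, setT z <-> setT (refl 0 z) by [].
rewrite -(Lpow_patch u1 p0 (@subsetT _ half)) -(Lpow_patch u2 p0 (@subsetT _ half)).
rewrite -(Lpow_refl measurableT TT p mp2).
have q1 : measurable_fun setT (fun z => `|(u1 \_ half) z| `^ p).
  by apply: measurable_powR_comp; exact: measurableT_comp.
have q2 : measurable_fun setT (fun z => `|(u2 \_ half) (refl 0 z)| `^ p).
  by apply: measurable_powR_comp; apply: measurableT_comp => //; exact: (measurableT_comp mp2 (@measurable_refl _ _ 0)).
have E := ge0_integralD_fin mu measurableT q1 q2 (fun z _ => powR_ge0 _ _) (fun z _ => powR_ge0 _ _).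
rewrite /Lpow -E.
apply: eq_integral => z _; congr EFin; rewrite /glue !patchE.
case: ifPn => z1; case: ifPn => z2; rewrite ?normr0 ?powR0// ?addr0 ?add0r ?normr0 ?powR0//.
by move: z1 z2; rewrite !inE /half_space/= refl_last sub0r; lra.
Qed.

Lemma dirichlet_glue g1 g2 : (forall i, measurable_fun half (g1 i)) -> (forall i, measurable_fun half (g2 i)) ->
  dirichlet setT (glueg g1 g2) = (dirichlet half g1 + dirichlet half g2)%E.
Proof.
move=> m1 m2; rewrite /dirichlet -big_split/=; apply: eq_bigr => i _.
have p2 : 2 != 0 :> R by rewrite pnatr_eq0.
rewrite /glueg (Lpow_glue p2 (m1 i) (measurable_funM (measurable_cst _) (m2 i))).
by rewrite Lpow_rsgn.
Qed.

Lemma L2_glue u1 u2 : L2 half u1 -> L2 half u2 -> L2 setT (glue u1 u2).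
Proof.
move=> L1 L2_; have mD := measurable_half.
have TT : forall z : X, setT z <-> setT (refl 0 z) by [].
apply: (L2D measurableT); first exact: (L2_patch mD measurableT (@subsetT _ _) L1).
exact: (L2_refl measurableT TT (L2_patch mD measurableT (@subsetT _ _) L2_)).
Qed.

Lemma Rintegral_glue u1 u2 psi : L2 half u1 -> L2 half u2 -> Cc psi ->
  \int[mu]_z (glue u1 u2 z * psi z) =
  \int[mu]_(z in half) (u1 z * psi z) + \int[mu]_(z in half) (u2 z * psi (refl 0 z)).
Proof.
move=> L1 L2_ cpsi; have mD := measurable_half.
have TT : forall z : X, setT z <-> setT (refl 0 z) by [].
have P1 := L2_patch mD measurableT (@subsetT _ _) L1.
have P2 := L2_patch mD measurableT (@subsetT _ _) L2_.
have Lp := L2_Cc measurableT cpsi.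
have P2r := L2_refl measurableT TT P2.
have i1 := L2_integrableM measurableT P1 Lp.
have i2 := L2_integrableM measurableT P2r Lp.
rewrite -(integral_patch u1 psi (@subsetT _ half)) -(integral_patch u2 (fun z => psi (refl 0 z)) (@subsetT _ half)).
have [mp2 _] := P2; have mpsi := Cc_measurable (Cc_refl 0 cpsi).
rewrite -(Rintegral_refl measurableT TT (f := fun z => (u2 \_ half) z * psi (refl 0 z))); last first.
  exact: measurable_funM.
rewrite -[RHS]RintegralD//.
  by apply: eq_Rintegral => z _; rewrite /glue reflK; ring.
rewrite (_ : _ \o _ = EFin \o (fun z => (u2 \_ half) (refl 0 z) * psi z))//.
by apply/funext => z /=; rewrite reflK.
Qed.

(** In a direction parallel to the hyperplane, [half_weak] applies to each half separately. In the
    normal direction each half leaves its boundary functional, with opposite signs because of the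
    reflection, and the hypothesis says that they cancel. *)
Lemma H1_glue u1 g1 u2 g2 : H1 half u1 g1 -> H1 half u2 g2 ->
  (forall phi, Cc phi -> bdry half u1 g1 phi = bdry half u2 g2 (fun z => phi (refl 0 z))) ->
  H1 setT (glue u1 u2) (glueg g1 g2).
Proof.
move=> h1 h2 hB; have mD := measurable_half.
have [L1 G1] := h1; have [L2_ G2] := h2.
split; first exact: L2_glue.
move=> i; have [Lg1 _] := G1 i; have [Lg2 _] := G2 i.
split; first exact: (L2_glue Lg1 (L2_rsgn i Lg2)).
move=> phi cphi _; have sphi := Cc_smooth cphi.
have cdp := Cc_partial i cphi.
rewrite (Rintegral_glue L1 L2_ cdp) (Rintegral_glue Lg1 (L2_rsgn i Lg2) cphi).
pose psi z := phi (refl 0 z).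
have cpsi : Cc psi by exact: Cc_refl.
have dpsi z : partial i phi (refl 0 z) = rsgn i * partial i psi z.
  by rewrite /psi (partial_refl _ _ sphi) mulrA rsgn_sqr mul1r.
have j1 := L2_integrableM mD L1 (L2_Cc mD cdp).
have j2 := L2_integrableM mD Lg1 (L2_Cc mD cphi).
have j3 := L2_integrableM mD L2_ (L2_Cc mD (Cc_partial i cpsi)).
have j4 := L2_integrableM mD Lg2 (L2_Cc mD cpsi).
have -> : \int[mu]_(z in half) (u2 z * partial i phi (refl 0 z)) = rsgn i * \int[mu]_(z in half) (u2 z * partial i psi z).
  by rewrite -RintegralZl//; apply: eq_Rintegral => z _; rewrite dpsi; ring.
have -> : \int[mu]_(z in half) (rsgn i * g2 i z * phi (refl 0 z)) = rsgn i * \int[mu]_(z in half) (g2 i z * psi z).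
  by rewrite -RintegralZl//; apply: eq_Rintegral => z _; rewrite /psi; ring.
have S1 := RintegralD mD j1 j2; have S2 := RintegralD mD j3 j4.
have [ii|ni] := eqVneq i ord_max.
  by subst i; have := hB _ cphi; rewrite /bdry S1 S2 /rsgn eqxx => e; exact: eq_addN_odd e.
have n1 : i = ord_max -> forall x, phi (rV_rcons (x, 0)) = 0 by move=> h; rewrite h eqxx in ni.
have n2 : i = ord_max -> forall x, psi (rV_rcons (x, 0)) = 0 by move=> h; rewrite h eqxx in ni.
have := half_weak h1 cphi n1; have := half_weak h2 cpsi n2.
by rewrite S1 S2 /rsgn (negbTE ni) => e2 e1; exact: eq_addN_even e1 e2.
Qed.

(** The difference of [phi] and its reflection vanishes on [y = 0], so [half_weak] applies to it.
    Hence even reflection stays in H^1 without any knowledge of the trace of [u]. *)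
Lemma bdry_even u g phi : H1 half u g -> Cc phi -> bdry half u g phi = bdry half u g (fun z => phi (refl 0 z)).
Proof.
move=> h cphi; have mD := measurable_half.
have cr := Cc_refl 0 cphi.
have cN : Cc (fun z => (-1) * phi (refl 0 z)) by apply: (CcM' _ cr); exact: smooth_cst.
have cpsi := CcD cphi cN.
have := half_weak (i := ord_max) h cpsi _.
have -> : \int[mu]_(z in half) (u z * partial ord_max (fun z => phi z + (-1) * phi (refl 0 z)) z + g ord_max z * (phi z + (-1) * phi (refl 0 z))) =
  bdry half u g phi - bdry half u g (fun z => phi (refl 0 z)).
  rewrite /bdry -RintegralB//; [|exact: integrable_bdry|exact: integrable_bdry].
  apply: eq_Rintegral => z _; rewrite (partialD _ (Cc_smooth cphi) (Cc_smooth cN)).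
  by rewrite (partialM _ (@smooth_cst _ _ (-1)) (Cc_smooth cr)) partial_cst; ring.
move=> /(_ _)/wrap[]; last by lra.
by move=> _ x; rewrite refl_rcons subr0 mulN1r subrr.
Qed.

End half.

(** * Splitting and doubling: comparison of the space with the half-space *)

Section halves.
Context {R : realType} (N : nat).
Local Notation X := 'rV[R]_N.+1.
Local Notation mu := (leb R N.+1).
Local Notation half := (@half_space R N).
Local Notation q := (two_star R N).
Local Notation s := (2 / N.+1%:R : R).
Implicit Types (D : set X) (u f : X -> R) (g : 'I_N.+1 -> X -> R).

Lemma last_rcons (x : 'rV[R]_N) (y : R) : rV_rcons (x, y) ord0 ord_max = y.
Proof. by rewrite mxE unlift_none. Qed.

Lemma leb_hyperplane : mu [set z : X | z ord0 ord_max = 0] = 0%E.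
Proof.
have mH : measurable [set z : X | z ord0 ord_max = 0].
  rewrite (_ : [set _ | _] = (fun z : X => z ord0 ord_max) @^-1` [set 0])//.
  by rewrite -[X in measurable X]setTI; exact: (measurable_coor (ord_max : 'I_N.+1)).
have := integral_indic mu measurableT mH; rewrite setIT => <-.
rewrite ge0_leb_fubini//; last by apply/measurable_EFinP; exact: measurable_indic.
rewrite -[RHS](integral_set1 (fun y => \int[leb R N]_x (\1_[set z : X | z ord0 ord_max = 0] (rV_rcons (x, y)))%:E)%E 0).
rewrite [RHS]integral_mkcond; apply: eq_integral => y _; rewrite patchE; case: ifPn => //.
rewrite notin_setE/= => /eqP y0; apply: integral0_eq => x _.
by rewrite indicE memNset//= last_rcons; exact/eqP.
Qed.

Lemma ge0_integral_split (F : X -> \bar R) : measurable_fun setT F -> (forall z, (0 <= F z)%E) ->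
  (\int[mu]_z F z = \int[mu]_(z in half) F z + \int[mu]_(z in half) F (refl 0 z))%E.
Proof.
move=> mF F0; have mD := @measurable_half R N.
have mr : measurable_fun setT (fun z => F (refl 0 z)) := measurableT_comp mF (@measurable_refl R N 0).
rewrite [X in (X + _)%E]integral_mkcond [X in (_ + X)%E]integral_mkcond.
have p0 (H : X -> \bar R) z : (forall z, (0 <= H z)%E) -> (0 <= (H \_ half) z)%E.
  by move=> H0; rewrite patchE; case: ifPn.
have m1 : measurable_fun setT (F \_ half) by apply/(measurable_restrictT _ mD); exact: measurable_funTS.
have m2 : measurable_fun setT ((fun z => F (refl 0 z)) \_ half).
  by apply/(measurable_restrictT _ mD); exact: measurable_funTS.
rewrite -(@ge0_integral_refl _ _ 0 ((fun z => F (refl 0 z)) \_ half))//; last by move=> z; exact: p0.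
have m2r := measurableT_comp m2 (@measurable_refl R N 0).
rewrite -ge0_integralD//; do ?[by move=> z _; apply: p0].
apply: ge0_ae_eq_integral => //.
- exact: emeasurable_funD.
- by move=> z _; rewrite adde_ge0//; exact: p0.
exists [set z : X | z ord0 ord_max = 0]; split.
- rewrite (_ : [set _ | _] = (fun z : X => z ord0 ord_max) @^-1` [set 0])//.
  by rewrite -[X in measurable X]setTI; exact: (measurable_coor (ord_max : 'I_N.+1)).
- exact: leb_hyperplane.
move=> z /= hz; apply: contrapT => z0; apply: hz => _.
rewrite !patchE reflK; case: ifPn => z1; case: ifPn => z2; rewrite ?adde0 ?add0e//.
  by exfalso; move: z1 z2; rewrite !inE /half_space/= refl_last; lra.
exfalso; move: z1 z2; rewrite !notin_setE /half_space/= refl_last => h1 h2; apply: z0.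
by move/negP: h1; move/negP: h2; rewrite -!leNgt; lra.
Qed.

Lemma Lpow_split p f : measurable_fun setT f ->
  Lpow setT p f = (Lpow half p f + Lpow half p (fun z => f (refl 0 z)))%E.
Proof.
move=> mf; apply: (@ge0_integral_split (fun z => (`|f z| `^ p)%:E)).
  by apply/measurable_EFinP; apply: measurable_powR_comp; exact: measurableT_comp.
by move=> z; rewrite lee_fin powR_ge0.
Qed.

Lemma dirichlet_split (phi : X -> R) : Cc phi -> dirichlet setT (fun i => partial i phi) =
  (dirichlet half (fun i => partial i phi) + dirichlet half (fun i => partial i (fun z => phi (refl 0 z))))%E.
Proof.
move=> cphi; rewrite /dirichlet -big_split/=; apply: eq_bigr => i _.
rewrite Lpow_split; last by apply: Cc_measurable; exact: Cc_partial.
by rewrite (partial_refl _ _ (Cc_smooth cphi)) Lpow_rsgn.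
Qed.

Definition vtrans (t : R) f : X -> R :=
  fun z => f (affmap (fun=> 1) (fun i => if i == ord_max then t else 0) z).

Lemma vtrans_rcons t f x y : vtrans t f (rV_rcons (x, y)) = f (rV_rcons (x, y + t)).
Proof.
rewrite /vtrans affmap_rcons eqxx mul1r; congr (f (rV_rcons (_, _))).
by apply/rowP => j; rewrite !mxE /= mul1r eq_sym (negbTE (neq_lift _ _)) addr0.
Qed.

Lemma Cc_vtrans t f : Cc f -> Cc (vtrans t f).
Proof. by move=> cf; apply: Cc_affmap => // i; exact: oner_neq0. Qed.

Lemma partial_vtrans t f i : smooth f -> partial i (vtrans t f) = vtrans t (partial i f).
Proof. by move=> sf; rewrite /vtrans partial_affmap//; apply/funext => z; rewrite mul1r. Qed.

Lemma Lpow_vtrans t p f : measurable_fun setT f -> Lpow setT p (vtrans t f) = Lpow setT p f.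
Proof.
move=> mf; have mp : measurable_fun setT (fun z => (`|f z| `^ p)%:E).
  by apply/measurable_EFinP; apply: measurable_powR_comp; exact: measurableT_comp.
have := ge0_integral_affmap (fun i : 'I_N.+1 => if i == ord_max then t else 0) (fun i => oner_neq0 R) mp
  (fun z => powR_ge0 _ _).
by rewrite big1 ?mul1e// => i _; rewrite normr1.
Qed.

Lemma dirichlet_vtrans t (phi : X -> R) : Cc phi ->
  dirichlet setT (fun i => partial i (vtrans t phi)) = dirichlet setT (fun i => partial i phi).
Proof.
move=> cphi; apply: eq_bigr => i _; rewrite partial_vtrans; last exact: Cc_smooth.
by apply: Lpow_vtrans; apply: Cc_measurable; exact: Cc_partial.
Qed.

Lemma measurable_slice_mass f : measurable_fun setT f ->
  measurable_fun setT (fun y : R => sqint (leb R N) setT (fun x => f (rV_rcons (x, y)))).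
Proof.
move=> mf; apply: (measurable_int_rcons (f := fun z => (f z ^+ 2)%:E)).
  by apply/measurable_EFinP; exact: measurable_sqr.
by move=> z; rewrite lee_fin sqr_ge0.
Qed.

Lemma half_mass_vtrans t f : measurable_fun setT f ->
  sqint mu half (vtrans t f) =
  (\int[lebesgue_measure]_(y in `]t, +oo[) sqint (leb R N) setT (fun x => f (rV_rcons (x, y))))%E.
Proof.
move=> mf; have mD := @measurable_half R N.
have mt : measurable_fun setT (vtrans t f).
  by rewrite /vtrans; apply: measurableT_comp => //; exact: measurable_affmap.
pose nu (y : R) := sqint (leb R N) setT (fun x => f (rV_rcons (x, y))).
have mnu : measurable_fun setT (nu \_ `]t, +oo[).
  apply/(measurable_restrictT _ (measurable_itv _)).
  exact: (measurable_funTS (measurable_slice_mass mf)).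
have nu0 y : (0 <= (nu \_ `]t, +oo[) y)%E by rewrite patchE; case: ifPn => // _; exact: sqint_ge0.
have := ge0_integral_aff1 (c := 1) t (oner_neq0 R) mnu nu0; rewrite normr1 mul1e => H.
rewrite [RHS]integral_mkcond -H /sqint integral_mkcond ge0_leb_fubini; last 2 first.
- apply/(measurable_restrictT _ mD); apply: measurable_funTS; apply/measurable_EFinP.
  exact: measurable_sqr.
- by move=> z; rewrite patchE; case: ifPn => // _; rewrite lee_fin sqr_ge0.
apply: eq_integral => y _; rewrite mul1r [RHS]patchE; case: ifPn => yt.
  apply: eq_integral => x _; rewrite patchE ifT ?vtrans_rcons//.
  by apply/mem_set; rewrite /half_space/= last_rcons; move: yt; rewrite inE/= in_itv/= andbT; lra.
apply: integral0_eq => x _; rewrite patchE ifF//; apply/negbTE.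
rewrite notin_setE /half_space/= last_rcons => y0; move: yt; rewrite notin_setE/= in_itv/= andbT; apply.
lra.
Qed.

(** The slices have bounded mass by [slice_mass_le], so the mass above height [t] is a Lipschitz
    function of [t]. It decreases from the whole mass to 0, and the intermediate value theorem gives
    [t]. *)
Lemma bisect_mass (phi : X -> R) : Cc phi ->
  exists t : R, sqint mu half (vtrans t phi) = (rmass phi / 2)%:E.
Proof.
move=> cphi; have mf := Cc_measurable cphi.
pose nu (y : R) := sqint (leb R N) setT (fun x => phi (rV_rcons (x, y))).
have mnu : measurable_fun setT nu by exact: measurable_slice_mass.
have nu0 y : (0 <= nu y)%E by exact: sqint_ge0.
pose C := 2 * (rmass phi `^ 2^-1 * rdir phi `^ 2^-1).
have C0 : 0 <= C by rewrite !mulr_ge0// powR_ge0.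
have nuC y : (nu y <= C%:E)%E by rewrite /nu (rmassE (Cc_slice y cphi)) lee_fin; exact: slice_mass_le.
have /CcP[_ [r r0 br]] := cphi.
have nur y : r < `|y| -> nu y = 0%E.
  move=> ry; apply: integral0_eq => x _; rewrite (br _ ord_max) ?expr0n//.
  by rewrite last_rcons.
have int_nu : (\int[lebesgue_measure]_y nu y = (rmass phi)%:E)%E.
  rewrite -(rmassE cphi) /sqint ge0_leb_fubini//.
  - by apply/measurable_EFinP; exact: measurable_sqr.
  - by move=> z; rewrite lee_fin sqr_ge0.
pose I (t : R) := (\int[lebesgue_measure]_(y in `]t, +oo[) nu y)%E.
have I0 t : (0 <= I t)%E by exact: integral_ge0.
have IM t : (I t <= (rmass phi)%:E)%E by rewrite -int_nu; apply: ge0_subset_integral.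
have Ifin t : I t \is a fin_num by rewrite ge0_fin_numE// (le_lt_trans (IM t))// ltry.
pose m t := fine (I t).
have split a b : a <= b -> I a = (\int[lebesgue_measure]_(y in `]a, b]) nu y + I b)%E.
  move=> ab; rewrite -ge0_integral_setU//=.
  - congr (integral _ _ _); apply/seteqP; split => y /=; rewrite !in_itv/= !andbT.
      by move=> ay; have [yb|yb] := leP y b; [left; rewrite ay|right].
    by move=> [/andP[]//|]; exact: le_lt_trans.
  - exact: measurable_funTS.
  - apply/disj_setPS => y []/=; rewrite !in_itv/= andbT => /andP[_ h1] h2.
    by move: h1; rewrite leNgt h2.
have lip a b : a <= b -> 0 <= m a - m b <= C * (b - a).
  move=> ab; have H := split _ _ ab.
  have i1 : (\int[lebesgue_measure]_(y in `]a, b]) nu y <= (C * (b - a))%:E)%E.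
    apply: (@le_trans _ _ (\int[lebesgue_measure]_(y in `]a, b]) (cst C%:E y))%E).
      by apply: ge0_le_integral => //; exact: measurable_funTS.
    rewrite integral_cst//= lebesgue_measure_itv/= lte_fin.
    case: (ltP a b) => ab'; last by rewrite mule0 lee_fin mulr_ge0// subr_ge0.
    by rewrite -EFinD -EFinM.
  have i0 : (0 <= \int[lebesgue_measure]_(y in `]a, b]) nu y)%E by exact: integral_ge0.
  have ifin : (\int[lebesgue_measure]_(y in `]a, b]) nu y)%E \is a fin_num.
    by rewrite ge0_fin_numE// (le_lt_trans i1)// ltry.
  rewrite /m H fineD//= addrK; apply/andP; split; first exact: fine_ge0.
  by rewrite -lee_fin fineK.
have cm : continuous m.
  have C1 : 0 < C + 1 by rewrite ltr_wpDl.
  move=> t; apply/cvgrPdist_le => e e0; near=> t'.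
  have : `|m t - m t'| <= C * `|t - t'|.
    have [tt|/ltW tt] := leP t t'.
      by have /andP[h1 h2] := lip _ _ tt; rewrite ger0_norm// distrC ger0_norm ?subr_ge0.
    by have /andP[h1 h2] := lip _ _ tt; rewrite distrC ger0_norm// ger0_norm ?subr_ge0.
  move/le_trans; apply.
  apply: (@le_trans _ _ ((C + 1) * `|t - t'|)); first by rewrite ler_wpM2r// lerDl.
  rewrite mulrC -ler_pdivlMr//; near: t'.
  apply/nbhs_ballP; exists (e / (C + 1)) => [|x]; first exact: divr_gt0.
  by rewrite /ball/= => /ltW.
have m1 : m (- r - 1) = rmass phi.
  apply/eqP; rewrite -eqe fineK// -int_nu; apply/eqP; rewrite /I integral_mkcond.
  apply: eq_integral => y _; rewrite patchE; case: ifPn => //; rewrite notin_setE/= in_itv/= andbT => h.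
  by rewrite nur//; move/negP: h; rewrite -leNgt => h; rewrite ltr0_norm; lra.
have m2 : m r = 0.
  apply/eqP; rewrite -eqe fineK//; apply/eqP; apply: integral0_eq => y /=; rewrite in_itv/= andbT => h.
  by rewrite nur// (lt_le_trans h)// ler_norm.
have M0 := rmass_ge0 phi.
have [|||t _ mt] := @IVT R m (- r - 1) r (rmass phi / 2).
- lra.
- exact: continuous_subspaceT.
- rewrite m1 m2; rewrite minEle maxEle; case: ifPn => h; apply/andP; split; lra.
exists t; rewrite half_mass_vtrans// -mt fineK//.
Unshelve. all: by end_near. Qed.

#[local] Opaque vtrans Lpow.

(** Equal masses are what allows the inequalities of the two halves to be added: they share the
    factor [(m / 2) ^ s], and the Dirichlet integrals add up. The hypothesis concerns test functions
    only, so that it can also be supplied by a terminal edge. *)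
Lemma bisect (k : R) : 0 <= k ->
  (forall psi : X -> R, Cc psi -> gn half k psi (fun i => partial i psi)) ->
  forall phi : X -> R, Cc phi -> gn setT (k / 2 `^ s) phi (fun i => partial i phi).
Proof.
move=> k0 Hk phi cphi; have [t mt] := bisect_mass cphi.
have c1 := Cc_vtrans t cphi; have c2 := Cc_refl 0 c1.
have mphi := Cc_measurable cphi; have mpsi := Cc_measurable c1.
have M0 := rmass_ge0 phi.
have p2 : 0 < 2 `^ s :> R by rewrite powR_gt0.
have A1 := Hk _ c1; have A2 := Hk _ c2.
have M1 : Lpow half 2 (vtrans t phi) = (rmass phi / 2)%:E by rewrite Lpow2E.
have M2 : Lpow half 2 (fun z => vtrans t phi (refl 0 z)) = (rmass phi / 2)%:E.
  have := Lpow_split 2 mpsi; rewrite (Lpow_vtrans t 2 mphi) M1 Lpow2E (rmassE cphi).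
  case: (Lpow half 2 _) => [x| |]//=; rewrite -EFinD => -[h].
  by congr EFin; lra.
have DD := etrans (esym (etrans (dirichlet_vtrans t cphi) (rdirE cphi))) (dirichlet_split c1).
rewrite /gn -(Lpow_vtrans t q mphi) (Lpow_split _ mpsi).
rewrite /gn M1 in A1; rewrite /gn M2 in A2.
apply: (le_trans (leeD A1 A2)); rewrite poweR_EFin.
rewrite -ge0_muleDr; [|by rewrite mule_ge0 ?lee_fin ?powR_ge0 ?dirichlet_ge0..].
rewrite -ge0_muleDl ?dirichlet_ge0// -DD (rdirE cphi) Lpow2E (rmassE cphi) poweR_EFin -!EFinM lee_fin.
rewrite powRM ?invr_ge0// -[2^-1](powR_inv1 (ler0n _ 2)) -powRrM mulN1r powRN.
by rewrite le_eqVlt; apply/orP; left; apply/eqP; ring.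
Qed.

Lemma K_domain_half_ge (k : R) : 0 <= k -> (K_domain half <= k%:E)%E ->
  (K_domain [set: X] <= (k / 2 `^ s)%:E)%E.
Proof.
move=> k0 Kk; apply: K_setT_le_Cc; first by rewrite divr_ge0// powR_ge0.
apply: bisect => // psi cpsi; apply: (K_domain_gn (@measurable_half R N) k0 Kk).
by apply: H1_Cc => //; exact: measurable_half.
Qed.

Lemma gn_glue (k : R) u1 g1 u2 g2 : 0 <= k -> (K_domain [set: X] <= k%:E)%E ->
  H1 half u1 g1 -> H1 half u2 g2 ->
  (forall phi, Cc phi -> bdry half u1 g1 phi = bdry half u2 g2 (fun z => phi (refl 0 z))) ->
  (Lpow half q u1 + Lpow half q u2 <=
   k%:E * ((dirichlet half g1 + dirichlet half g2) * (Lpow half 2 u1 + Lpow half 2 u2) `^ s))%E.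
Proof.
move=> k0 Kk h1 h2 hB; have := K_domain_gn measurableT k0 Kk (H1_glue h1 h2 hB).
have [[m1 _] G1] := h1; have [[m2 _] G2] := h2.
have q0 : q != 0 by rewrite gt_eqF// two_star_gt0.
have p2 : 2 != 0 :> R by rewrite pnatr_eq0.
have mg1 i : measurable_fun half (g1 i) by have [[]] := G1 i.
have mg2 i : measurable_fun half (g2 i) by have [[]] := G2 i.
by rewrite /gn (Lpow_glue q0 m1 m2) (Lpow_glue p2 m1 m2) (dirichlet_glue mg1 mg2).
Qed.

Lemma K_domain_half_le (k : R) : 0 <= k -> (K_domain [set: X] <= k%:E)%E ->
  (K_domain half <= (2 `^ s * k)%:E)%E.
Proof.
move=> k0 Kk; apply: K_domain_le; first exact: measurable_half.
  by rewrite mulr_ge0// powR_ge0.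
move=> u g h; have := gn_glue k0 Kk h h (fun phi cphi => bdry_even h cphi).
have [f1 f2] := H1_fin h; rewrite /gn -(fineK f1) -(fineK f2) -!EFinD !poweR_EFin -!EFinM.
set D := fine _; set M := fine _.
have M0 : 0 <= M by rewrite fine_ge0// Lpow_ge0.
have -> : M + M = 2 * M by ring.
rewrite powRM//; case: (Lpow half q u) => [x| |]//; last by move=> _; rewrite leNye.
rewrite -?EFinD ?lee_fin => H.
by rewrite -(ler_pM2l (ltr0n _ 2)); move: H; congr (_ <= _); ring.
Qed.

End halves.

(** * Upper bounds on graphs *)

Section pairing.
Context {R : realType} (n : nat).
Local Notation X := 'rV[R]_n.
Local Notation mu := (leb R n).
Variable (D : set X).
Hypothesis mD : measurable D.
Implicit Types (f psi : X -> R).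

Lemma mulr_le_young (t a b : R) : 0 < t -> `|a * b| <= t * a ^+ 2 + t^-1 * b ^+ 2.
Proof.
move=> t0; have t1 : 0 < t^-1 by rewrite invr_gt0.
rewrite normrM -(real_normK (num_real a)) -(real_normK (num_real b)).
have : 0 <= `|a| by []. have : 0 <= `|b| by [].
move: `|a| `|b| => x y y0 x0; rewrite -subr_ge0.
rewrite (_ : _ - _ = t^-1 * ((t * x - y) ^+ 2 + t * (x * y))); last by field; rewrite gt_eqF.
by rewrite mulr_ge0 ?(ltW t1)// addr_ge0 ?sqr_ge0// !mulr_ge0// ltW.
Qed.

Lemma L2_sub f psi : L2 D f -> L2 D psi -> L2 D (fun z => f z - psi z).
Proof.
move=> Lf Lp; have n1 (z : X) : D z -> `|-1 : R| <= 1 by rewrite normrN1.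
have := L2D mD Lf (@L2_mulb _ _ D psi (fun=> -1) 1 mD (measurable_cst _) n1 Lp).
by under [X in L2 D X -> _]eq_fun do rewrite mulN1r.
Qed.

(** A weighted Young inequality in place of Cauchy-Schwarz avoids square roots of extended reals;
    [L2_pair_cvg] chooses the weight. *)
Lemma Rintegral_pair_le (t : R) f psi : 0 < t -> L2 D f -> L2 D psi ->
  `|\int[mu]_(z in D) (f z * psi z)| <= t * fine (sqint mu D f) + t^-1 * fine (sqint mu D psi).
Proof.
move=> t0 Lf Lp; have t1 : 0 < t^-1 by rewrite invr_gt0.
have /L2P[mf f2] := Lf; have /L2P[mp p2] := Lp.
have i0 := L2_integrableM mD Lf Lp.
have i1 := integrable_sq mD mf f2; have i2 := integrable_sq mD mp p2.
apply: (le_trans (le_normr_Rintegral mD i0)).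
rewrite -[fine (sqint mu D f)]/(\int[mu]_(z in D) (f z ^+ 2)) -[fine (sqint mu D psi)]/(\int[mu]_(z in D) (psi z ^+ 2)).
have j1 : mu.-integrable D (EFin \o (fun z => t * f z ^+ 2)).
  by apply: (integrable_mulb (M := `|t|)).
have j2 : mu.-integrable D (EFin \o (fun z => t^-1 * psi z ^+ 2)).
  by apply: (integrable_mulb (M := `|t^-1|)).
rewrite -RintegralZl// -RintegralZl// -RintegralD//.
apply: le_Rintegral => //.
- exact: (integrable_abse i0).
- exact: integrableD_fin.
- by move=> z _; exact: mulr_le_young.
Qed.

Lemma L2_pair_cvg (f_ : nat -> X -> R) f psi : (forall k, L2 D (f_ k)) -> L2 D f -> L2 D psi ->
  sqint mu D (fun z => f_ k z - f z) @[k --> \oo] --> 0%E ->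
  (fun k => \int[mu]_(z in D) (f_ k z * psi z)) @ \oo --> \int[mu]_(z in D) (f z * psi z).
Proof.
move=> Lf_ Lf Lp f0; apply/cvgrPdist_le => e e0.
pose P := fine (sqint mu D psi) + 1.
have P0 : 0 <= fine (sqint mu D psi) by rewrite fine_ge0// sqint_ge0.
have P1 : 0 < P by rewrite ltr_wpDl.
(* With this weight each of the two terms is at most [e / 2]. *)
pose t := 2 * P / e.
have t0 : 0 < t by rewrite divr_gt0// mulr_gt0.
have et : (0 < (e / (2 * t))%:E)%E by rewrite lte_fin divr_gt0// mulr_gt0.
have := cvge_lt f0 et; apply: filterS => k hk.
have Lfk := L2_sub (Lf_ k) Lf.
have i1 := L2_integrableM mD Lf Lp; have i2 := L2_integrableM mD (Lf_ k) Lp.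
rewrite distrC -RintegralB//.
rewrite (_ : \int[mu]_(z in D) _ = \int[mu]_(z in D) ((f_ k z - f z) * psi z)); last first.
  by apply: eq_Rintegral => z _; rewrite mulrBl.
apply: (le_trans (Rintegral_pair_le t0 Lfk Lp)).
have F : fine (sqint mu D (fun z => f_ k z - f z)) <= e / (2 * t).
  by rewrite -lee_fin fineK ?ltW// ge0_fin_numE ?sqint_ge0// (lt_trans hk)// ltry.
apply: (@le_trans _ _ (t * (e / (2 * t)) + t^-1 * P)).
  apply: lerD; first by apply: ler_wpM2l F; exact: ltW.
  by apply: ler_wpM2l; [rewrite invr_ge0 ltW|rewrite lerDl].
rewrite le_eqVlt; apply/orP; left; apply/eqP; rewrite /t; field.
by rewrite gt_eqF// gt_eqF.
Qed.

End pairing.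

(** * Green's formula on a strip and the two ends of an edge *)

Section strips.
Context {R : realType} (N : nat).
Local Notation X := 'rV[R]_N.+1.
Local Notation mu := (leb R N.+1).
Local Notation half := (@half_space R N).
Local Notation strip := (@strip R N).
Implicit Types (D : set X) (u f eta : X -> R) (g : 'I_N.+1 -> X -> R).

Lemma Rintegral_strip_partial (l : R) f : 0 < l -> Cc f -> (forall z : X, l <= z ord0 ord_max -> f z = 0) ->
  \int[mu]_(z in strip l) partial ord_max f z = - \int[leb R N]_x f (rV_rcons (x, 0)).
Proof.
move=> l0 cf fl; have mD := @measurable_strip R N l.
have cdf := Cc_partial ord_max cf.
have icd := integrableS measurableT mD (@subsetT _ _) (Cc_integrable cdf).
have := (integrable_mkcond _ mD).1 icd => ip.
rewrite /Rintegral integral_mkcond leb_fubini'//.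
rewrite -mulN1r -RintegralZl//; last exact: (Cc_integrable (Cc_slice 0 cf)).
rewrite /Rintegral; congr fine; apply: eq_integral => x _.
transitivity (\int[lebesgue_measure]_(y in `]0%R, l[) (partial ord_max f (rV_rcons (x, y)))%:E)%E.
  rewrite [RHS]integral_mkcond; apply: eq_integral => y _; rewrite !patchE.
  have E : (rV_rcons (x, y) \in strip l) = (y \in `]0, l[%classic).
    by apply/idP/idP; rewrite !inE /strip/= last_rcons in_itv.
  by rewrite E.
have cv := @continuous_vslice _ _ _ x (Cc_smooth cdf).
rewrite -(@integral_itv_bndoo _ _ _ _ true false); last first.
  by apply: measurable_funTS; apply/measurable_EFinP; exact: continuous_measurable_fun.
rewrite (FTC2_continuous l0 cv (fun y => is_derive_vslice x y (Cc_smooth cf))).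
by rewrite fl ?last_rcons// sub0r mulN1r.
Qed.

(** For the test functions that define the trace this is the fundamental theorem of calculus on
    vertical lines, and [psi] vanishes at the upper face. Both sides are continuous for the two
    convergences in [is_trace]. *)
Lemma trace_bdry (l : R) u g h psi : 0 < l -> H1 (strip l) u g -> is_trace (strip l) u g 0 h ->
  Cc psi -> (forall z : X, l <= z ord0 ord_max -> psi z = 0) ->
  bdry (strip l) u g psi = - \int[leb R N]_x (h x * psi (rV_rcons (x, 0))).
Proof.
move=> l0 Hu [Lh [phi [cphi p1 p2]]] cpsi psil; have mD := @measurable_strip R N l.
have [Lu Hg] := Hu; have [Lg _] := Hg ord_max.
have cdpsi := Cc_partial ord_max cpsi.
have Lphi k : L2 (strip l) (phi k) := L2_Cc mD (cphi k).
have Ldphi k : L2 (strip l) (partial ord_max (phi k)) := L2_Cc mD (Cc_partial ord_max (cphi k)).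
have Lpsi := L2_Cc mD cpsi; have Ldpsi := L2_Cc mD cdpsi.
have c1 : sqint mu (strip l) (fun z => phi k z - u z) @[k --> \oo] --> 0%E.
  apply: (squeeze_cvge _ (@cvg_cst _ 0%E _ \oo _) p1); apply: nearW => k.
  by rewrite sqint_ge0/= /H1dist2 -Lpow2E leeDl// dirichlet_ge0.
have c2 : sqint mu (strip l) (fun z => partial ord_max (phi k) z - g ord_max z) @[k --> \oo] --> 0%E.
  apply: (squeeze_cvge _ (@cvg_cst _ 0%E _ \oo _) p1); apply: nearW => k.
  rewrite sqint_ge0/= /H1dist2 -Lpow2E /dirichlet (bigD1 ord_max)//= addeCA leeDl//.
  by rewrite adde_ge0 ?Lpow_ge0//; apply: sume_ge0 => i _; exact: Lpow_ge0.
have d1 := L2_pair_cvg mD Lphi Lu Ldpsi c1.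
have d2 := L2_pair_cvg mD Ldphi Lg Lpsi c2.
have p2' : sqint (leb R N) setT (fun x => phi k (rV_rcons (x, 0)) - h x) @[k --> \oo] --> 0%E.
  by under eq_fun do rewrite -Lpow2E.
have d3 := L2_pair_cvg measurableT (fun k => L2_Cc measurableT (Cc_slice 0 (cphi k))) Lh (L2_Cc measurableT (Cc_slice 0 cpsi)) p2'.
have E k : \int[mu]_(z in strip l) (phi k z * partial ord_max psi z) + \int[mu]_(z in strip l) (partial ord_max (phi k) z * psi z) =
   - \int[leb R N]_x (phi k (rV_rcons (x, 0)) * psi (rV_rcons (x, 0))).
  have cpp : Cc (fun z => phi k z * psi z) by exact: CcM (cphi k) (Cc_smooth cpsi).
  rewrite -(@Rintegral_strip_partial l (fun z => phi k z * psi z))//; last first.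
    by move=> z lz; rewrite psil// mulr0.
  have i1 := L2_integrableM mD (Lphi k) Ldpsi; have i2 := L2_integrableM mD (Ldphi k) Lpsi.
  rewrite -RintegralD//; apply: eq_Rintegral => z _.
  by rewrite (partialM _ (Cc_smooth (cphi k)) (Cc_smooth cpsi)) [in RHS](mulrC (psi z)).
have d12 : (fun k => - \int[leb R N]_x (phi k (rV_rcons (x, 0)) * psi (rV_rcons (x, 0)))) @ \oo -->
    \int[mu]_(z in strip l) (u z * partial ord_max psi z) + \int[mu]_(z in strip l) (g ord_max z * psi z).
  by rewrite -(funext E); exact: cvgD d1 d2.
have i1 := L2_integrableM mD Lu Ldpsi; have i2 := L2_integrableM mD Lg Lpsi.
rewrite /bdry RintegralD//.
exact: (cvg_unique (@Rhausdorff R) d12 (cvgN d3)).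
Qed.

Definition prodg eta u g : 'I_N.+1 -> X -> R := fun i z => eta z * g i z + partial i eta z * u z.

Record cutoff (M : R) (eta : X -> R) : Prop := Cutoff {
  cutoff_smooth : smooth eta;
  cutoff_bound : forall z, `|eta z| <= M;
  cutoff_dbound : forall i z, `|partial i eta z| <= M }.

(** The gap between [l'] and [l] keeps the closed support of the product inside the open strip. *)
Lemma cutoff_fsupport (l l' : R) eta phi : l' < l -> (forall z : X, l' <= z ord0 ord_max -> eta z = 0) ->
  fsupport phi `<=` half -> fsupport (fun z => phi z * eta z) `<=` strip l.
Proof.
move=> ll e0 sphi z hz; rewrite /Defs.strip/=; apply/andP; split.
  by apply: sphi; apply: closureS hz => w /=; apply: contraNN => /eqP ->; rewrite mul0r.
have cl : closed [set z : X | z ord0 ord_max <= l'].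
  rewrite (_ : [set _ | _] = (fun z : X => z ord0 ord_max) @^-1` [set y | y <= l'])//.
  apply: closed_comp; last exact: closed_le.
  by move=> w _; exact: coord_continuous.
have : closure [set z | phi z * eta z != 0] `<=` [set z : X | z ord0 ord_max <= l'].
  rewrite [X in _ `<=` X](closure_id _).1//; apply: closureS => w /= hw.
  rewrite leNgt; apply/negP => wk; move/eqP: hw; apply; rewrite e0 ?mulr0//; exact: ltW.
by move=> /(_ _ hz) /=; move/le_lt_trans; apply.
Qed.

(** [eta] vanishes near the far end, so the extension by zero stays in H^1 of the half-space. It is
    1 on [y = 0], so Green's formula still sees the trace of [u] itself. *)
Lemma half_edge0 (l l' M : R) eta u g : 0 < l -> l' < l -> cutoff M eta ->
  (forall z : X, l' <= z ord0 ord_max -> eta z = 0) -> (forall x, eta (rV_rcons (x, 0)) = 1) ->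
  H1 (strip l) u g ->
  exists v w, [/\ H1 half v w,
    forall p, p != 0 -> Lpow half p v = Lpow (strip l) p (fun z => eta z * u z),
    dirichlet half w = dirichlet (strip l) (prodg eta u g) &
    forall h, is_trace (strip l) u g 0 h -> forall phi, Cc phi ->
      bdry half v w phi = - \int[leb R N]_x (h x * phi (rV_rcons (x, 0)))].
Proof.
move=> l0 ll [se eM deM] e0 e1 Hu; have mD := @measurable_strip R N l; have mH := @measurable_half R N.
have sub : strip l `<=` half by move=> z /andP[].
exists ((fun z => eta z * u z) \_ (strip l)), (fun i => (prodg eta u g i) \_ (strip l)); split.
- apply: (H1_cut mD mH sub Hu se eM deM) => phi cphi; exact: cutoff_fsupport ll e0.
- by move=> p p0; rewrite Lpow_patch.
- by apply: eq_bigr => i _; rewrite Lpow_patch// pnatr_eq0.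
move=> h th phi cphi.
have cpe : Cc (fun z => phi z * eta z) by exact: CcM cphi se.
have := trace_bdry l0 Hu th cpe _ => /(_ _)/wrap[].
  move=> z lz; rewrite e0 ?mulr0//; exact: le_trans (ltW ll) lz.
under [X in _ = - X -> _]eq_Rintegral do rewrite e1 mulr1.
move=> <-; rewrite /bdry Rintegral_mkcond [RHS]Rintegral_mkcond; apply: eq_Rintegral => z _.
rewrite !patchE; case: ifPn => zh; case: ifPn => zs; rewrite ?mul0r ?addr0//.
  by rewrite (partialM _ (Cc_smooth cphi) se) /prodg; ring.
by exfalso; move: zh; rewrite (mem_set (sub _ (set_mem zs))).
Qed.

(** The reflection [refl l] brings the far end to [y = 0], so that the two ends of an edge give
    functions on the same half-space. *)
Lemma half_edge1 (l l' M : R) eta u g : 0 < l -> 0 < l' -> cutoff M eta ->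
  (forall z : X, z ord0 ord_max <= l' -> eta z = 0) -> (forall x, eta (rV_rcons (x, l)) = 1) ->
  H1 (strip l) u g ->
  exists v w, [/\ H1 half v w,
    forall p, p != 0 -> Lpow half p v = Lpow (strip l) p (fun z => eta z * u z),
    dirichlet half w = dirichlet (strip l) (prodg eta u g) &
    forall h, is_trace (strip l) u g l h -> forall phi, Cc phi ->
      bdry half v w phi = - \int[leb R N]_x (h x * phi (rV_rcons (x, 0)))].
Proof.
move=> l0 ll [se eM deM] e0 e1 Hu; have mD := @measurable_strip R N l.
have DD z : strip l z <-> strip l (refl l z).
  by rewrite /Defs.strip/= refl_last; split => /andP[h1 h2]; apply/andP; split; lra.
have ce : cutoff M (fun z => eta (refl l z)).
  split; [exact: smooth_affmap|by move=> z; exact: eM|move=> i z].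
  by rewrite (partial_refl _ _ se) normrM rsgn_norm mul1r.
have [|||v [w [h1 h2 h3 h4]]] := half_edge0 l0 (_ : l - l' < l) ce _ _ (H1_refl mD DD Hu).
- by rewrite ltrBlDr ltrDl.
- by move=> z hz; apply: e0; rewrite refl_last; lra.
- by move=> x; rewrite refl_rcons subr0.
have [[mu_ _] Hg] := Hu.
have me : measurable_fun (strip l) eta by apply: measurable_funTS; exact: smooth_measurable.
exists v, w; split; first exact: h1.
- by move=> p p0; rewrite (h2 p p0) -(Lpow_refl mD DD p (measurable_funM me mu_)).
- rewrite h3; apply: eq_bigr => i _; have [[mg _] _] := Hg i.
  have mde : measurable_fun (strip l) (partial i eta).
    by apply: measurable_funTS; apply: smooth_measurable; exact: smooth_partial.
  have mp : measurable_fun (strip l) (prodg eta u g i).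
    by apply: measurable_funD; exact: measurable_funM.
  rewrite -(Lpow_refl mD DD 2 mp) -(Lpow_rsgn (strip l) 2 i (fun z => prodg eta u g i (refl l z))).
  apply: eq_integral => z _; congr (`|_| `^ _)%:E.
  by rewrite /prodg /reflg (partial_refl _ _ se); ring.
move=> h th; apply: h4; rewrite -(subrr l); exact: (is_trace_refl mD DD Hu th).
Qed.

End strips.

(** The intervals []j + 1, j + 2[] are disjoint, so [x] spoils at most one of the terms. *)
Lemma sum_trans_ge1 (R : realType) (n : nat) (x : R) (f : 'I_n -> R) : (forall j, 0 <= f j) ->
  (forall j : 'I_n, ~~ (j.+1%:R < x < j.+2%:R) -> 1 <= f j) -> n%:R - 1 <= \sum_j f j.
Proof.
move=> f0 f1.
have [/existsP[j0 hj0]|/existsPn h] := boolP [exists j : 'I_n, (j.+1%:R < x < j.+2%:R)].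
  rewrite (bigD1 j0)//=.
  have : n%:R - 1 <= \sum_(i < n | i != j0) f i.
    apply: (@le_trans _ _ (\sum_(i < n | i != j0) 1)).
      have n0 : (0 < n)%N by case: (n) j0 {hj0} => // -[].
      rewrite sumr_const (cardC1 j0) card_ord -(prednK n0) /= -natr1 addrK; exact: lexx.
    apply: ler_sum => j jj0; apply: f1; apply/negP => /andP[h1 h2].
    move/andP: hj0 => [h3 h4]; move/eqP: jj0; apply; apply/val_inj => /=.
    have : (j.+1 < j0.+2)%N by rewrite -(ltr_nat R) (lt_trans h1).
    have : (j0.+1 < j.+2)%N by rewrite -(ltr_nat R) (lt_trans h3).
    by rewrite !ltnS => a b; apply/eqP; rewrite eqn_leq a b.
  by move/le_trans; apply; rewrite lerDr.
apply: (@le_trans _ _ (\sum_(j < n) 1)).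
  by rewrite sumr_const card_ord lerBlDr lerDl.
by apply: ler_sum => j _; apply: f1.
Qed.

(** The two pieces are estimated together: [eta ^ 2 + (1 - eta) ^ 2 <= 1] keeps the coefficient of
    [g ^ 2] at [1 + del], where separate bounds would double it. *)
Lemma sqr_prodg_le (R : realType) (del eta g dn u : R) : 0 < del -> 0 <= eta <= 1 ->
  (eta * g + dn * u) ^+ 2 + ((1 - eta) * g + (- dn) * u) ^+ 2 <=
  (1 + del) * g ^+ 2 + 2 * (1 + del^-1) * dn ^+ 2 * u ^+ 2.
Proof.
move=> d0 /andP[e0 e1]; have di : 0 < del^-1 by rewrite invr_gt0.
have h1 := sqr_add_le (eta * g) (dn * u) d0.
have h2 := sqr_add_le ((1 - eta) * g) (- dn * u) d0.
apply: (le_trans (lerD h1 h2)); rewrite !exprMn sqrrN -subr_ge0.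
rewrite (_ : _ - _ = (1 + del) * (2 * (eta * (1 - eta)) * g ^+ 2)); last by ring.
by rewrite mulr_ge0 ?addr_ge0 ?(ltW d0)// mulr_ge0 ?sqr_ge0// !mulr_ge0// subr_ge0.
Qed.

(** * Cutting one edge into two half-edges *)

Section edge.
Context {R : realType} (N : nat).
Local Notation X := 'rV[R]_N.+1.
Local Notation mu := (leb R N.+1).
Local Notation half := (@half_space R N).
Local Notation strip := (@strip R N).
Local Notation q := (two_star R N).
Implicit Types (D : set X) (u f eta : X -> R) (g : 'I_N.+1 -> X -> R).

(* The transition zone is (j + 1) l / (n + 2) < y < (j + 2) l / (n + 2); the
   cutoff keeps the end t of the edge. *)
Definition endcut (n j : nat) (l : R) (t : bool) (z : X) : R :=
  let h := ystep (n.+2%:R / l) (- j.+1%:R) z in if t then h else 1 - h.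

Lemma endcut01 n j l t z : 0 <= endcut n j l t z <= 1.
Proof.
by rewrite /endcut; have /andP[h1 h2] := ystep01 (n.+2%:R / l) (- j.+1%:R) z; case: t; apply/andP; split; lra.
Qed.

Lemma endcutC n j l z : endcut n j l true z = 1 - endcut n j l false z.
Proof. by rewrite /endcut subKr. Qed.

Lemma smooth_endcut n j l t : smooth (endcut n j l t).
Proof.
rewrite /endcut; case: t; first exact: smooth_ystep.
rewrite (_ : (fun z => _) = (fun z => 1 + (-1) * ystep (n.+2%:R / l) (- j.+1%:R) z)); last first.
  by apply/funext => z; rewrite mulN1r.
by apply: smoothD (smooth_cst 1) _; apply: smoothM (smooth_cst (-1)) _; exact: smooth_ystep.
Qed.

Lemma partial_endcut n j l t i z : partial i (endcut n j l t) z =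
  (if t then 1 else -1) * (if ord_max == i then n.+2%:R / l * dsstep (n.+2%:R / l * z ord0 ord_max + - j.+1%:R) else 0).
Proof.
transitivity ((if t then 1 else -1) * partial i (ystep (n.+2%:R / l) (- j.+1%:R)) z); last first.
  by rewrite partial_ystep.
rewrite /endcut; case: t; first by rewrite mul1r.
rewrite (_ : (fun z => _) = (fun z => 1 + (-1) * ystep (n.+2%:R / l) (- j.+1%:R) z)); last first.
  by apply/funext => w; rewrite mulN1r.
have sy := @smooth_ystep R N (n.+2%:R / l) (- j.+1%:R).
rewrite (partialD _ (smooth_cst 1) (smoothM (smooth_cst (-1)) sy)) partial_cst add0r.
by rewrite (partialM _ (smooth_cst (-1)) sy) partial_cst mulr0 addr0.
Qed.

Lemma partial_endcut_le (M : R) n j l t i z : 0 < l -> (forall x : R, `|dsstep x| <= M) -> 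
  `|partial i (endcut n j l t) z| <= n.+2%:R / l * M.
Proof.
move=> l0 hM; have a0 : 0 <= n.+2%:R / l by rewrite divr_ge0// ltW.
have M0 : 0 <= M by exact: le_trans (hM 0).
rewrite partial_endcut normrM (_ : `|if t then 1 else -1| = 1) ?mul1r; last by case: t; rewrite ?normrN1 ?normr1.
case: ifP => _; last by rewrite normr0 mulr_ge0.
by rewrite normrM (ger0_norm a0) ler_wpM2l.
Qed.

Lemma cutoff_endcut n j l t : 0 < l -> exists M, cutoff M (endcut n j l t).
Proof.
move=> l0; have [M M0 hM] := @dsstep_bounded R.
have a0 : 0 <= n.+2%:R / l * M by rewrite mulr_ge0// divr_ge0// ltW.
exists (1 + n.+2%:R / l * M); split; first exact: smooth_endcut.
  by move=> z; have /andP[h1 h2] := endcut01 n j l t z; rewrite ger0_norm//; lra.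
by move=> i z; apply: (le_trans (partial_endcut_le n j t i z l0 hM)); lra.
Qed.

Lemma half_edge n j l t u g : 0 < l -> (j < n)%N -> H1 (strip l) u g ->
  exists v w, [/\ H1 half v w,
    forall p, p != 0 -> Lpow half p v = Lpow (strip l) p (fun z => endcut n j l t z * u z),
    dirichlet half w = dirichlet (strip l) (prodg (endcut n j l t) u g) &
    forall h, is_trace (strip l) u g (if t then l else 0) h -> forall phi, Cc phi ->
      bdry half v w phi = - \int[leb R N]_x (h x * phi (rV_rcons (x, 0)))].
Proof.
move=> l0 jn Hu; have [M cM] := cutoff_endcut n j t l0.
have n0 : 0 < n.+2%:R :> R by rewrite ltr0n.
have nz := gt_eqF n0; have lz := gt_eqF l0.
have jn1 : j.+2%:R < n.+2%:R :> R by rewrite ltr_nat !ltnS.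
have jS : j.+2%:R = j.+1%:R + 1 :> R by rewrite natr1.
have j0 : 0 < j.+1%:R :> R by rewrite ltr0n.
case: t cM => cM.
  apply: (@half_edge1 _ _ _ (l * (j.+1%:R / n.+2%:R)) M) => //.
  - by rewrite mulr_gt0// divr_gt0.
  - move=> z hz; rewrite /endcut /ystep sstep0//.
    rewrite subr_le0 mulrAC ler_pdivrMr// mulrC -ler_pdivlMr//.
    by rewrite (_ : j.+1%:R * l / n.+2%:R = l * (j.+1%:R / n.+2%:R))//; ring.
  - move=> x; rewrite /endcut /ystep sstep1// last_rcons divfK ?lz//; lra.
apply: (@half_edge0 _ _ _ (l * (j.+2%:R / n.+2%:R)) M) => //.
- by rewrite -[ltRHS]mulr1 ltr_pM2l// ltr_pdivrMr// mul1r.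
- move=> z hz; rewrite /endcut /ystep sstep1 ?subrr//.
  rewrite lerBrDr addrC -jS mulrAC ler_pdivlMr// [leRHS]mulrC -ler_pdivrMr//.
  by rewrite (_ : j.+2%:R * l / n.+2%:R = l * (j.+2%:R / n.+2%:R))//; ring.
- by move=> x; rewrite /endcut /ystep sstep0 ?subr0// last_rcons mulr0; lra.
Qed.

Section estimates.
Variables (l : R) (l0 : 0 < l) (u : X -> R) (g : 'I_N.+1 -> X -> R) (Hu : H1 (strip l) u g).
Variables (n : nat).

Let mD := @measurable_strip R N l.
Let mS : measurable_fun (strip l) u. Proof. by case: Hu => -[]. Qed.
Let mgS i : measurable_fun (strip l) (g i). Proof. by case: Hu => _ /(_ i) [[]]. Qed.

Let me j t : measurable_fun (strip l) (endcut n j l t).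
Proof. by apply: measurable_funTS; apply: smooth_measurable; exact: smooth_endcut. Qed.

Let mp j t i : measurable_fun (strip l) (prodg (endcut n j l t) u g i).
Proof.
apply: measurable_funD; apply: measurable_funM; [exact: me|exact: mgS| |exact: mS].
by apply: measurable_funTS; apply: smooth_measurable; apply: smooth_partial; exact: smooth_endcut.
Qed.

Lemma endcut_mass j : (Lpow (strip l) 2 (fun z => (endcut n j l false z * u z)%R) +
  Lpow (strip l) 2 (fun z => (endcut n j l true z * u z)%R) <= Lpow (strip l) 2 u)%E.
Proof.
rewrite !Lpow2E /sqint -ge0_integralD_fin//; last 4 first.
- by apply: measurable_sqr; exact: measurable_funM.
- by apply: measurable_sqr; exact: measurable_funM.
- by move=> z _; exact: sqr_ge0.
- by move=> z _; exact: sqr_ge0.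
apply: ge0_le_integral_fin => //.
- by apply: measurable_funD; apply: measurable_sqr; exact: measurable_funM.
- exact: measurable_sqr.
- by move=> z _; rewrite addr_ge0// sqr_ge0.
move=> z _; rewrite endcutC; have /andP[h1 h2] := endcut01 n j l false z.
move: (endcut _ _ _ _ _) h1 h2 => e h1 h2; rewrite !exprMn -mulrDl ler_piMl ?sqr_ge0//.
have : 0 <= e * (1 - e) by rewrite mulr_ge0// subr_ge0.
nra.
Qed.

(** The transition zone has width [l / (n + 2)], hence the slope [(n + 2) M / l]. The factor [N.+1]
    counts the directions, all bounded in the same way. *)
Lemma endcut_dirichlet (del M : R) j : 0 < del -> (forall x : R, `|dsstep x| <= M) ->
  (dirichlet (strip l) (prodg (endcut n j l false) u g) + dirichlet (strip l) (prodg (endcut n j l true) u g) <=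
  (1 + del)%:E * dirichlet (strip l) g +
  (N.+1%:R * (2 * (1 + del^-1) * (n.+2%:R / l * M) ^+ 2))%:E * Lpow (strip l) 2 u)%E.
Proof.
move=> d0 hM; pose c := 2 * (1 + del^-1) * (n.+2%:R / l * M) ^+ 2.
have di : 0 < del^-1 by rewrite invr_gt0.
have c0 : 0 <= c by rewrite mulr_ge0 ?sqr_ge0// mulr_ge0// addr_ge0// ltW.
have d1 : 0 <= 1 + del by rewrite addr_ge0// ltW.
have -> : ((N.+1%:R * c)%:E * Lpow (strip l) 2 u = \sum_(i < N.+1) (c%:E * Lpow (strip l) 2 u))%E.
  have [f1 _] := H1_fin Hu; rewrite -(fineK f1) -EFinM sumEFin sumr_const card_ord.
  by congr EFin; rewrite -[RHS]mulr_natl mulrA.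
rewrite /dirichlet ge0_sume_distrr; last by move=> i _; exact: Lpow_ge0.
rewrite -!big_split/=; apply: lee_sum => i _.
rewrite !Lpow2E /sqint -!ge0_integralZl_fin//; do ?[exact: measurable_sqr|by move=> z _; exact: sqr_ge0].
rewrite -!ge0_integralD_fin//; do ?[exact: measurable_sqr|by move=> z _; exact: sqr_ge0|
  by move=> z _; rewrite mulr_ge0// sqr_ge0|by apply: measurable_funM => //; exact: measurable_sqr].
apply: ge0_le_integral_fin => //.
- by apply: measurable_funD; exact: measurable_sqr.
- by apply: measurable_funD; apply: measurable_funM => //; exact: measurable_sqr.
- by move=> z _; rewrite addr_ge0// sqr_ge0.
move=> z _; have eM := partial_endcut_le n j true i z l0 hM.
have dn : partial i (endcut n j l false) z = - partial i (endcut n j l true) z.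
  by rewrite !partial_endcut; ring.
rewrite /prodg dn addrC (_ : endcut n j l false z = 1 - endcut n j l true z); last by rewrite endcutC subKr.
apply: (le_trans (sqr_prodg_le _ _ _ d0 (endcut01 n j l true z))).
rewrite lerD2l; apply: ler_wpM2r; first exact: sqr_ge0.
apply: ler_wpM2l; first by rewrite mulr_ge0// addr_ge0// ltW.
rewrite -(real_normK (num_real (partial _ _ _))) ler_sqr ?nnegrE//; exact: le_trans eM.
Qed.

(** Outside the transition zone one of the two cutoffs equals 1, and a point lies in at most one of
    the [n] zones. Summed over the positions, the pieces recover the integrand at least [n - 1]
    times. *)
Lemma endcut_Lq : ((n%:R - 1)%:E * Lpow (strip l) q u <=
  \sum_(j < n) (Lpow (strip l) q (fun z => (endcut n j l false z * u z)%R) +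
    Lpow (strip l) q (fun z => (endcut n j l true z * u z)%R)))%E.
Proof.
have [n0|n0] := posnP n.
  rewrite n0 big_ord0 sub0r EFinN mulNe mul1e oppe_le0; exact: Lpow_ge0.
have mq j t : measurable_fun (strip l) (fun z => `|endcut n j l t z * u z| `^ q).
  by apply: measurable_powR_comp; apply: measurableT_comp => //; exact: measurable_funM.
have mq' j : measurable_fun (strip l) (fun z => `|endcut n j l false z * u z| `^ q + `|endcut n j l true z * u z| `^ q).
  by apply: measurable_funD; exact: mq.
have nn : 0 <= n%:R - 1 :> R by rewrite subr_ge0 ler1n.
have -> : (\sum_(j < n) (Lpow (strip l) q (fun z => (endcut n j l false z * u z)%R) +
    Lpow (strip l) q (fun z => (endcut n j l true z * u z)%R)) =
  \int[mu]_(z in strip l) (\sum_(j < n) (`|endcut n j l false z * u z| `^ q + `|endcut n j l true z * u z| `^ q)%R)%:E)%E.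
  under eq_bigr do rewrite /Lpow -(ge0_integralD_fin mu mD (mq _ _) (mq _ _) (fun z _ => powR_ge0 _ _) (fun z _ => powR_ge0 _ _)).
  rewrite -ge0_integral_sum//; last by move=> j; apply/measurable_EFinP; exact: mq'.
  by apply: eq_integral => z _; rewrite sumEFin.
rewrite /Lpow -ge0_integralZl_fin//; last by apply: measurable_powR_comp; exact: measurableT_comp.
apply: ge0_le_integral_fin => //.
- apply: measurable_funM => //; apply: measurable_powR_comp; exact: measurableT_comp.
- by apply: measurable_sum => j; exact: mq'.
- by move=> z _; rewrite mulr_ge0// powR_ge0.
move=> z _.
have E j t : `|endcut n j l t z * u z| `^ q = `|endcut n j l t z| `^ q * `|u z| `^ q.
  by move: (endcut n j l t z) => e; rewrite normrM powRM.
under eq_bigr do rewrite !E -mulrDl.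
rewrite -mulr_suml; apply: ler_wpM2r; first exact: powR_ge0.
apply: (@sum_trans_ge1 _ _ (n.+2%:R / l * z ord0 ord_max)) => j.
  by rewrite addr_ge0// powR_ge0.
rewrite negb_and -!leNgt => /orP[h|h].
- have -> : endcut n j l false z = 1 by rewrite /endcut /ystep sstep0 ?subr0// subr_le0.
  by rewrite normr1 powR1 lerDl powR_ge0.
- have -> : endcut n j l true z = 1 by rewrite /endcut /ystep sstep1// lerBrDr addrC natr1.
  by rewrite normr1 powR1 lerDr powR_ge0.
Qed.

End estimates.

End edge.

Lemma lee_dbl (R : realType) (x y : \bar R) : (x + x <= y + y)%E -> (x <= y)%E.
Proof.
case: x => [x| |]; case: y => [y| |]//; rewrite ?leey ?leNye//.
by rewrite -!EFinD !lee_fin; lra.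
Qed.

Lemma lee_poweR (R : realType) (x y : \bar R) (r : R) : (0 <= x)%E -> (x <= y)%E -> 0 <= r -> (x `^ r <= y `^ r)%E.
Proof.
move=> x0 xy r0; apply: gt0_ler_poweR => //.
- by rewrite in_itv/= x0 leey.
- by rewrite in_itv/= (le_trans x0 xy) leey.
Qed.

Lemma lee_sum1 (R : realType) (I : finType) (F : I -> \bar R) (i : I) : (forall i, (0 <= F i)%E) ->
  (F i <= \sum_i F i)%E.
Proof. by move=> F0; rewrite (bigD1 i)//= leeDl// sume_ge0. Qed.

Lemma lee_sum2 (R : realType) (I : finType) (F : I -> \bar R) (i j : I) : (forall i, (0 <= F i)%E) ->
  j != i -> (F i + F j <= \sum_i F i)%E.
Proof. by move=> F0 ji; rewrite (bigD1 i)//= (bigD1 j)//= addeA leeDl// sume_ge0. Qed.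

Lemma sum_add_inj (R : realType) (I : finType) (F : I -> \bar R) (p : I -> I) : injective p ->
  (\sum_i (F i + F (p i)) = \sum_i F i + \sum_i F i)%E.
Proof. by move=> pI; rewrite [X in (_ + X)%E](reindex_inj pI) -big_split. Qed.

(** Used with [r = n - 1]: the loss [(r + 1) / r] of the averaging and the loss [1 + eps / 3] on the
    gradient multiply to at most [1 + eps], while [c <= b] absorbs the gradient of the cutoffs into
    the mass term. *)
Lemma upper_algebra (R : realType) (r eps d m b c k P : R) : 0 < eps <= 1 -> 3 / eps <= r ->
  0 <= d -> 0 <= m -> 0 <= c <= b -> 0 <= k -> 0 <= P ->
  (r + 1) * (k * (((1 + eps / 3) * d + c * m) * P)) <= r * (k * (1 + eps) * ((d + b * m) * P)).
Proof.
move=> /andP[e0 e1] hr d0 m0 /andP[c0 cb] k0 P0.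
have h : 3 <= r * eps by rewrite -ler_pdivrMr.
have r0 : 0 <= r by apply: le_trans hr; rewrite divr_ge0// ltW.
have h1 : (r + 1) * (1 + eps / 3) <= r * (1 + eps) by nra.
have h2 : r + 1 <= r * (1 + eps) by nra.
have h3 : (r + 1) * (1 + eps / 3) * d <= r * (1 + eps) * d by apply: ler_wpM2r.
have h4 : (r + 1) * (c * m) <= r * (1 + eps) * (b * m).
  apply: ler_pM => //; [by rewrite addr_ge0|by rewrite mulr_ge0|exact: ler_wpM2r].
have := ler_wpM2l (mulr_ge0 k0 P0) (lerD h3 h4).
by congr (_ <= _); ring.
Qed.

(** * Summation over the half-edges of the graph *)

Section graph_upper.
Context {R : realType} (N : nat) (G : metric_graph R).
Local Notation X := 'rV[R]_N.+1.
Local Notation mu := (leb R N.+1).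
Local Notation half := (@half_space R N).
Local Notation strip := (@strip R N).
Local Notation q := (two_star R N).
Local Notation s := (2 / N.+1%:R : R).
Local Notation E := (gedge G).
Local Notation HE := (gedge G * bool)%type.
Implicit Types (u : E -> X -> R) (g : E -> 'I_N.+1 -> X -> R).

Definition vert (d : HE) : gvertex G := gend d.1 d.2.

Lemma sum_half_edges (F : HE -> \bar R) : (\sum_d F d = \sum_e (F (e, false) + F (e, true)))%E.
Proof.
rewrite -(eq_bigr _ (fun d _ => congr1 F (esym (surjective_pairing d)))).
rewrite -(pair_bigA _ (fun e t => F (e, t)))/=; apply: eq_bigr => e _.
by rewrite big_bool/= addeC.
Qed.

Section pieces.
Variables (n j : nat) (u : E -> X -> R) (g : E -> 'I_N.+1 -> X -> R).

Definition pieceL (p : R) (d : HE) : \bar R :=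
  Lpow (strip (len d.1)) p (fun z => endcut n j (len d.1) d.2 z * u d.1 z).

Definition pieceD (d : HE) : \bar R :=
  dirichlet (strip (len d.1)) (prodg (endcut n j (len d.1) d.2) (u d.1) (g d.1)).

Lemma sum_piece_mass : H1_graph u g -> (\sum_d pieceL 2 d <= Lpow_graph 2 u)%E.
Proof.
move=> [Hu _]; rewrite sum_half_edges; apply: lee_sum => e _; exact: endcut_mass (Hu e) n j.
Qed.

Lemma pieceL_ge0 p d : (0 <= pieceL p d)%E. Proof. exact: Lpow_ge0. Qed.

Lemma pieceD_ge0 d : (0 <= pieceD d)%E. Proof. exact: dirichlet_ge0. Qed.

(** [h] is chosen before [d]: half-edges at one vertex share the function [h (vert d)], and this is
    how continuity at the vertices enters. *)
Lemma half_edges : (j < n)%N -> H1_graph u g -> exists h : gvertex G -> 'rV[R]_N -> R,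
  forall d : HE, exists vw : (X -> R) * ('I_N.+1 -> X -> R), [/\ H1 half vw.1 vw.2,
    forall p, p != 0 -> Lpow half p vw.1 = pieceL p d,
    dirichlet half vw.2 = pieceD d &
    forall phi, Cc phi -> bdry half vw.1 vw.2 phi = - \int[leb R N]_x (h (vert d) x * phi (rV_rcons (x, 0)))].
Proof.
move=> jn [Hu [h th]]; exists h => -[e t].
have [v [w [h1 h2 h3 h4]]] := half_edge t (len_gt0 e) jn (Hu e).
exists (v, w); split; [exact: h1|exact: h2|exact: h3|].
by move=> phi cphi; apply: h4 => //; exact: th.
Qed.

End pieces.

#[local] Opaque pieceL pieceD Lpow Lpow_graph dirichlet half_space.

(** The only form in which the constants of the half-space and of the whole space act on the graph.
    The power [s] bears on the total mass, so that inequalities for single half-edges, or for pairs,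
    can be summed. *)
Definition cut_ineq (k : R) : Prop := forall n j u g, (j < n)%N -> H1_graph u g ->
  (\sum_d pieceL n j u q d <= k%:E * ((\sum_d pieceD n j u g d) * Lpow_graph 2 u `^ s))%E.

Lemma cut_ineq_half (k : R) : 0 <= k -> (K_domain half <= k%:E)%E -> cut_ineq k.
Proof.
move=> k0 Kk n j u g jn Hg; have [h Hh] := half_edges jn Hg.
have s0 : 0 <= s by exact: ltW (sexp_gt0 _).
rewrite ge0_sume_distrl; last by move=> d _; exact: pieceD_ge0.
rewrite ge0_sume_distrr; last by move=> d _; rewrite mule_ge0 ?pieceD_ge0 ?poweR_ge0.
apply: lee_sum => d _; have [[v w] /= [h1 h2 h3 _]] := Hh d.
have := K_domain_gn (@measurable_half R N) k0 Kk h1.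
have q0 : q != 0 by apply: lt0r_neq0; exact: two_star_gt0.
have n20 : 2 != 0 :> R by rewrite pnatr_eq0.
rewrite /gn (h2 _ q0) h3 (h2 _ n20).
move/le_trans; apply; apply: lee_wpmul2l; first by rewrite lee_fin.
apply: lee_wpmul2l; first exact: pieceD_ge0.
apply: lee_poweR s0; first exact: pieceL_ge0.
exact: le_trans (lee_sum1 d (pieceL_ge0 n j u 2)) (sum_piece_mass n j Hg).
Qed.

(** Each [d] is glued to [p d], and the inequalities are summed over all [d]. As [p] is a
    permutation, every half-edge occurs twice on both sides, whatever the parity of the degrees. As
    [p d] differs from [d], the masses of the two glued pieces add up to at most the total mass. *)
Lemma cut_ineq_full (k : R) (p : HE -> HE) : 0 <= k -> (K_domain [set: X] <= k%:E)%E ->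
  injective p -> (forall d, p d != d) -> (forall d, vert (p d) = vert d) -> cut_ineq k.
Proof.
move=> k0 Kk pI pd pv n j u g jn Hg; have [h Hh] := half_edges jn Hg.
have s0 : 0 <= s by exact: ltW (sexp_gt0 _).
have [vw Hvw] := choice Hh.
have pair d : (pieceL n j u q d + pieceL n j u q (p d) <=
    k%:E * ((pieceD n j u g d + pieceD n j u g (p d)) * Lpow_graph 2 u `^ s))%E.
  have [h1 h2 h3 h4] := Hvw d; have [h1' h2' h3' h4'] := Hvw (p d).
  have q0 : q != 0 by apply: lt0r_neq0; exact: two_star_gt0.
  have n20 : 2 != 0 :> R by rewrite pnatr_eq0.
  have comp phi : Cc phi -> bdry half (vw d).1 (vw d).2 phi =
      bdry half (vw (p d)).1 (vw (p d)).2 (fun z => phi (refl 0 z)).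
    move=> cphi; rewrite (h4 _ cphi) (h4' _ (Cc_refl 0 cphi)) pv.
    by congr (- _); apply: eq_Rintegral => x _; rewrite refl_rcons subr0.
  have := gn_glue k0 Kk h1 h1' comp.
  rewrite (h2 _ q0) (h2' _ q0) (h2 _ n20) (h2' _ n20) h3 h3'.
  move/le_trans; apply; apply: lee_wpmul2l; first by rewrite lee_fin.
  apply: lee_wpmul2l; first by rewrite adde_ge0 ?pieceD_ge0.
  apply: lee_poweR s0; first exact: adde_ge0 (pieceL_ge0 _ _ _ _ _) (pieceL_ge0 _ _ _ _ _).
  exact: le_trans (lee_sum2 (pieceL_ge0 n j u 2) (pd d)) (sum_piece_mass n j Hg).
have := @lee_sum _ _ _ _ (index_enum _) xpredT (fun d _ => pair d).
rewrite (sum_add_inj (pieceL n j u q) pI) => H.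
apply: lee_dbl; apply: (le_trans H).
rewrite -ge0_sume_distrr; last first.
  by move=> d _; rewrite !mule_ge0 ?poweR_ge0// adde_ge0 ?pieceD_ge0.
rewrite -ge0_sume_distrl; last by move=> d _; rewrite adde_ge0 ?pieceD_ge0.
rewrite (sum_add_inj (pieceD n j u g) pI).
have SD : (0 <= \sum_d pieceD n j u g d)%E by apply: sume_ge0 => d _; exact: pieceD_ge0.
by rewrite ge0_muleDl// ge0_muleDr// mule_ge0 ?poweR_ge0.
Qed.

#[local] Transparent Lpow_graph pieceL pieceD.

Lemma total_length_gt0 : 0 < total_length G.
Proof.
have /card_gt0P[e _] := gedge_gt0 G.
rewrite /total_length (bigD1 e)//= ltr_pwDl ?len_gt0// sumr_ge0// => e' _.
exact: ltW (len_gt0 _).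
Qed.

Lemma H1_graph_fin u g : H1_graph u g -> Lpow_graph 2 u \is a fin_num /\ dirichlet_graph g \is a fin_num.
Proof.
move=> [Hu _]; split; rewrite sum_fin_num; apply/allP => x /mapP[e _ ->].
- by have [] := H1_fin (Hu e).
- by have [] := H1_fin (Hu e).
Qed.

Lemma Lpow_graph_ge0 p u : (0 <= Lpow_graph p u)%E.
Proof. by apply: sume_ge0 => e _; exact: Lpow_ge0. Qed.

Lemma dirichlet_graph_ge0 g : (0 <= dirichlet_graph g)%E.
Proof. by apply: sume_ge0 => e _; exact: dirichlet_ge0. Qed.

Lemma K_graph_le_of_cut (k eps : R) : 0 <= k -> 0 < eps <= 1 -> cut_ineq k ->
  exists2 B0, 0 <= B0 & forall B, B0 <= B -> (K_graph N G B <= (k * (1 + eps))%:E)%E.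
Proof.
move=> k0 e01 Hk; have /andP[e0 e1] := e01.
have [M M0 hM] := @dsstep_bounded R.
pose del := eps / 3; have d0 : 0 < del by rewrite divr_gt0.
(* [n - 1] must be at least [3 / eps] for [upper_algebra], to which [del = eps / 3] is also
   adapted. *)
pose n := (Num.truncn (3 / eps)).+2.
have n1 : 3 / eps <= n%:R - 1.
  have -> : n%:R - 1 = (Num.truncn (3 / eps)).+1%:R :> R by rewrite /n -[X in X - 1]natr1 addrK.
  exact: ltW (truncnS_gt _).
have nn : n%:R = (n%:R - 1) + 1 :> R by rewrite subrK.
have r0 : 0 < n%:R - 1 :> R by apply: lt_le_trans n1; rewrite divr_gt0.
pose C (e : E) := N.+1%:R * (2 * (1 + del^-1) * (n.+2%:R / len e * M) ^+ 2) : R.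
have d2 : 0 <= 1 + del^-1 by rewrite addr_ge0// invr_ge0 ltW.
have C0 (e : E) : 0 <= C e := mulr_ge0 (ler0n _ _) (mulr_ge0 (mulr_ge0 (ler0n _ 2) d2) (sqr_ge0 _)).
(* One constant for all the edges; the sum stands in for the maximum. *)
pose c := \sum_(e : E) C e.
have c0 : 0 <= c by exact: sumr_ge0.
have Cc_ (e : E) : C e <= c by rewrite /c (bigD1 e)//= lerDl sumr_ge0.
(* From this [B] on, [c] is at most the coefficient [B / total_length G ^+ 2] of the mass, which
   absorbs the cost of the cutoffs. *)
exists (c * total_length G ^+ 2); first by rewrite mulr_ge0// sqr_ge0.
move=> B hB; apply: ub_ereal_sup => _ [u [g [Hg u0 ->]]].
have [f1 f2] := H1_graph_fin Hg.
rewrite norm_two_star ?Lpow_graph_ge0//.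
pose m := fine (Lpow_graph 2 u); pose d := fine (dirichlet_graph g).
have m0 : 0 <= m by rewrite fine_ge0// Lpow_graph_ge0.
have dd0 : 0 <= d by rewrite fine_ge0// dirichlet_graph_ge0.
pose b := B / total_length G ^+ 2.
have cb : c <= b by rewrite ler_pdivlMr// exprn_gt0// total_length_gt0.
have b0 : 0 <= b := le_trans c0 cb.
have -> : ((dirichlet_graph g + (B / total_length G ^+ 2)%:E * Lpow_graph 2 u) * Lpow_graph 2 u `^ s =
    ((d + b * m) * m `^ s)%:E)%E.
  by rewrite -(fineK f1) -(fineK f2) poweR_EFin.
have P0 : 0 <= m `^ s by exact: powR_ge0.
rewrite ediv_le; last 3 first.
- exact: Lpow_graph_ge0.
- by rewrite mulr_ge0// addr_ge0// mulr_ge0.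
- by rewrite mulr_ge0// addr_ge0// ltW.
have key : ((n%:R - 1)%:E * Lpow_graph q u <= (n%:R * (k * (((1 + del) * d + c * m) * m `^ s)))%:E)%E.
  rewrite /Lpow_graph ge0_sume_distrr; last by move=> e _; exact: Lpow_ge0.
  apply: (@le_trans _ _ (\sum_(e : E) \sum_(j < n) (pieceL n j u q (e, false) + pieceL n j u q (e, true)))%E).
    by apply: lee_sum => e _; exact: (endcut_Lq (proj1 Hg e) n).
  rewrite exchange_big/=.
  apply: (@le_trans _ _ (\sum_(j < n) (k * (((1 + del) * d + c * m) * m `^ s))%:E)%E); last first.
    by rewrite sumEFin sumr_const card_ord lee_fin -[leLHS]mulr_natl.
  apply: lee_sum => j _; rewrite -sum_half_edges.
  apply: (le_trans (Hk _ _ _ _ (ltn_ord j) Hg)).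
  rewrite -(fineK f1) poweR_EFin -/m.
  rewrite EFinM; apply: lee_wpmul2l; first by rewrite lee_fin.
  rewrite EFinM; apply: lee_wpmul2r; first by rewrite lee_fin.
  rewrite sum_half_edges EFinD EFinM EFinM.
  rewrite (fineK f2) (fineK f1) /dirichlet_graph /Lpow_graph.
  rewrite ge0_sume_distrr; last by move=> e _; exact: dirichlet_ge0.
  rewrite ge0_sume_distrr; last by move=> e _; exact: Lpow_ge0.
  rewrite -big_split/=; apply: lee_sum => e _.
  apply: (le_trans (endcut_dirichlet (len_gt0 e) (proj1 Hg e) n j d0 hM)).
  rewrite leeD2l//; apply: lee_wpmul2r; first exact: Lpow_ge0.
  by rewrite lee_fin; exact: Cc_.
have := upper_algebra e01 n1 dd0 m0 _ k0 P0 => /(_ b c).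
rewrite c0 cb -nn -/del => /(_ isT) alg.
rewrite -(@lee_pmul2l _ (n%:R - 1)%:E)//.
by apply: (le_trans key); rewrite -EFinM lee_fin.
Qed.

End graph_upper.

Lemma fine_eq_scale (R : realType) (a : R) (x y : \bar R) : x \is a fin_num ->
  (a%:E * x = y)%E -> a * fine x = fine y.
Proof. by case: x => // x _ <-. Qed.

Lemma fine_eq_scale2 (R : realType) (a b : R) (x y : \bar R) : x \is a fin_num -> y \is a fin_num ->
  (a%:E * x = b%:E * y)%E -> a * fine x = b * fine y.
Proof. by case: x y => [x| |] [y| |]// _ _ []. Qed.

Lemma den_EFin (R : realType) (k b r : R) (D M : \bar R) : D \is a fin_num -> M \is a fin_num ->
  (k%:E * ((D + b%:E * M) * M `^ r) = (k * ((fine D + b * fine M) * fine M `^ r))%:E)%E.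
Proof. by case: D M => [D| |] [M| |]. Qed.

Lemma powR_exp_sexp (R : realType) (N : nat) (lam : R) : 0 <= lam ->
  (lam ^+ N.+1) `^ (2 / N.+1%:R) = lam ^+ 2.
Proof.
by move=> l0; rewrite -powR_mulrn// -powRrM mulrCA mulfV ?pnatr_eq0// mulr1 powR_mulrn.
Qed.

(** With [Lam = lam ^ (N + 1)] and [r = s], the hypothesis [Lam ^ r = lam ^ 2] expresses that the
    exponent is critical: the power of the mass compensates the factor [lam ^ 2] of the Dirichlet
    integral, and the term in [b] is left with [1 / lam ^ 2]. *)
Lemma scale_algebra (R : realType) (lam k d b m df mf r Lam : R) : 0 < lam -> 0 <= mf -> 0 <= Lam ->
  Lam `^ r = lam ^+ 2 -> Lam * mf = m -> Lam * df = lam ^+ 2 * d ->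
  Lam * (k * ((df + b * mf) * mf `^ r)) = k * ((d + b * m / lam ^+ 2) * m `^ r).
Proof.
move=> lam0 mf0 Lam0 hs hm hd; rewrite -{2}hm powRM// hs.
transitivity (k * ((Lam * df + b * (Lam * mf)) * mf `^ r)); first by ring.
by rewrite hd hm; field; rewrite gt_eqF.
Qed.

(** * Lower bounds on graphs *)

Section lower.
Context {R : realType} (N : nat).
Local Notation X := 'rV[R]_N.+1.
Local Notation mu := (leb R N.+1).
Local Notation half := (@half_space R N).
Local Notation strip := (@strip R N).
Local Notation q := (two_star R N).
Local Notation s := (2 / N.+1%:R : R).

Lemma q_neq0 : q != 0.
Proof. by apply: lt0r_neq0; exact: two_star_gt0. Qed.

Lemma two_neq0 : 2 != 0 :> R.
Proof. by rewrite pnatr_eq0. Qed.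

Lemma Lpow0 n (D : set 'rV[R]_n) p : p != 0 -> Lpow D p (fun=> 0) = 0%E.
Proof. by move=> p0; apply: integral0_eq => z _; rewrite normr0 powR0. Qed.

Lemma is_trace_Cc (D : set X) phi y : Cc phi ->
  is_trace D phi (fun i => partial i phi) y (fun x => phi (rV_rcons (x, y))).
Proof.
move=> cphi; split; first exact: (L2_Cc measurableT (Cc_slice y cphi)).
exists (fun=> phi); split => //.
  have -> : (fun _ : nat => H1dist2 D phi (fun i => partial i phi) phi) = fun=> 0%E.
    apply/funext => _; rewrite /H1dist2 /dirichlet big1 ?adde0; last first.
      by move=> i _; rewrite -[RHS](Lpow0 D two_neq0); congr Lpow; apply/funext => z /=; rewrite subrr.
    by rewrite -[RHS](Lpow0 D two_neq0); congr Lpow; apply/funext => z /=; rewrite subrr.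
  exact: cvg_cst.
under eq_fun do under eq_fun do rewrite subrr.
by rewrite (Lpow0 _ two_neq0); exact: cvg_cst.
Qed.

Lemma Lpow_sub_supp (D D' : set X) p f : p != 0 -> D `<=` D' -> (forall z, D' z -> ~ D z -> f z = 0) ->
  Lpow D p f = Lpow D' p f.
Proof.
move=> p0 DD f0; rewrite /Lpow integral_mkcond [RHS]integral_mkcond; apply: eq_integral => z _.
rewrite !patchE; case: ifPn => zD; case: ifPn => zD'//.
- by exfalso; move: zD'; rewrite mem_set//; apply: DD; exact: set_mem.
- by rewrite f0 ?normr0 ?powR0//; [exact: set_mem|move: zD; rewrite notin_setE].
Qed.

Lemma Lpow_half_scale (lam p : R) (f : X -> R) : 0 < lam -> measurable_fun setT f ->
  ((lam ^+ N.+1)%:E * Lpow half p (fun z => f (affmap (fun=> lam) (fun=> 0%R) z)) = Lpow half p f)%E.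
Proof.
move=> l0 mf; have mD := @measurable_half R N.
have mp : measurable_fun setT ((fun z => (`|f z| `^ p)%:E) \_ half).
  apply/(measurable_restrictT _ mD); apply/measurable_EFinP; apply: measurable_funTS.
  by apply: measurable_powR_comp; exact: measurableT_comp.
have p0 z : (0 <= ((fun z => (`|f z| `^ p)%:E) \_ half) z)%E.
  by rewrite patchE; case: ifPn => // _; rewrite lee_fin powR_ge0.
have := ge0_integral_affmap (c := fun=> lam) (fun=> 0) (fun i => lt0r_neq0 l0) mp p0.
rewrite prodr_const card_ord (gtr0_norm l0) => H.
rewrite [RHS]integral_mkcond -H; congr (_ * _)%E; rewrite /Lpow integral_mkcond; apply: eq_integral => z _; rewrite !patchE.
have -> : (affmap (fun=> lam) (fun=> 0%R) z \in half) = (z \in half) => //.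
by apply/idP/idP; rewrite !inE /half_space/= !mxE addr0 pmulr_rgt0.
Qed.

Lemma dirichlet_half_scale (lam : R) (psi : X -> R) : 0 < lam -> Cc psi ->
  ((lam ^+ N.+1)%:E * dirichlet half (fun i => partial i (fun z => psi (affmap (fun=> lam) (fun=> 0%R) z))) =
   (lam ^+ 2)%:E * dirichlet half (fun i => partial i psi))%E.
Proof.
move=> lam0 cpsi; rewrite /dirichlet ge0_sume_distrr; last by move=> i _; exact: Lpow_ge0.
rewrite ge0_sume_distrr; last by move=> i _; exact: Lpow_ge0.
apply: eq_bigr => i _; have mdp := Cc_measurable (Cc_partial i cpsi).
rewrite -(Lpow_half_scale 2 lam0 mdp) (partial_affmap _ _ _ (Cc_smooth cpsi)).
rewrite muleCA; congr (_ * _)%E; have mD := @measurable_half R N.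
rewrite !Lpow2E /sqint -(ge0_integralZl_fin mu mD _ (fun z _ => sqr_ge0 _) (sqr_ge0 lam)).
  by apply: eq_integral => z _; rewrite exprMn.
apply: measurable_funTS; apply: measurable_sqr.
exact: (measurableT_comp mdp (measurable_affmap _ _)).
Qed.

Lemma bsupp_zero_above (r : R) (f : X -> R) (z : X) : bsupp r f -> r < z ord0 ord_max -> f z = 0.
Proof. by move=> bf h; apply: (bf z ord_max); rewrite (lt_le_trans h)// ler_norm. Qed.

Lemma partial_zero_above (l l' : R) (f : X -> R) i : l' < l ->
  (forall z : X, l' < z ord0 ord_max -> f z = 0) -> forall z : X, l <= z ord0 ord_max -> partial i f z = 0.
Proof.
move=> ll f0 z lz; apply: (@fsupport0 _ _ (partial i f)) => /fsupport_partial hz.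
have cl : closed [set z : X | z ord0 ord_max <= l'].
  rewrite (_ : [set _ | _] = (fun z : X => z ord0 ord_max) @^-1` [set y | y <= l'])//.
  apply: closed_comp; last exact: closed_le.
  by move=> w _; exact: coord_continuous.
have : fsupport f `<=` [set z : X | z ord0 ord_max <= l'].
  rewrite [X in _ `<=` X](closure_id _).1//; apply: closureS => w /= hw.
  by rewrite leNgt; apply/negP => wk; move/eqP: hw; apply; exact: f0.
by move=> /(_ _ hz) /= h; move: (le_trans lz h); rewrite leNgt ll.
Qed.

Variable G : metric_graph R.
Local Notation E := (gedge G).

(** [w] is extended by zero to the other edges. It must vanish at the end opposite to [t0] and, as
    soon as another half-edge meets the vertex of [(e0, t0)], at that vertex too; a self-loop is
    included. At a vertex of degree one the second condition is void. *)
Lemma graph_test (e0 : E) (t0 : bool) (w : X -> R) : Cc w ->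
  (forall x, w (rV_rcons (x, if t0 then 0 else len e0)) = 0) ->
  (forall d, d != (e0, t0) -> vert d = gend e0 t0 ->
     forall x, w (rV_rcons (x, if t0 then len e0 else 0)) = 0) ->
  exists u g, [/\ @H1_graph R N G u g, forall p, p != 0 -> Lpow_graph p u = Lpow (strip (len e0)) p w &
    dirichlet_graph g = dirichlet (strip (len e0)) (fun i => partial i w)].
Proof.
move=> cw w0 w1.
pose u (e : E) : X -> R := if e == e0 then w else fun=> 0.
have cu e : Cc (u e) by rewrite /u; case: ifP => _; [exact: cw|exact: Cc0].
exists u, (fun e i => partial i (u e)); split.
- split; first by move=> e; apply: (H1_Cc (measurable_strip _) (cu e)).
  exists (fun v => if v == gend e0 t0 then (fun x => w (rV_rcons (x, if t0 then len e0 else 0))) else fun=> 0) => e t.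
  have H : is_trace (strip (len e)) (u e) (fun i => partial i (u e)) (if t then len e else 0)
     (fun x => u e (rV_rcons (x, if t then len e else 0))) := is_trace_Cc _ _ (cu e).
  rewrite (_ : (if _ then _ else _) = (fun x => u e (rV_rcons (x, if t then len e else 0))))//.
  apply/funext => x; rewrite /u; case: (eqVneq e e0) => [->|ee].
    have [->|tt] := eqVneq t t0; first by rewrite eqxx.
    have -> : (if t then len e0 else 0) = (if t0 then 0 else len e0) by case: (t) (t0) tt => -[].
    rewrite w0; case: eqP => // vv; apply: (w1 (e0, t)) => //.
    by rewrite xpair_eqE eqxx.
  by case: eqP => // vv; apply: (w1 (e, t)) => //; rewrite xpair_eqE (negbTE ee).
- move=> p p0; rewrite /Lpow_graph (bigD1 e0)//= /u eqxx big1 ?adde0// => e /negbTE ->.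
  exact: Lpow0.
- rewrite /dirichlet_graph (bigD1 e0)//= /u eqxx big1 ?adde0// => e /negbTE ->.
  by rewrite /dirichlet big1// => i _; rewrite partial_cst (Lpow0 _ two_neq0).
Qed.

(** The profile [psi] is written on the half-space with the end [t0] at [y = 0]; for [t0 = true] it
    is reflected into the strip. *)
Lemma graph_test_half (e0 : E) (t0 : bool) (l' : R) (psi : X -> R) : Cc psi -> l' < len e0 ->
  (forall z : X, l' < z ord0 ord_max -> psi z = 0) ->
  (forall d, d != (e0, t0) -> vert d = gend e0 t0 -> forall x, psi (rV_rcons (x, 0)) = 0) ->
  exists u g, [/\ @H1_graph R N G u g, forall p, p != 0 -> Lpow_graph p u = Lpow half p psi &
    dirichlet_graph g = dirichlet half (fun i => partial i psi)].
Proof.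
move=> cpsi ll psi0 hv; set l := len e0; have l0 : 0 < l := len_gt0 e0.
have mD := @measurable_strip R N l.
have DD (z : X) : strip l z <-> strip l (refl l z).
  by rewrite /Defs.strip/= refl_last; split => /andP[h1 h2]; apply/andP; split; lra.
have sub : strip l `<=` half by move=> z /andP[].
have out (z : X) : half z -> ~ strip l z -> l <= z ord0 ord_max.
  by rewrite /half_space /Defs.strip/= => -> /negP; rewrite /= -leNgt.
have LS p : p != 0 -> Lpow (strip l) p psi = Lpow half p psi.
  move=> p0; apply: Lpow_sub_supp => // z h1 h2; apply: psi0; exact: lt_le_trans ll (out z h1 h2).
have DS : dirichlet (strip l) (fun i => partial i psi) = dirichlet half (fun i => partial i psi).
  apply: eq_bigr => i _; apply: (Lpow_sub_supp two_neq0 sub) => z h1 h2.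
  exact: (partial_zero_above i ll psi0 (out z h1 h2)).
have mpsi := Cc_measurable cpsi.
case: t0 hv => hv; last first.
  have [||u [g [h1 h2 h3]]] := @graph_test e0 false psi cpsi.
  - by move=> x; apply: psi0; rewrite last_rcons.
  - exact: hv.
  exists u, g; split; [exact: h1|by move=> p p0; rewrite (h2 _ p0) (LS _ p0)|by rewrite h3 DS].
have [||u [g [h1 h2 h3]]] := @graph_test e0 true (fun z => psi (refl l z)) (Cc_refl l cpsi).
- by move=> x; rewrite refl_rcons subr0; apply: psi0; rewrite last_rcons.
- by move=> d d1 d2 x; rewrite refl_rcons subrr; exact: hv d1 d2 x.
exists u, g; split; first exact: h1.
  move=> p p0; rewrite (h2 _ p0) -(LS _ p0); apply: (Lpow_refl mD DD).
  exact: measurable_funTS.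
rewrite h3 -DS; apply: eq_bigr => i _; rewrite (partial_refl _ _ (Cc_smooth cpsi)) Lpow_rsgn.
by apply: (Lpow_refl mD DD); apply: measurable_funTS; apply: Cc_measurable; exact: Cc_partial.
Qed.

Lemma K_graph_gn (B k : R) (u : E -> X -> R) g : 0 <= B -> 0 <= k -> (K_graph N G B <= k%:E)%E -> H1_graph u g ->
  (Lpow_graph q u <= k%:E * ((dirichlet_graph g + (B / total_length G ^+ 2)%:E * Lpow_graph 2 u)
     * Lpow_graph 2 u `^ s))%E.
Proof.
move=> B0 k0 Kk Hg; have [f1 f2] := H1_graph_fin Hg.
have b0 : 0 <= B / total_length G ^+ 2 by rewrite divr_ge0// sqr_ge0.
have [u0|u0] := eqVneq (Lpow_graph 2 u) 0%E.
  have -> : Lpow_graph q u = 0%E.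
    rewrite /Lpow_graph big1// => e _; apply: (Lpow_eq0 (measurable_strip _) _ q_neq0).
      by have [/(_ e) [[]]] := Hg.
    apply/eqP; rewrite eq_le Lpow_ge0 andbT -u0; apply: (@lee_sum1 _ _ (fun e => Lpow (strip (len e)) 2 (u e))).
    by move=> e'; exact: Lpow_ge0.
  by rewrite !mule_ge0 ?lee_fin ?poweR_ge0// adde_ge0 ?dirichlet_graph_ge0// mule_ge0 ?lee_fin ?Lpow_graph_ge0.
have : (Lpow_graph q u / ((dirichlet_graph g + (B / total_length G ^+ 2)%:E * Lpow_graph 2 u) *
   (Lpow_graph 2 u `^ 2^-1) `^ (q - 2)) <= k%:E)%E.
  by apply: le_trans Kk; apply: ereal_sup_ubound; exists u, g.
rewrite norm_two_star ?Lpow_graph_ge0//.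
have -> : ((dirichlet_graph g + (B / total_length G ^+ 2)%:E * Lpow_graph 2 u) * Lpow_graph 2 u `^ s =
  ((fine (dirichlet_graph g) + B / total_length G ^+ 2 * fine (Lpow_graph 2 u)) * fine (Lpow_graph 2 u) `^ s)%:E)%E.
  by rewrite -{1 2}(fineK f1) -{1}(fineK f2) poweR_EFin.
rewrite ediv_le//; first exact: Lpow_graph_ge0.
apply: mulr_ge0 (powR_ge0 _ _).
exact: addr_ge0 (fine_ge0 (dirichlet_graph_ge0 _)) (mulr_ge0 b0 (fine_ge0 (Lpow_graph_ge0 _ _))).
Qed.

Lemma scale_limit (a k d b m P lam0 : R) : 0 <= k -> 0 <= b -> 0 <= m -> 0 <= P ->
  (forall lam, 0 < lam -> lam0 <= lam -> a <= k * ((d + b * m / lam ^+ 2) * P)) -> a <= k * (d * P).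
Proof.
move=> k0 b0 m0 P0 H; apply/ler_addgt0Pr => e e0.
pose c := k * (b * m) * P; have c0 : 0 <= c by rewrite !mulr_ge0.
(* Then [lam >= 1] and [lam >= c / e], so that [c / lam ^ 2 <= e]. *)
pose lam := Num.max lam0 (c / e + 1).
have l1 : c / e + 1 <= lam by rewrite le_max lexx orbT.
have ce : 0 <= c / e by rewrite divr_ge0// ltW.
have l2 : 1 <= lam by apply: le_trans l1; rewrite lerDr.
have l3 : 0 < lam by exact: lt_le_trans l2.
have l4 : lam0 <= lam by rewrite le_max lexx.
apply: (le_trans (H lam l3 l4)).
rewrite (_ : k * _ = k * (d * P) + c / lam ^+ 2); last by rewrite /c; ring.
rewrite lerD2l ler_pdivrMr ?exprn_gt0//.
have : c / e <= lam ^+ 2.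
  apply: (@le_trans _ _ lam); first by apply: le_trans l1; rewrite lerDl.
  by rewrite expr2 ler_peMl// ltW.
by rewrite ler_pdivrMr// mulrC.
Qed.

#[local] Opaque Lpow dirichlet half_space.

(** The dilations of [psi] concentrate at the end [t0], and the term in [B] vanishes as their ratio
    grows. [B] stays fixed: a bound on [K_graph] for a single [B] is enough. *)
Lemma gn_half_of_graph (B k : R) (e0 : E) (t0 : bool) (psi : X -> R) : 0 <= B -> 0 <= k ->
  (K_graph N G B <= k%:E)%E -> Cc psi ->
  (forall d, d != (e0, t0) -> vert d = gend e0 t0 -> forall x, psi (rV_rcons (x, 0)) = 0) ->
  gn half k psi (fun i => partial i psi).
Proof.
move=> B0 k0 Kk cpsi hv.
have mH := @measurable_half R N.
have [f1 f2] := H1_fin (H1_Cc mH cpsi).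
have /CcP[_ [r r0 br]] := cpsi.
set l := len e0; have l0 : 0 < l := len_gt0 e0.
have L0 := total_length_gt0 G.
pose b := B / total_length G ^+ 2.
have b0 : 0 <= b by rewrite divr_ge0// sqr_ge0.
pose m := fine (Lpow half 2 psi); pose d := fine (dirichlet half (fun i => partial i psi)).
have m0 : 0 <= m by rewrite fine_ge0// Lpow_ge0.
have P0 : 0 <= m `^ s by exact: powR_ge0.
have mpsi := Cc_measurable cpsi.
(* [lam >= (r + 1) / l] makes the dilated function vanish above the height [r / lam < l], so that it
   fits into the edge. *)
have key lam : 0 < lam -> (r + 1) / l <= lam -> (Lpow half q psi <= (k * ((d + b * m / lam ^+ 2) * m `^ s))%:E)%E.
  move=> lam0 hlam; pose f z := psi (affmap (fun=> lam) (fun=> 0) z).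
  have lz := lt0r_neq0 lam0.
  have cf : Cc f by apply: Cc_affmap.
  have rl : r / lam < l.
    by rewrite ltr_pdivrMr// -ltr_pdivrMl// mulrC (lt_le_trans _ hlam)// ltr_pM2r ?invr_gt0// ltrDl.
  have f0 (z : X) : r / lam < z ord0 ord_max -> f z = 0.
    rewrite ltr_pdivrMr// => hz; apply: (bsupp_zero_above br); rewrite !mxE addr0 mulrC; exact: hz.
  have fv d' : d' != (e0, t0) -> vert d' = gend e0 t0 -> forall x, f (rV_rcons (x, 0)) = 0.
    by move=> h1 h2 x; rewrite /f affmap_rcons mulr0 addr0; exact: hv h1 h2 _.
  have [u [g [Hg hA hD]]] := graph_test_half cf rl f0 fv.
  have := K_graph_gn B0 k0 Kk Hg; rewrite (hA _ q_neq0) (hA _ two_neq0) hD -/b.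
  have Lam0 : 0 < lam ^+ N.+1 by rewrite exprn_gt0.
  have [g1 g2] := H1_fin (H1_Cc mH cf).
  have EA := Lpow_half_scale q lam0 mpsi.
  have EM := Lpow_half_scale 2 lam0 mpsi.
  have ED := dirichlet_half_scale lam0 cpsi.
  rewrite -/f in EA EM ED.
  pose mf := fine (Lpow half 2 f); pose df := fine (dirichlet half (fun i => partial i f)).
  have EM' : lam ^+ N.+1 * mf = m := fine_eq_scale g1 EM.
  have ED' : lam ^+ N.+1 * df = lam ^+ 2 * d := fine_eq_scale2 g2 f2 ED.
  rewrite (den_EFin k b s g2 g1) -/mf -/df => HH.
  rewrite -EA; apply: (le_trans (lee_wpmul2l _ HH)); first by rewrite lee_fin ltW.
  rewrite -EFinM lee_fin.
  have mf0 : 0 <= mf := fine_ge0 (Lpow_ge0 half 2 f).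
  rewrite le_eqVlt; apply/orP; left; apply/eqP.
  exact: (scale_algebra k b lam0 mf0 (ltW Lam0) (powR_exp_sexp N (ltW lam0)) EM' ED').
(* One admissible ratio already shows finiteness, after which the limit is taken among real
   numbers. *)
have Afin : Lpow half q psi \is a fin_num.
  rewrite ge0_fin_numE ?Lpow_ge0//.
  have lam0 : 0 < (r + 1) / l by rewrite divr_gt0// ltr_wpDl.
  exact: le_lt_trans (key _ lam0 (lexx _)) (ltry _).
rewrite /gn -(fineK f1) -(fineK f2) poweR_EFin -!EFinM -(fineK Afin) lee_fin.
apply: (scale_limit (lam0 := (r + 1) / l) k0 b0 m0 P0) => lam h1 h2.
by rewrite -lee_fin (fineK Afin); exact: key.
Qed.

Lemma K_setT_le_graph (B k : R) : 0 <= B -> 0 <= k -> (K_graph N G B <= k%:E)%E ->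
  (K_domain [set: X] <= k%:E)%E.
Proof.
move=> B0 k0 Kk; apply: K_setT_le_Cc => // phi cphi.
have /card_gt0P[e0 _] := gedge_gt0 G.
have /CcP[_ [r r0 br]] := cphi.
(* The support now lies in [1 <= y <= 2 r + 1]. The function vanishes on [y = 0], so any edge can
   carry it, and its integrals on the half-space are those on the whole space. *)
pose psi := vtrans (- (r + 1)) phi.
have cpsi : Cc psi by exact: Cc_vtrans.
have psi0 (z : X) : z ord0 ord_max <= 0 -> psi z = 0.
  move=> hz; rewrite -(rV_unrconsK z) /psi vtrans_rcons (br _ ord_max)// last_rcons /= ltr0_norm; lra.
have psi1 (z : X) : ~ half z -> psi z = 0.
  by move=> hz; apply: psi0; rewrite leNgt; apply/negP.
have := @gn_half_of_graph B k e0 false psi B0 k0 Kk cpsi _ => /(_ _)/wrap[].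
  by move=> d _ _ x; apply: psi0; rewrite last_rcons.
have mphi := Cc_measurable cphi.
rewrite /gn (Lpow_sub_supp q_neq0 (@subsetT _ half)); last by move=> z _; exact: psi1.
rewrite (Lpow_sub_supp two_neq0 (@subsetT _ half)); last by move=> z _; exact: psi1.
have -> : dirichlet half (fun i => partial i psi) = dirichlet setT (fun i => partial i psi).
  apply: eq_bigr => i _; apply: (Lpow_sub_supp two_neq0 (@subsetT _ _)) => z _ hz.
  rewrite /psi (partial_vtrans _ _ (Cc_smooth cphi)) -(rV_unrconsK z) vtrans_rcons.
  have hz' : z ord0 ord_max <= 0 by rewrite leNgt; exact/negP.
  by apply: (@bsupp_partial _ _ _ _ i br _ ord_max); rewrite last_rcons /= ltr0_norm; lra.
by rewrite /psi (dirichlet_vtrans _ cphi) !Lpow_vtrans.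
Qed.

(** No other half-edge meets a vertex of degree one, so [gn_half_of_graph] applies to test functions
    with arbitrary values on [y = 0]; this is the hypothesis of [bisect]. *)
Lemma K_setT_le_terminal (B k : R) : has_terminal_edge G -> 0 <= B -> 0 <= k -> (K_graph N G B <= k%:E)%E ->
  (K_domain [set: X] <= (k / 2 `^ s)%:E)%E.
Proof.
move=> [e0 [t0 deg1]] B0 k0 Kk; apply: K_setT_le_Cc; first by rewrite divr_ge0// powR_ge0.
apply: bisect => // psi cpsi; apply: (@gn_half_of_graph B k e0 t0) => // d dd dv.
exfalso; move: deg1; rewrite /degree => /eqP/cards1P[d1 Hd1].
have h1 : d \in [set d1]%SET by rewrite -Hd1 inE; apply/eqP.
have h2 : (e0, t0) \in [set d1]%SET by rewrite -Hd1 inE.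
by move: h1 h2 dd; rewrite !inE => /eqP -> /eqP ->; rewrite eqxx.
Qed.

End lower.

(** * Cycles and the limit *)

Section cycles.
Context {R : realType} (G : metric_graph R).
Local Notation HE := (gedge G * bool)%type.

Lemma uniq_map_inj (T1 T2 : eqType) (f : T1 -> T2) (c : seq T1) x y :
  uniq (map f c) -> x \in c -> y \in c -> f x = f y -> x = y.
Proof.
move=> uc xc yc fxy; rewrite -(nth_index x xc) -(nth_index x yc); congr (nth x c _).
apply/eqP; rewrite -(nth_uniq (f x) _ _ uc) ?size_map ?index_mem//.
by rewrite !(nth_map x) ?index_mem// !nth_index// fxy.
Qed.

(** A cycle through the edge leaves or enters the vertex by the neighbouring edge of the cycle,
    [next] or [prev] according to the end. If the cycle is a single self-loop, this neighbour is the
    edge itself and the half-edge found is its other end; the absence of repeated edges excludes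
    [d' = d]. *)
Lemma covered_half_edge : covered_by_cycles G ->
  forall d : HE, exists2 d' : HE, d' != d & vert d' = vert d.
Proof.
move=> cov [e t]; have [c [cc uc]] := cov e; move/mapP => [[e1 t1] d1c /= ee].
subst e1; have [tt|tt] := eqVneq t t1; last first.
  have -> : t = ~~ t1 by case: t t1 tt {d1c} => -[].
  exists (next c (e, t1)); last by have /eqP /= := next_cycle cc d1c.
  apply/eqP => h; have nc : next c (e, t1) \in c by rewrite mem_next.
  have : next c (e, t1) = (e, t1) by apply: (uniq_map_inj uc nc d1c); rewrite h.
  by rewrite h => -[]; case: (t1).
subst t1; have pc : prev c (e, t) \in c by rewrite mem_prev.
exists ((prev c (e, t)).1, ~~ (prev c (e, t)).2); last by have /eqP /= := prev_cycle cc d1c.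
apply/eqP => -[h1 h2].
have h : prev c (e, t) = (e, t) by apply: (uniq_map_inj uc pc d1c).
by move: h2; rewrite h /=; case: (t).
Qed.

Lemma next_neq (T : eqType) (c : seq T) x y : uniq c -> x \in c -> y \in c -> y != x -> next c x != x.
Proof.
move=> uc xc yc yx; have [i c' Hc] := rot_to xc.
rewrite -(next_rot i uc) Hc; have ur : uniq (x :: c') by rewrite -Hc rot_uniq.
have : y \in x :: c' by rewrite -Hc mem_rot.
rewrite inE (negbTE yx) /=; case: c' ur {Hc} => //= z c' + _.
by rewrite eqxx inE negb_or eq_sym => /andP[/andP[]].
Qed.

(** [next] on an enumeration without repetition of the half-edges at a vertex is a cyclic
    permutation, without fixed point as soon as there are two of them. *)
Lemma vertex_rotation : (forall d : HE, exists2 d' : HE, d' != d & vert d' = vert d) ->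
  exists p : HE -> HE, [/\ injective p, forall d, p d != d & forall d, vert (p d) = vert d].
Proof.
move=> H; pose c (v : gvertex G) := enum [pred d : HE | vert d == v].
have uc v : uniq (c v) by exact: enum_uniq.
have inc d v : (d \in c v) = (vert d == v) by rewrite mem_enum inE.
pose p d := next (c (vert d)) d.
have pv d : vert (p d) = vert d by apply/eqP; rewrite -inc mem_next inc.
exists p; split => //.
- move=> d d' pp; have vv : vert d = vert d' by rewrite -pv pp pv.
  by move: pp; rewrite /p vv; exact: (can_inj (prev_next (uc _))).
- move=> d; have [d' dd' vd'] := H d.
  by apply: (next_neq (uc _) _ _ dd'); rewrite inc ?vd'.
Qed.

End cycles.

(** * Exact constants, monotonicity in B and the limit *)

Section positivity.
Context {R : realType} (N : nat).
Local Notation X := 'rV[R]_N.+1.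
Local Notation mu := (leb R N.+1).
Local Notation half := (@half_space R N).
Local Notation q := (two_star R N).
Local Notation s := (2 / N.+1%:R : R).

Lemma Lpow_bump_gt0 p : (0 < Lpow setT p (@cutn R N.+1 0))%E.
Proof.
apply: (@lt_le_trans _ _ (mu (box 1))).
  by rewrite leb_boxE// lte_fin exprn_gt0// mulr2n addr_gt0.
have mB := @measurable_box R N.+1 1.
rewrite -[leLHS]mul1e -integral_cst//.
have mf : measurable_fun setT (fun z => (`|@cutn R N.+1 0 z| `^ p)%:E).
  apply/measurable_EFinP; apply: measurable_powR_comp; apply: measurableT_comp => //.
  by apply: Cc_measurable; exact: Cc_cutn.
apply: (@le_trans _ _ (\int[mu]_(z in box 1) (`|cutn 0 z| `^ p)%:E)%E).
  rewrite le_eqVlt; apply/orP; left; apply/eqP; apply: eq_integral => z /set_mem zB.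
  rewrite cutn_eq1 ?normr1 ?powR1//; exact: norm_le_box.
exact: ge0_subset_integral.
Qed.

Lemma K_setT_gt0 : (0 < K_domain [set: X])%E.
Proof.
rewrite ltNge; apply/negP => K0.
have := K_domain_gn measurableT (lexx 0) K0 (H1_Cc measurableT (@Cc_cutn R N.+1 0)).
by rewrite /gn mul0e leNgt Lpow_bump_gt0.
Qed.

Lemma K_setT_fin : K_domain [set: X] \is a fin_num.
Proof. by rewrite ge0_fin_numE; [exact: K_setT_lty|exact: ltW K_setT_gt0]. Qed.

Lemma K_half_eq : K_domain half = ((2 `^ s)%:E * K_domain [set: X])%E.
Proof.
have k0 : 0 <= fine (K_domain [set: X]) by rewrite fine_ge0// ltW// K_setT_gt0.
have le1 : (K_domain half <= (2 `^ s * fine (K_domain [set: X]))%:E)%E.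
  by apply: K_domain_half_le => //; rewrite fineK ?K_setT_fin.
(* The supremum is taken among extended reals, where a negative value must be ruled out: it would
   make the constant of the whole space nonpositive. *)
have h0 : (0 <= K_domain half)%E.
  rewrite leNgt; apply/negP => h; have := @K_domain_half_ge R N 0 (lexx 0) (ltW h).
  by rewrite mul0r leNgt K_setT_gt0.
have hfin : K_domain half \is a fin_num by rewrite ge0_fin_numE// (le_lt_trans le1)// ltry.
apply/eqP; rewrite eq_le; apply/andP; split.
  by rewrite -[X in (_ <= _ * X)%E](fineK K_setT_fin) -EFinM.
have le2 : (K_domain half <= (fine (K_domain half))%:E)%E by rewrite fineK.
have := K_domain_half_ge (fine_ge0 h0) le2.
rewrite -[X in (X <= _)%E](fineK K_setT_fin) lee_fin ler_pdivlMr ?powR_gt0// mulrC => H.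
by rewrite -(fineK K_setT_fin) -(fineK hfin) -EFinM lee_fin.
Qed.

Variable G : metric_graph R.

Lemma K_graph_gt0 B : 0 <= B -> (0 < K_graph N G B)%E.
Proof.
move=> B0; rewrite ltNge; apply/negP => h.
by have := K_setT_le_graph B0 (lexx 0) h; rewrite leNgt K_setT_gt0.
Qed.

Lemma K_graph_le (B k : R) : 0 <= B -> 0 <= k -> (forall (u : gedge G -> X -> R) g, H1_graph u g ->
  (Lpow_graph q u <= k%:E * ((dirichlet_graph g + (B / total_length G ^+ 2)%:E * Lpow_graph 2 u)
     * Lpow_graph 2 u `^ s))%E) -> (K_graph N G B <= k%:E)%E.
Proof.
move=> B0 k0 H; apply: ub_ereal_sup => _ [u [g [Hg u0 ->]]].
have [f1 f2] := H1_graph_fin Hg; have := H _ _ Hg.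
have b0 : 0 <= B / total_length G ^+ 2 by rewrite divr_ge0// sqr_ge0.
rewrite norm_two_star ?Lpow_graph_ge0// (den_EFin k _ s f2 f1).
have := den_EFin 1 (B / total_length G ^+ 2) s f2 f1; rewrite mul1e mul1r => ->.
rewrite ediv_le//; first exact: Lpow_graph_ge0.
apply: mulr_ge0 (powR_ge0 _ _).
exact: addr_ge0 (fine_ge0 (dirichlet_graph_ge0 _)) (mulr_ge0 b0 (fine_ge0 (Lpow_graph_ge0 _ _))).
Qed.

Lemma K_graph_antitone (B B' k : R) : 0 <= B <= B' -> 0 <= k -> (K_graph N G B <= k%:E)%E ->
  (K_graph N G B' <= k%:E)%E.
Proof.
move=> /andP[B0 BB] k0 Kk; apply: (K_graph_le (le_trans B0 BB) k0) => u g Hg.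
apply: (le_trans (K_graph_gn B0 k0 Kk Hg)).
apply: lee_wpmul2l; first by rewrite lee_fin.
apply: lee_wpmul2r; first exact: poweR_ge0.
apply: leeD2l; apply: lee_wpmul2r; first exact: Lpow_graph_ge0.
by rewrite lee_fin ler_wpM2r// invr_ge0 sqr_ge0.
Qed.

Lemma le_of_eps (a c : R) : 0 <= c -> (forall eps : R, 0 < eps <= 1 -> a <= c * (1 + eps)) -> a <= c.
Proof.
move=> c0 H; apply/ler_addgt0Pr => e e0.
have c1 : 0 < c + 1 by rewrite ltr_wpDl.
pose eps := Num.min 1 (e / (c + 1)).
have ep0 : 0 < eps by rewrite lt_min ltr01 divr_gt0.
have ep1 : eps <= 1 by rewrite ge_min lexx.
have ep2 : eps <= e / (c + 1) by rewrite ge_min lexx orbT.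
apply: (le_trans (H eps _)); first by rewrite ep0.
rewrite mulrDr mulr1 lerD2l; move: ep2; rewrite ler_pdivlMr//; nra.
Qed.

(** [K_graph] decreases in [B], so its limit is an infimum. The other two clauses turn bounds on the
    limit into statements about one finite [B] at a time, for lower bounds, and about [cut_ineq],
    for upper bounds. *)
Lemma K_graph_cvg : exists Kinf : R, [/\ K_graph N G B @[B --> +oo] --> Kinf%:E,
  forall c : R, (forall B k : R, 0 <= B -> 0 <= k -> (K_graph N G B <= k%:E)%E -> c <= k) -> c <= Kinf &
  forall c : R, 0 <= c -> @cut_ineq R N G c -> Kinf <= c].
Proof.
pose kh : R := 2 `^ s * fine (K_domain [set: X]).
have kT0 : 0 <= fine (K_domain [set: X]) by rewrite fine_ge0// ltW// K_setT_gt0.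
have kh0 : 0 <= kh by rewrite mulr_ge0// powR_ge0.
have Kh : (K_domain half <= kh%:E)%E by rewrite K_half_eq EFinM fineK ?K_setT_fin.
have one01 : 0 < (1 : R) <= 1 by rewrite lexx ltr01.
(* The case [eps = 1] gives a threshold from which the constants are finite; the infimum is taken
   beyond it. *)
have [B1 B10 HB1] := K_graph_le_of_cut kh0 one01 (@cut_ineq_half R N G _ kh0 Kh).
pose f B := K_graph N G B.
have fpos B : B1 <= B -> (0 < f B)%E by move=> h; apply: K_graph_gt0; exact: le_trans h.
have ffin B : B1 <= B -> f B \is a fin_num.
  by move=> h; rewrite ge0_fin_numE ?ltW ?fpos// (le_lt_trans (HB1 _ h))// ltry.
pose S := [set fine (f B) | B in [set B | B1 <= B]].
have S0 : S !=set0 by exists (fine (f B1)); exists B1 => /=.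
have fine0 B : B1 <= B -> 0 <= fine (f B) by move=> h; rewrite fine_ge0// ltW// fpos.
have lbS : lbound S 0 by move=> _ [B /= h <-]; exact: fine0.
have anti B B' : B1 <= B -> B <= B' -> fine (f B') <= fine (f B).
  move=> h1 h2; rewrite -lee_fin fineK ?ffin ?(le_trans h1)//.
  apply: (@K_graph_antitone B) => //; [by rewrite h2 (le_trans B10)|exact: fine0|].
  by rewrite (fineK (ffin _ h1)).
have infle B : B1 <= B -> inf S <= fine (f B).
  by move=> h; apply: ge_inf; [exists 0|exists B].
exists (inf S); split.
- apply/fine_cvgP; split.
    by exists B1; split; [exact: num_real|move=> B h; apply: ffin; exact: ltW].
  apply/cvgrPdist_le => e e0.
  have [_ [B2 /= hB2 <-] h2] := inf_adherent e0 (conj S0 (ex_intro _ 0 lbS)).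
  exists B2; split; first exact: num_real.
  move=> B /= hB; have hB' : B1 <= B by exact: le_trans hB2 (ltW hB).
  rewrite distrC ger0_norm ?subr_ge0 ?infle// lerBlDl.
  exact: le_trans (anti _ _ hB2 (ltW hB)) (ltW h2).
- move=> c H; apply: lb_le_inf => // _ [B /= hB <-].
  apply: (H B); [exact: le_trans hB|exact: fine0|by rewrite fineK ?ffin].
move=> c c0 Hc; apply: (le_of_eps c0) => eps e01.
have [B2 B20 HB2] := K_graph_le_of_cut c0 e01 Hc.
pose B := Num.max B1 B2.
have hB1 : B1 <= B by rewrite le_max lexx.
have hB2 : B2 <= B by rewrite le_max lexx orbT.
apply: (le_trans (infle B hB1)).
by rewrite -lee_fin (fineK (ffin _ hB1)); exact: HB2.
Qed.

End positivity.

Theorem corollary4p12 (R : realType) (N : nat) (hN : (1 <= N)%N)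
    (G : metric_graph R) :
  exists Kinf : R,
    [/\ K_graph N G B @[B --> +oo] --> Kinf%:E,
        (@K_domain R N setT <= Kinf%:E <= K_domain (@half_space R N))%E,
        covered_by_cycles G -> Kinf%:E = @K_domain R N setT &
        has_terminal_edge G ->
          Kinf%:E = K_domain (@half_space R N) /\
          K_domain (@half_space R N) =
            ((2 `^ (2 / N.+1%:R))%:E * @K_domain R N setT)%E].
Proof.
have [Kinf [Kcvg Kge Kle]] := @K_graph_cvg R N G.
have kf := @K_setT_fin R N; pose k := fine (@K_domain R N setT).
have k0 : 0 <= k by rewrite fine_ge0// ltW// K_setT_gt0.
have kE : @K_domain R N setT = k%:E by rewrite fineK.
have Kh : K_domain (@half_space R N) = (2 `^ (2 / N.+1%:R) * k)%:E by rewrite K_half_eq kE.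
have kh0 : 0 <= 2 `^ (2 / N.+1%:R) * k by rewrite mulr_ge0// powR_ge0.
have low : k <= Kinf.
  by apply: Kge => B c B0 c0 Kc; rewrite -lee_fin -kE; exact: K_setT_le_graph Kc.
have up : Kinf <= 2 `^ (2 / N.+1%:R) * k.
  by apply: Kle => //; apply: cut_ineq_half => //; rewrite Kh.
exists Kinf; split.
- exact: Kcvg.
- by rewrite kE Kh !lee_fin low.
- move=> cov; rewrite kE; congr EFin; apply/eqP; rewrite eq_le low andbT.
  have [p [pI pd pv]] := vertex_rotation (covered_half_edge cov).
  by apply: Kle => //; apply: (cut_ineq_full k0 _ pI pd pv); rewrite kE.
- move=> term; rewrite Kh kE; split => //; congr EFin; apply/eqP; rewrite eq_le up /=.
  apply: Kge => B c B0 c0 Kc.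
  have := K_setT_le_terminal term B0 c0 Kc; rewrite kE lee_fin.
  by rewrite ler_pdivlMr ?powR_gt0// mulrC.
Qed.
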